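(* The stable singularities of tangential family germs are exactly the following two: singularity $\mathrm{I}$, i.e. the $\mathcal{A}$-equivalence class of the germ at the origin of $(\xi,t)\mapsto(\xi+t,\,t^2)$, and singularity $\mathrm{II}$, i.e. the $\mathcal{A}$-equivalence class of the germ at the origin of $(\xi,t)\mapsto(\xi+t,\,t^2\xi)$. That is, the singularity of a tangential family germ is stable if and only if it is $\mathrm{I}$ or $\mathrm{II}$. Moreover, the extended codimension of singularity $\mathrm{I}$ is $0$ and the extended codimension of singularity $\mathrm{II}$ is $1$.
   Context: All objects are $C^\infty$. Let $(\xi,t)$ be coordinates on the source plane $\mathbb{R}^2$ and $(x,y)$ on the target plane. A map $f:\mathbb{R}^2\to\mathbb{R}^2$ (with $\partial_t f$ nowhere vanishing) parameterizes a tangential family if $\partial_\xi f$ and $\partial_t f$ are parallel nonzero vectors at every point $(\xi,t=0)$ and the image of $f(\cdot,0)$ is an embedded curve, called the support. Germs: let $\mathscr{E}_{\xi,t}$ be the ring of function germs $(\mathbb{R}^2,0)\to\mathbb{R}$ in the variables $\xi,t$, and $\mathfrak{m}_{\xi,t}$ the ideal of germs vanishing at the origin. A tangential family germ is an element of $(\mathfrak{m}_{\xi,t})^2$ (a map germ $(\mathbb{R}^2,0)\to(\mathbb{R}^2,0)$) parameterizing a tangential family; $X_0\subset(\mathfrak{m}_{\xi,t})^2$ is the set of such germs. Left-Right equivalence: $\mathcal{A}=\mathrm{Diff}(\mathbb{R}^2,0)\times\mathrm{Diff}(\mathbb{R}^2,0)$, where $\mathrm{Diff}(\mathbb{R}^2,0)$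 is the group of diffeomorphism germs of the plane fixing the origin; it acts on $(\mathfrak{m}_{\xi,t})^2$ by $(\phi,\psi)\cdot f=\psi\circ f\circ\phi^{-1}$. Two germs are $\mathcal{A}$-equivalent if they lie in the same orbit. The singularity of a tangential family germ is its $\mathcal{A}$-equivalence class. The singularity of a map at a point other than the origin is the class of its germ there after translating the point and its image to the origins. Tangential deformations: a $p$-parameter tangential deformation of a tangential family $f$ is a smooth map $F:\mathbb{R}^2\times\mathbb{R}^p\to\mathbb{R}^2$ such that $F_\lambda:=F(\cdot;\lambda)$ is a tangential family for every $\lambda$ and $F_0=f$; similarly for germs (with $F$ a germ at $(0;0)$; $F_\lambda$ need not fix the origin for $\lambda\ne0$). The notion extends to the whole $\mathcal{A}$-orbit of a tangential family germ via the action: if $g=\psi\circ f\circ\phi^{-1}$ with $f\in X_0$, the deformations $\psi\circ F_\lambda\circ\phi^{-1}$, with $F_\lambda$ a tangential deformation of $f$, are tangential deformations of $g$. Stability: a singularity is stable if for every representative $f$ of it, every tangential deformation $F_\lambda$ of $f$ has a singularity $\mathcal{A}$-equivalent to that of $f$ at some $\lambda$-depending point, arbitrarily close to the origin for $\lambda$ small enough. Extended codimension: the extended tangent space at $f$ to its $\mathcal{A}$-orbit is $T_e\mathcal{A}(f)=\langle\partial_\xi f,\partial_t f\rangle_{\mathscr{E}_{\xi,t}}+f^*(\mathscr{E}_{x,y})\cdot\mathbb{R}^2\subset\mathscr{E}_{\xi,t}^2$, where $\mathscr{E}_{x,y}$ is the ring of function germs at the origin of the target plane and $f^*g=g\circ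 f$. The extended codimension of $f$ is $\dim_{\mathbb{R}}\mathscr{E}_{\xi,t}^2/T_e\mathcal{A}(f)$; the extended codimension of a singularity is that of any representative. *)

(* Defs.v *)
From mathcomp Require Import all_boot all_order all_algebra.
From mathcomp Require Import all_classical all_reals all_analysis.
Set Implicit Arguments.
Unset Strict Implicit.
Unset Printing Implicit Defensive.
Import Order.TTheory GRing.Theory Num.Theory.
Import numFieldNormedType.Exports.
Local Open Scope classical_set_scope.
Local Open Scope ring_scope.

(* Coordinates (xi, t) on the source, (x, y) on the target. *)
Notation plane R := (R * R)%type.

Section Smooth.
Context {R : realType} {V W : normedModType R}.

(* C^n on an open set U of a finite-dimensional space V. *)
Fixpoint Cn_on (n : nat) (U : set V) (f : V -> W) : Prop :=
  match n with
  | 0%N => forall x, U x -> {for x, continuous f}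
  | m.+1 => (forall x, U x -> differentiable f x) /\
            (forall v : V, Cn_on m U ('D_v f))
  end.

Definition smooth_on (U : set V) (f : V -> W) : Prop :=
  forall n, Cn_on n U f.

(* A germ at a is represented by a total function; only its values near a
   matter, and two functions represent the same germ when they agree near a. *)
Definition smooth_germ (a : V) (f : V -> W) : Prop :=
  exists U : set V, [/\ open U, U a & smooth_on U f].

End Smooth.

Section LeftRight.
Context {R : realType}.
Implicit Types f g phi psi : plane R -> plane R.

(* phi represents an element of Diff(R^2, 0), with inverse phi'. *)
Definition diffeo_germ phi phi' : Prop :=
  [/\ smooth_germ 0 phi, smooth_germ 0 phi', phi 0 = 0, phi' 0 = 0 &
      (\forall z \near (0 : plane R), phi' (phi z) = z) /\
      (\forall z \near (0 : plane R), phi (phi' z) = z)].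

Definition A_equiv f g : Prop :=
  exists phi phi' psi psi',
    [/\ diffeo_germ phi phi', diffeo_germ psi psi' &
        \forall z \near (0 : plane R), g z = psi (f (phi' z))].

(* The singularity of f at the origin: the set of all representatives of the
   germs in the orbit of f. *)
Definition singularity f : set (plane R -> plane R) := [set g | A_equiv f g].

Definition germ_at f (q : plane R) : plane R -> plane R :=
  fun z => f (q + z) - f q.

End LeftRight.

Section TangentialFamilies.
Context {R : realType}.
Implicit Types f g G : plane R -> plane R.

Definition d_xi f : plane R -> plane R := 'D_((1, 0) : plane R) f.
Definition d_t f : plane R -> plane R := 'D_((0, 1) : plane R) f.

Definition box (r : R) : set (plane R) := [set z | `|z.1| < r /\ `|z.2| < r].

Definition parallel (u v : plane R) : Prop := exists k : R, u = k *: v.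

(* The continuous curve c is a homeomorphism from ]-r, r[ onto its image; for
   an immersion this says that it is an embedding. *)
Definition embeds (r : R) (c : R -> plane R) : Prop :=
  exists k : plane R -> R,
    (forall x, `|x| < r -> k (c x) = x) /\
    {within c @` [set x | `|x| < r], continuous k}.

Definition tangential_on (r : R) f : Prop :=
  [/\ smooth_on (box r) f,
      forall z, box r z -> d_t f z != 0,
      forall xi, `|xi| < r ->
        [/\ d_xi f (xi, 0) != 0, d_t f (xi, 0) != 0 &
            parallel (d_xi f (xi, 0)) (d_t f (xi, 0))] &
      embeds r (fun xi => f (xi, 0))].

Definition tangential_family_germ f : Prop :=
  f 0 = 0 /\ exists2 r : R, 0 < r & tangential_on r f.

(* F is a germ at (0; 0), so the neighbourhood box r of the origin on which
   the F_lambda are tangential families does not depend on lambda. *)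
Definition tangential_deformation0 (p : nat) f
    (F : plane R * 'rV[R]_p -> plane R) : Prop :=
  exists r s : R,
    [/\ 0 < r, 0 < s,
        smooth_on (box r `*` [set l | `|l| < s]) F,
        forall l : 'rV[R]_p, `|l| < s -> tangential_on r (fun z => F (z, l)) &
        \forall z \near (0 : plane R), F (z, 0) = f z].

(* Tangential deformations of a germ g in the A-orbit of a tangential family
   germ. *)
Definition tangential_deformation (p : nat) g
    (G : plane R * 'rV[R]_p -> plane R) : Prop :=
  exists f phi phi' psi psi' (F : plane R * 'rV[R]_p -> plane R),
    [/\ tangential_family_germ f,
        diffeo_germ phi phi' /\ diffeo_germ psi psi',
        \forall z \near (0 : plane R), g z = psi (f (phi' z)),
        tangential_deformation0 f F &
        \forall w \near (0 : plane R * 'rV[R]_p),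
          G w = psi (F (phi' w.1, w.2))].

Definition stable (S : set (plane R -> plane R)) : Prop :=
  forall f, S f -> forall (p : nat) (F : plane R * 'rV[R]_p -> plane R),
    tangential_deformation f F ->
    forall U : set (plane R), nbhs (0 : plane R) U ->
    \forall l \near (0 : 'rV[R]_p),
      exists2 q, U q & A_equiv f (germ_at (fun z => F (z, l)) q).

(* h belongs to the extended tangent space T_e A(f); u is an element of
   E_{x,y}^2 = E_{x,y} . R^2. *)
Definition ext_tangent f (h : plane R -> plane R) : Prop :=
  exists (a b : plane R -> R) (u : plane R -> plane R),
    [/\ smooth_germ 0 a, smooth_germ 0 b, smooth_germ 0 u &
        \forall z \near (0 : plane R),
          h z = a z *: d_xi f z + b z *: d_t f z + u (f z)].

(* dim E_{xi,t}^2 / T_e A(f) = d: the classes of e_0, ..., e_(d-1) form a basis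
   of the quotient. *)
Definition ext_codim f (d : nat) : Prop :=
  exists e : 'I_d -> plane R -> plane R,
    [/\ forall i, smooth_germ 0 (e i),
        forall h : plane R -> plane R, smooth_germ 0 h ->
          exists c : 'I_d -> R,
            ext_tangent f (fun z => h z - \sum_i c i *: e i z) &
        forall c : 'I_d -> R,
          ext_tangent f (fun z => \sum_i c i *: e i z) -> forall i, c i = 0].

Definition singularity_ext_codim (S : set (plane R -> plane R)) (d : nat) :=
  forall f, S f -> ext_codim f d.

End TangentialFamilies.

Definition germI (R : realType) : plane R -> plane R :=
  fun z => (z.1 + z.2, z.2 ^+ 2).
Definition germII (R : realType) : plane R -> plane R :=
  fun z => (z.1 + z.2, z.2 ^+ 2 * z.1).
Arguments germI : clear implicits.
Arguments germII : clear implicits.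

Definition singularityI (R : realType) := singularity (germI R).
Definition singularityII (R : realType) := singularity (germII R).
Arguments singularityI : clear implicits.
Arguments singularityII : clear implicits.

(* Main.v *)
(** The Jacobian determinant of a tangential family germ vanishes along the
    support, so that by Hadamard's lemma the germ is left-right equivalent to one
    of the form [(u, t) |-> (u, t^2 c(u, t))].

    If [c 0 <> 0], rescaling [t] by a square root of [c] gives I.  If [c 0 = 0]
    and both partial derivatives of [c] are nonzero at the origin, the fibre
    map [t |-> t^2 c(u, t)] has besides [t = 0] a critical point depending
    smoothly on [u]; it is a versal perturbation of a cubic and is straightened
    to [u t^2 - t^3], which is II.  The two cases are detected by the Jacobian
    determinant [J]: in the first [dJ <> 0] at the origin, in the second [J] has
    a nondegenerate critical point there and the kernel of the differential is
    not isotropic for its Hessian.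

    These conditions are left-right invariant and persist under tangential
    deformations (for II the critical point of [J] moves along the support,
    where [J] vanishes identically), which gives stability.  In all the other
    cases deform by [c + l0 + l1 u + l2 t]: the set of [l] for which a critical
    point of [J] violating the conditions exists near the origin is covered by
    three Lipschitz images of plane squares, hence contains no cube, so some
    arbitrarily small [l] avoids the original singularity near the origin.

    The extended codimensions are computed on the normal forms [(u, t^2)] and
    [(u, u t^2 - t^3)] by Hadamard's lemma, and transported along diffeomorphisms. *)

Require Import Defs.
From HB Require Import structures.
From mathcomp Require Import all_boot all_order all_algebra.
From mathcomp Require Import all_classical all_reals all_analysis.
From mathcomp Require Import ring lra zify.
Set Implicit Arguments.
Unset Strict Implicit.
Unset Printing Implicit Defensive.
Import Order.TTheory GRing.Theory Num.Theory.
Import numFieldNormedType.Exports.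
Local Open Scope classical_set_scope.
Local Open Scope ring_scope.

(** * Calculus of smooth germs *)

Section CnCalculus.
Context {R : realType}.
Implicit Types U V W X : normedModType R.

(** On [(u, t^2 c)] the Jacobian determinant is [t m] with [m = 2 c + t d_t c], and every condition
    is read off from [m]. On the support the Hessian of [t m] has the entries [0], [d_u m],
    [2 d_t m], and the kernel of the differential is the [t] direction; so II means [m = 0] with
    both derivatives of [m] nonzero. The same formula gives the dimension count behind instability.
    Off the support a critical point satisfies [m = d_u m = d_t m = 0], three equations that
    determine the three deformation parameters from the two coordinates of the point. On the support
    a degenerate point has one coordinate and two equations, which leave one parameter free. Bad
    parameters thus depend on two real variables, and a pigeonhole argument on a grid takes the
    place of measure theory. Two obstacles shape the statements. A germ [(u, t^2 c)] is not itself a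
    tangential family, since its [t] derivative vanishes on the support; deformations are built
    after a shear of the source. And stability speaks of displaced points, so coordinate changes and
    invariants are needed at all points near the origin. *)

Lemma is_diff_deriveE V W (f df : V -> W) x v :
  is_diff x f df -> 'D_v f x = df v.
Proof. by move=> [fx <-]; rewrite deriveE. Qed.

Lemma is_diff_eps V W (f : V -> W) (L : {linear V -> W}) x : continuous L ->
  (forall e : R, 0 < e ->
    \forall h \near (0 : V), `|f (h + x) - f x - L h| <= e * `|h|) ->
  is_diff x f L.
Proof.
move=> cL fL.
have E : f \o shift x = cst (f x) + L +o_ 0 id.
  apply/eqaddoP => e e0; have := fL _ e0; apply: filterS => h /=.
  by rewrite opprD addrA.
have dE : 'd f x = L :> (V -> W) by exact: diff_unique.
apply: DiffDef => //; apply/diff_locallyP; rewrite dE; split => //.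
Qed.

Lemma diff_eps V W (f : V -> W) x : differentiable f x ->
  forall e : R, 0 < e ->
    \forall h \near (0 : V), `|f (h + x) - f x - 'd f x h| <= e * `|h|.
Proof.
move=> /diff_locally /eqaddoP fo e e0; have := fo _ e0.
by apply: filterS => h /=; rewrite opprD addrA.
Qed.

Lemma near_eq_differentiable V W (f g : V -> W) x :
  (\near x, f x = g x) -> differentiable f x -> differentiable g x.
Proof.
move=> fg df.
suff : is_diff x g ('d f x) by case.
apply: is_diff_eps => [|e e0]; first exact: diff_continuous.
have fgx := nbhs_singleton fg.
have := diff_eps df e0; move: fg; rewrite (near_shift 0 x) subr0 => fg.
by apply: filterS2 fg => h /= <-; rewrite fgx.
Qed.

Lemma near_eq_continuous V W (f g : V -> W) x :
  (\near x, f x = g x) -> {for x, continuous f} -> {for x, continuous g}.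
Proof.
move=> fg; rewrite /prop_for /continuous_at -(nbhs_singleton fg) => fc.
exact: cvg_trans (near_eq_cvg fg) fc.
Qed.

Lemma is_diffZ_fun V W (k dk : V -> R) (f df : V -> W) x :
  is_diff x k dk -> is_diff x f df ->
  is_diff x (fun z => k z *: f z) (fun v => dk v *: f x + k x *: df v).
Proof.
move=> kx fx.
(* Scalar multiplication is continuous and bilinear, so the product rule is the chain rule through
   the pair [(k, f)]. *)
have bil : bilinear_for (GRing.Scale.Law.clone _ _ *:%R _)
    (GRing.Scale.Law.clone _ _ *:%R _) (@GRing.scale R W).
  split=> [u'|u] a y z /=; first by rewrite scalerDl scalerA.
  by rewrite scalerDr !scalerA mulrC.
pose bM := bilinear_isBilinear.Build R R W W _ _ (@GRing.scale R W) bil.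
pose bL : {bilinear R -> W -> W} := HB.pack (@GRing.scale R W) bM.
have bc : continuous (fun p : R * W => bL p.1 p.2).
  by move=> p; apply: cvgZ; [exact: cvg_fst|exact: cvg_snd].
have bd p : is_diff p (fun q : R * W => q.1 *: q.2)
    (fun q : R * W => p.1 *: q.2 + q.1 *: p.2).
  split; first exact: (differentiable_bilin p bc).
  exact: (diff_bilin p bc).
have kf := is_diff_pair kx fx.
apply: is_diff_eq (is_diff_comp kf (bd (k x, f x))) _.
by apply/funext => v /=; rewrite addrC.
Qed.

Lemma Cn_onS V W n (D : set V) (f : V -> W) : Cn_on n.+1 D f -> Cn_on n D f.
Proof.
elim: n f => [|n IH] f [fd fD]; first by move=> x /fd/differentiable_continuous.
by split => // v; apply: IH.
Qed.

Lemma Cn_on_sub V W n (D D' : set V) (f : V -> W) : D' `<=` D ->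
  Cn_on n D f -> Cn_on n D' f.
Proof.
move=> DD; elim: n f => [|n IH] f /=; first by move=> h x /DD/h.
by move=> [h1 h2]; split => [x /DD/h1|v] //; apply/IH/h2.
Qed.

Lemma Cn_on_diff V W n (D : set V) (f : V -> W) x : Cn_on n.+1 D f -> D x ->
  differentiable f x.
Proof. by move=> [h _] /h. Qed.

Lemma Cn_on_ext V W n (D : set V) (f g : V -> W) : open D ->
  (forall x, D x -> f x = g x) -> Cn_on n D f -> Cn_on n D g.
Proof.
move=> oD; elim: n f g => [|n IH] f g fg.
  move=> h x Dx; apply: near_eq_continuous (h x Dx).
  by apply: filterS (open_nbhs_nbhs (conj oD Dx)) => y /fg.
have near x : D x -> \near x, f x = g x.
  by move=> Dx; apply: filterS (open_nbhs_nbhs (conj oD Dx)) => y /fg.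
move=> [fd fD]; split => [x Dx|v].
  exact: near_eq_differentiable (near _ Dx) (fd _ Dx).
apply: IH (fD v) => x Dx; apply: near_eq_derive; exact: near.
Qed.

(** The induction step of the closure properties: a formula for the differential, valid on [D] only,
    whose value along each fixed vector is [C^n]. As ['D_v f] is a total function, openness of [D]
    is what lets the formula replace it. *)
Lemma Cn_on_step V W n (D : set V) (f : V -> W) (df : V -> V -> W) : open D ->
  (forall x, D x -> is_diff x f (df x)) ->
  (forall v, Cn_on n D (fun x => df x v)) -> Cn_on n.+1 D f.
Proof.
move=> oD fd fD; split => [x /fd []|v] //.
apply: Cn_on_ext (fD v) => // x /fd fx.
by rewrite (is_diff_deriveE _ fx).
Qed.

Lemma Cn_on_cst V W n (D : set V) (c : W) : open D -> Cn_on n D (cst c).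
Proof.
move=> oD; elim: n c => [|n IH] c; first by move=> x _; exact: cst_continuous.
apply: (@Cn_on_step _ _ _ _ _ (fun _ => 0)) => // v; exact: IH.
Qed.

Lemma Cn_on_linear V W n (D : set V) (f : {linear V -> W}) : open D ->
  continuous f -> Cn_on n D f.
Proof.
move=> oD fc; case: n => [|n]; first by move=> x _; exact: fc.
apply: (@Cn_on_step _ _ _ _ _ (fun _ => f)) => //.
  move=> x _; split; [exact: linear_differentiable|exact: diff_lin].
move=> v; exact: Cn_on_cst.
Qed.

Lemma Cn_onD V W n (D : set V) (f g : V -> W) : open D ->
  Cn_on n D f -> Cn_on n D g -> Cn_on n D (fun x => f x + g x).
Proof.
move=> oD; elim: n f g => [|n IH] f g.
  by move=> fc gc x Dx; apply: continuousD; [exact: fc|exact: gc].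
move=> [fd fD] [gd gD].
apply: (@Cn_on_step _ _ _ _ _ (fun x v => 'd f x v + 'd g x v)) => //.
  by move=> x Dx; apply: (@is_diffD _ _ _ f g); apply: differentiableP; auto.
move=> v; apply: (@Cn_on_ext _ _ _ _ (fun x => 'D_v f x + 'D_v g x)) => //.
  by move=> x Dx; rewrite !deriveE //; auto.
exact: IH (fD v) (gD v).
Qed.

Lemma Cn_onZ V W n (D : set V) (k : V -> R) (f : V -> W) : open D ->
  Cn_on n D k -> Cn_on n D f -> Cn_on n D (fun x => k x *: f x).
Proof.
move=> oD; elim: n k f => [|n IH] k f.
  by move=> fc gc x Dx; apply: cvgZ; [exact: fc|exact: gc].
move=> kC fC; have [kd kD] := kC; have [fd fD] := fC.
apply: (@Cn_on_step _ _ _ _ _ (fun x v => 'd k x v *: f x + k x *: 'd f x v)) => //.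
  by move=> x Dx; apply: is_diffZ_fun; apply: differentiableP; auto.
move=> v; apply: (@Cn_on_ext _ _ _ _
    (fun x => 'D_v k x *: f x + k x *: 'D_v f x)) => //.
  by move=> x Dx; rewrite !deriveE //; auto.
by apply: Cn_onD => //; [exact: IH (kD v) (Cn_onS fC)|
  exact: IH (Cn_onS kC) (fD v)].
Qed.

Lemma Cn_on_pair V W X n (D : set V) (f : V -> W) (g : V -> X) : open D ->
  Cn_on n D f -> Cn_on n D g -> Cn_on n D (fun x => (f x, g x)).
Proof.
move=> oD; elim: n f g => [|n IH] f g.
  by move=> fc gc x Dx; apply: cvg_pair; [exact: fc|exact: gc].
move=> [fd fD] [gd gD].
apply: (@Cn_on_step _ _ _ _ _ (fun x v => ('d f x v, 'd g x v))) => //.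
  by move=> x Dx; apply: is_diff_pair; apply: differentiableP; auto.
move=> v; apply: (@Cn_on_ext _ _ _ _ (fun x => ('D_v f x, 'D_v g x))) => //.
  by move=> x Dx; rewrite !deriveE //; auto.
exact: IH (fD v) (gD v).
Qed.

Lemma Cn_on_sum V W n (D : set V) m (f : 'I_m -> V -> W) : open D ->
  (forall i, Cn_on n D (f i)) -> Cn_on n D (fun x => \sum_i f i x).
Proof.
move=> oD; elim: m f => [|m IH] f fD.
  apply: (@Cn_on_ext _ _ _ _ (cst 0)) => //; last exact: Cn_on_cst.
  by move=> x _; rewrite big_ord0.
apply: (@Cn_on_ext _ _ _ _ (fun x => f ord0 x + \sum_i f (lift ord0 i) x)) => //.
  by move=> x _; rewrite big_ord_recl.
by apply: Cn_onD => //; apply: IH.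
Qed.

Lemma Cn_onV V n (D : set V) (f : V -> R) : open D ->
  (forall x, D x -> f x != 0) ->
  Cn_on n D f -> Cn_on n D (fun x => (f x)^-1).
Proof.
move=> oD f0; elim: n => [|n IH].
  by move=> fc x Dx; apply: cvgV; [exact: f0|exact: fc].
move=> fC; have [fd fD] := fC.
apply: (@Cn_on_step _ _ _ _ _ (fun x v => - (f x) ^- 2 * 'd f x v)) => //.
  move=> x Dx; split; first by apply: differentiableV; auto.
  by apply: diffV; auto.
move=> v; apply: (@Cn_on_ext _ _ _ _
    (fun x => (- 1) *: ((f x)^-1 *: ((f x)^-1 *: 'D_v f x)))) => //.
  move=> x Dx; rewrite !deriveE //; last by auto.
  by rewrite scaleN1r /GRing.scale /= mulNr mulrA expr2 invfM.
have fI : Cn_on n D (fun x => (f x)^-1) by apply/IH/Cn_onS.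
apply: (@Cn_onZ _ _ _ _ (cst (-1))) => //; first exact: Cn_on_cst.
exact: Cn_onZ oD fI (Cn_onZ oD fI (fD v)).
Qed.

(** The derivative of the composite along [v] is ['D_(L v) f], a derivative along a fixed direction,
    composed with the same affine map. The induction therefore closes without coordinates. *)
Lemma Cn_on_affine V W X n (D : set V) (L : {linear X -> V}) (a : V)
  (f : V -> W) : continuous L -> open D -> Cn_on n D f ->
  Cn_on n [set x | D (L x + a)] (fun x => f (L x + a)).
Proof.
move=> Lc oD.
have ac : continuous (fun x => L x + a).
  by move=> x; apply: continuousD; [exact: Lc|exact: cst_continuous].
have oD' : open [set x | D (L x + a)].
  exact: (open_comp (f := fun x => L x + a)).
elim: n f => [|n IH] f.
  move=> fc x Dx; apply: (continuous_comp (f := fun x => L x + a)).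
    exact: ac.
  exact: fc.
move=> [fd fD].
apply: (@Cn_on_step _ _ _ _ _ (fun x v => 'd f (L x + a) (L v))) => //.
  move=> x Dx.
  have LD : is_diff x (fun x => L x + a) L.
    apply: (is_diff_eq (@is_diffD _ _ _ L (cst a) L 0 x _ _)).
      by split; [exact: linear_differentiable|exact: diff_lin].
    by apply/funext => v /=; rewrite addr0.
  exact: (is_diff_comp LD (differentiableP (fd _ Dx))).
move=> v; apply: (@Cn_on_ext _ _ _ _ (fun x => 'D_(L v) f (L x + a))) => //.
  by move=> x Dx; rewrite deriveE //; auto.
exact: IH (fD (L v)).
Qed.

Lemma Cn_on_linear_comp V W X n (D : set V) (l : {linear X -> W}) (h : V -> X) :
  open D -> continuous l -> Cn_on n D h -> Cn_on n D (fun x => l (h x)).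
Proof.
move=> oD lc; elim: n h => [|n IH] h.
  by move=> hc x Dx; apply: (continuous_comp (f := h) (g := l));
    [exact: hc|exact: lc].
move=> [hd hD].
apply: (@Cn_on_step _ _ _ _ _ (fun x => l \o 'd h x)) => //.
  move=> x Dx; apply: is_diff_comp; first by apply: differentiableP; auto.
  by split; [exact: linear_differentiable|exact: diff_lin].
move=> w; apply: (@Cn_on_ext _ _ _ _ (fun x => l ('D_w h x))) => //.
  by move=> x Dx; rewrite deriveE //; auto.
exact: IH _ (hD w).
Qed.

(** Finite dimension in the form required by the chain rule: the derivative of [f \o g] is a
    derivative of [f] along the varying vector ['D_v g x], and the induction on the order needs it
    as a combination of derivatives along fixed vectors. *)
Definition has_coords X := exists (m : nat) (e : 'I_m -> X)
  (l : 'I_m -> {linear X -> R}),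
  (forall i, continuous (l i)) /\ forall x, x = \sum_i l i x *: e i.

Lemma Cn_on_comp V W X n (D : set V) (D' : set X) (g : V -> X) (f : X -> W) :
  has_coords X -> open D -> open D' -> (forall x, D x -> D' (g x)) ->
  Cn_on n D g -> Cn_on n D' f -> Cn_on n D (f \o g).
Proof.
move=> [m [e [l [lc le]]]] oD oD' gD.
elim: n f g gD => [|n IH] f g gD gC fC.
  move=> x Dx; apply: continuous_comp; first exact: gC.
  by apply: fC; exact: gD.
have [gd gD1] := gC; have [fd fD1] := fC.
apply: (@Cn_on_step _ _ _ _ _ (fun x => 'd f (g x) \o 'd g x)) => //.
  move=> x Dx; apply: is_diff_comp; apply: differentiableP; auto.
move=> v; apply: (@Cn_on_ext _ _ _ _
   (fun x => \sum_i l i ('D_v g x) *: 'D_(e i) f (g x))) => //.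
  move=> x Dx /=; rewrite [in RHS](le ('d g x v)) linear_sum.
  apply: eq_bigr => i _; rewrite linearZ /= !deriveE //; auto.
apply: Cn_on_sum => // i; apply: Cn_onZ => //.
  exact: Cn_on_linear_comp (gD1 v).
exact: IH gD (Cn_onS gC) (fD1 (e i)).
Qed.

End CnCalculus.

(** * Closure properties of smooth germs, mean value theorems, continuous partial derivatives *)

Section SmoothGerms.
Context {R : realType}.
Implicit Types U V W X : normedModType R.

Lemma nbhs_openE V (a : V) (P : set V) : nbhs a P ->
  exists D : set V, [/\ open D, D a & D `<=` P].
Proof.
move=> aP; exists P^°; split; [exact: open_interior|exact: aP|].
exact: interior_subset.
Qed.

Lemma smooth_germ_diff V W (a : V) (f : V -> W) : smooth_germ a f ->
  differentiable f a.
Proof. by move=> [D [oD Da fD]]; exact: Cn_on_diff (fD 1%N) Da. Qed.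

Lemma smooth_germ_cont V W (a : V) (f : V -> W) : smooth_germ a f ->
  {for a, continuous f}.
Proof. by move/smooth_germ_diff/differentiable_continuous. Qed.

Lemma smooth_germ_near V W (a : V) (f : V -> W) : smooth_germ a f ->
  \forall x \near a, smooth_germ x f.
Proof.
move=> [D [oD Da fD]]; apply: filterS (open_nbhs_nbhs (conj oD Da)) => x Dx.
by exists D.
Qed.

Lemma smooth_germ_ext V W (a : V) (f g : V -> W) :
  (\forall x \near a, f x = g x) -> smooth_germ a f -> smooth_germ a g.
Proof.
move=> fg [D [oD Da fD]].
have [D' [oD' Da' DP]] := nbhs_openE fg.
exists (D `&` D'); split; [exact: openI|by []|move=> n].
apply: (@Cn_on_ext _ _ _ _ _ f); first exact: openI.
  by move=> x [_ /DP].
by apply: Cn_on_sub (fD n) => x [].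
Qed.

Lemma smooth_germ_cst V W (a : V) (c : W) : smooth_germ a (fun=> c).
Proof.
exists setT; split; [exact: openT|by []|move=> n].
by apply: Cn_on_cst; exact: openT.
Qed.

Lemma smooth_germ_linear V W (a : V) (L : {linear V -> W}) : continuous L ->
  smooth_germ a L.
Proof.
move=> Lc; exists setT; split; [exact: openT|by []|move=> n].
by apply: Cn_on_linear => //; exact: openT.
Qed.

Lemma smooth_germ_id V (a : V) : smooth_germ a id.
Proof. by apply: (@smooth_germ_linear V V a idfun) => x; exact: cvg_id. Qed.

Lemma smooth_germ_derive V W (a v : V) (f : V -> W) : smooth_germ a f ->
  smooth_germ a ('D_v f).
Proof.
by move=> [D [oD Da fD]]; exists D; split => // n; have [_ /(_ v)] := fD n.+1.
Qed.

Lemma smooth_germ2 V W W' (a : V) (f : V -> W) (g : V -> W') :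
  smooth_germ a f -> smooth_germ a g ->
  exists D : set V, [/\ open D, D a, smooth_on D f & smooth_on D g].
Proof.
move=> [D [oD Da fD]] [D' [oD' Da' gD]].
exists (D `&` D'); split; [exact: openI|by []| |] => n.
  by apply: Cn_on_sub (fD n) => x [].
by apply: Cn_on_sub (gD n) => x [].
Qed.

Lemma smooth_germD V W (a : V) (f g : V -> W) : smooth_germ a f ->
  smooth_germ a g -> smooth_germ a (fun x => f x + g x).
Proof.
move=> fa ga; have [D [oD Da fD gD]] := smooth_germ2 fa ga.
by exists D; split=> // n; exact: Cn_onD.
Qed.

Lemma smooth_germZ V W (a : V) (k : V -> R) (f : V -> W) : smooth_germ a k ->
  smooth_germ a f -> smooth_germ a (fun x => k x *: f x).
Proof.
move=> fa ga; have [D [oD Da fD gD]] := smooth_germ2 fa ga.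
by exists D; split=> // n; exact: Cn_onZ.
Qed.

Lemma smooth_germM V (a : V) (f g : V -> R) : smooth_germ a f ->
  smooth_germ a g -> smooth_germ a (fun x => f x * g x).
Proof. exact: smooth_germZ. Qed.

Lemma smooth_germN V W (a : V) (f : V -> W) : smooth_germ a f ->
  smooth_germ a (fun x => - f x).
Proof.
move=> fa; apply: (@smooth_germ_ext _ _ a (fun x => (-1) *: f x)).
  by apply: nearW => x; rewrite scaleN1r.
apply: (smooth_germZ (k := fun=> -1)) => //; exact: smooth_germ_cst.
Qed.

Lemma smooth_germB V W (a : V) (f g : V -> W) : smooth_germ a f ->
  smooth_germ a g -> smooth_germ a (fun x => f x - g x).
Proof. by move=> fa ga; apply: smooth_germD => //; exact: smooth_germN. Qed.

Lemma smooth_germX V (a : V) (f : V -> R) n : smooth_germ a f ->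
  smooth_germ a (fun x => f x ^+ n).
Proof.
move=> fa; elim: n => [|n IH].
  apply: (@smooth_germ_ext V R a (fun=> 1)); last exact: smooth_germ_cst.
  by apply: nearW => x; rewrite expr0.
apply: (@smooth_germ_ext _ _ a (fun x => f x * f x ^+ n)).
  by apply: nearW => x; rewrite exprS.
exact: smooth_germM.
Qed.

Lemma smooth_germ_pair V W X (a : V) (f : V -> W) (g : V -> X) :
  smooth_germ a f -> smooth_germ a g -> smooth_germ a (fun x => (f x, g x)).
Proof.
move=> fa ga; have [D [oD Da fD gD]] := smooth_germ2 fa ga.
by exists D; split=> // n; exact: Cn_on_pair.
Qed.

Lemma smooth_germ_sum V W (a : V) m (f : 'I_m -> V -> W) :
  (forall i, smooth_germ a (f i)) -> smooth_germ a (fun x => \sum_i f i x).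
Proof.
elim: m f => [|m IH] f fa.
  apply: (@smooth_germ_ext _ _ a (fun=> 0)); last exact: smooth_germ_cst.
  by apply: nearW => x; rewrite big_ord0.
apply: (@smooth_germ_ext _ _ a (fun x => f ord0 x + \sum_i f (lift ord0 i) x)).
  by apply: nearW => x; rewrite big_ord_recl.
by apply: smooth_germD => //; apply: IH.
Qed.

Lemma smooth_germV V (a : V) (f : V -> R) : f a != 0 -> smooth_germ a f ->
  smooth_germ a (fun x => (f x)^-1).
Proof.
move=> f0 fa; have [D [oD Da fD]] := fa.
have [|D' [oD' Da' D'f]] := @nbhs_openE _ a (fun x => f x != 0).
  exact: cvgr_neq0 (smooth_germ_cont fa) f0.
exists (D `&` D'); split; [exact: openI|by []|move=> n].
apply: Cn_onV; [exact: openI|by move=> x [_ /D'f]|].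
by apply: Cn_on_sub (fD n) => x [].
Qed.

Lemma smooth_germ_comp V W X (a : V) (g : V -> X) (f : X -> W) :
  has_coords X -> smooth_germ a g -> smooth_germ (g a) f ->
  smooth_germ a (fun x => f (g x)).
Proof.
move=> Xc ga [D' [oD' Da' fD]]; have [D [oD Da gD]] := ga.
have [|E [oE Ea EP]] := @nbhs_openE _ a (g @^-1` D').
  exact: (smooth_germ_cont ga) (open_nbhs_nbhs (conj oD' Da')).
exists (D `&` E); split; [exact: openI|by []|move=> n].
apply: (@Cn_on_comp _ _ _ _ _ _ D' g f) => //; first exact: openI.
  by move=> x [_ /EP].
by apply: Cn_on_sub (gD n) => x [].
Qed.

Lemma smooth_germ_linear_comp V W X (a : V) (g : V -> X) (L : {linear X -> W}) :
  continuous L -> smooth_germ a g -> smooth_germ a (fun x => L (g x)).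
Proof.
move=> Lc [D [oD Da gD]]; exists D; split => // n.
exact: Cn_on_linear_comp.
Qed.

Lemma smooth_germ_affine V W X (x : X) (L : {linear X -> V}) (a : V)
    (f : V -> W) : continuous L -> smooth_germ (L x + a) f ->
  smooth_germ x (fun y => f (L y + a)).
Proof.
move=> Lc [D [oD Da fD]]; exists [set y | D (L y + a)]; split => //.
  apply: (open_comp (f := fun y => L y + a)) => // y _.
  by apply: continuousD; [exact: Lc|exact: cst_continuous].
by move=> n; exact: Cn_on_affine.
Qed.

Lemma continuous_fst V W : continuous (fst : V * W -> V).
Proof. by move=> x; exact: cvg_fst. Qed.

Lemma continuous_snd V W : continuous (snd : V * W -> W).
Proof. by move=> x; exact: cvg_snd. Qed.

Lemma smooth_germ_fst V W X (a : V) (f : V -> W * X) : smooth_germ a f ->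
  smooth_germ a (fun x => (f x).1).
Proof.
by move=> fa; apply: (@smooth_germ_linear_comp _ _ _ a f fst) => //;
  exact: continuous_fst.
Qed.

Lemma smooth_germ_snd V W X (a : V) (f : V -> W * X) : smooth_germ a f ->
  smooth_germ a (fun x => (f x).2).
Proof.
by move=> fa; apply: (@smooth_germ_linear_comp _ _ _ a f snd) => //;
  exact: continuous_snd.
Qed.

Lemma has_coords_R : has_coords (R : normedModType R).
Proof.
exists 1%N, (fun=> 1), (fun=> idfun); split; first by move=> _ x; exact: cvg_id.
by move=> x; rewrite big_ord1 /= /GRing.scale /= mulr1.
Qed.

Lemma has_coords_prod X Y : has_coords X -> has_coords Y ->
  has_coords (X * Y : normedModType R)%type.
Proof.
move=> [m [e [l [lc le]]]] [n [e' [l' [lc' le']]]].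
exists (m + n)%N, (fun i : 'I_(m + n) => match fintype.split i with
  | inl j => (e j, 0) | inr j => (0, e' j) end).
pose g (i : 'I_(m + n)) : {linear (X * Y)%type -> R} := match fintype.split i with
  
  | inl j => (l j \o fst : {linear _ -> _}) | inr j => (l' j \o snd : {linear _ -> _}) end.
exists g; split=> [i|[x y]].
  rewrite /g; case: (fintype.split i) => j z.
    by apply: continuous_comp; [exact: continuous_fst|exact: lc].
  by apply: continuous_comp; [exact: continuous_snd|exact: lc'].
rewrite big_split_ord /= /g.
under eq_bigr => i _ do rewrite (unsplitK (inl i)) /=.
under [X in _ = _ + X]eq_bigr => i _ do rewrite (unsplitK (inr i)) /=.
have E1 : \sum_i l i x *: ((e i, 0) : X * Y) = (x, 0).
  apply: injective_projections; rewrite raddf_sum /=; first by rewrite -le.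
  by apply: big1 => i _; rewrite scaler0.
have E2 : \sum_i l' i y *: ((0, e' i) : X * Y) = (0, y).
  apply: injective_projections; rewrite raddf_sum /=; last by rewrite -le'.
  by apply: big1 => i _; rewrite scaler0.
by rewrite E1 E2; congr (_, _); rewrite /= ?add0r ?addr0.
Qed.

Lemma has_coords_plane : has_coords (plane R).
Proof. by apply: has_coords_prod; exact: has_coords_R. Qed.

Lemma is_derive_line V W (f : V -> W) (x v : V) (s : R) (d : W) :
  is_derive (s *: v + x) v f d -> is_derive s 1 (fun r : R => f (r *: v + x)) d.
Proof.
have E : (fun h : R => h^-1 *: (((fun r : R => f (r *: v + x)) \o shift s) (h *: 1)
     - f (s *: v + x))) =
   (fun h : R => h^-1 *: ((f \o shift (s *: v + x)) (h *: v) - f (s *: v + x))).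
  apply/funext => h /=; congr (_ *: (f _ - _)).
  by rewrite [h%:A]mulr1 scalerDl addrA.
by move=> [fd fe]; split; [rewrite /derivable E|rewrite /derive E].
Qed.

Lemma MVT_ray V (f : V -> R) (x v : V) (c : R) (df : R -> R) :
  (forall s : R, 0 <= s <= 1 ->
    {for c * s, continuous (fun r : R => f (r *: v + x))}) ->
  (forall s : R, 0 < s < 1 -> is_derive ((c * s) *: v + x) v f (df (c * s))) ->
  exists2 s, 0 < s < 1 & f (c *: v + x) - f x = c * df (c * s).
Proof.
move=> fc fd.
pose g (s : R) := f ((c * s) *: v + x).
have gd (s : R) : s \in `]0, 1[ -> is_derive s 1 g (c * df (c * s)).
  rewrite in_itv /= => s01; have [d1 e1] := is_derive_line (fd _ s01).
  have [d2 e2] : is_derive s 1 (fun s : R => c * s) c.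
    apply: is_derive_eq (is_deriveZ (f := id) c _) _.
    by rewrite /GRing.scale /= mulr1.
  pose k (r : R) := f (r *: v + x).
  have dd : derivable (k \o (fun s => c * s)) s 1.
    apply/derivable1_diffP; apply: (@differentiable_comp _ _ _ _ (fun s => c * s) k).
      by apply/derivable1_diffP; exact: d2.
    by apply/derivable1_diffP; exact: d1.
  have ee := @derive1_comp _ (fun s => c * s) k s d2 d1.
  move: ee; rewrite !derive1E e1 e2 mulrC => ee.
  by split.
have gc : {within `[0, 1], continuous g}.
  apply: continuous_in_subspaceT => s; rewrite inE /= in_itv /= => s01.
  apply: (continuous_comp (f := fun s : R => c * s)
    (g := fun r : R => f (r *: v + x))); last exact: fc.
  by apply: continuousM; [exact: cst_continuous|exact: cvg_id].
have [s s01] := MVT ltr01 gd gc.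
rewrite /g mulr1 mulr0 scale0r add0r subr0 mulr1 => ->.
by exists s => //; move: s01; rewrite in_itv.
Qed.

(** The derivative is not asked for at [s = 0]: this matters at points of the axis [t = 0], where
    the differentiability of the averages below is still to be proved. *)
Lemma MVT_line V (f : V -> R) (x v : V) (c : R) (df : R -> R) : c != 0 ->
  (forall s : R, `|s| <= `|c| -> {for s, continuous (fun r : R => f (r *: v + x))}) ->
  (forall s : R, 0 < `|s| < `|c| -> is_derive (s *: v + x) v f (df s)) ->
  exists2 s, 0 < `|s| < `|c| & f (c *: v + x) - f x = c * df s.
Proof.
move=> c0 fc fd; have cn0 : 0 < `|c| by rewrite normr_gt0.
have itv (s : R) : 0 < s < 1 -> 0 < `|c * s| < `|c|.
  move=> /andP[s0 s1].
  by rewrite normrM (gtr0_norm s0) mulr_gt0 //= gtr_pMr.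
have [||s s01 ->] := @MVT_ray _ f x v c df; last by exists (c * s) => //; exact: itv.
- move=> s /andP[s0 s1]; apply: fc.
  by rewrite normrM (ger0_norm s0) ler_piMr.
- by move=> s /itv; exact: fd.
Qed.

Lemma is_derive_eps V (f : V -> R) x v d :
  (forall e : R, 0 < e -> \forall h \near (0 : R), h != 0 ->
    `|f (h *: v + x) - f x - h * d| <= e * `|h|) -> is_derive x v f d.
Proof.
move=> H.
have cv : (fun h : R => h^-1 *: ((f \o shift x) (h *: v) - f x)) @ 0^' --> d.
  apply/cvgrPdist_le => e e0.
  have := H _ e0; rewrite near_withinE; apply: filterS => h /[swap] h0 /(_ h0) /= hh.
  have -> : d - h^-1 *: (f (h *: v + x) - f x) =
      - (h^-1 * (f (h *: v + x) - f x - h * d)).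
    by rewrite !mulrBr mulKf // [RHS]opprB -mulrBr.
  by rewrite normrN normrM normfV ler_pdivrMl ?normr_gt0 // [leRHS]mulrC.
split; first by apply/cvg_ex; exists d.
exact/cvg_lim.
Qed.

Lemma is_derive_div V (f g : V -> R) x v df dg : g x != 0 ->
  is_derive x v f df -> is_derive x v g dg ->
  is_derive x v (fun z => f z / g z) ((df * g x - f x * dg) / (g x) ^+ 2).
Proof.
move=> gx fd gd.
have gV : is_derive x v (fun z => (g z)^-1) (- (g x) ^- 2 * dg).
  case: gd => gd ge; split; first exact: derivableV.
  by rewrite deriveV // ge.
apply: is_derive_eq (is_deriveM fd gV) _.
by rewrite /GRing.scale /=; field.
Qed.

Local Notation eX := ((1, 0) : plane R).
Local Notation eY := ((0, 1) : plane R).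

Lemma near_planeP (z0 : plane R) (P : set (plane R)) :
  (\forall z \near z0, P z) <-> exists2 d : R, 0 < d &
  forall x y, `|x| < d -> `|y| < d -> P (x + z0.1, y + z0.2).
Proof.
split.
  move=> /nbhs_normP[d d0 dP]; exists d => // x y xd yd; apply: dP.
  rewrite /= prod_normE gt_max /=.
  have E (a b : R) : `|a - (b + a)| = `|b|.
    by rewrite opprD addrCA subrr addr0 normrN.
  by rewrite !E xd.
move=> [d d0 dP]; apply/nbhs_normP; exists d => // -[x y].
rewrite /= prod_normE gt_max /= => /andP[xd yd].
have -> : (x, y) = (x - z0.1 + z0.1, y - z0.2 + z0.2) by rewrite !subrK.
by apply: dP; rewrite distrC.
Qed.

(** The increment is split into a vertical and a horizontal part; each is estimated by the mean
    value theorem and the continuity of the partial derivative. *)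
Lemma is_diff_partials (f f1 f2 : plane R -> R) (z0 : plane R) :
  (\forall z \near z0, is_derive z eX f (f1 z)) ->
  (\forall z \near z0, is_derive z eY f (f2 z)) ->
  (\forall z \near z0, {for z, continuous f}) ->
  {for z0, continuous f1} -> {for z0, continuous f2} ->
  is_diff z0 f (fun v => v.1 * f1 z0 + v.2 * f2 z0).
Proof.
move=> fd1 fd2 fc c1 c2.
set L := (fun v => _).
have Llin : linear L.
  move=> a [u1 u2] [v1 v2]; rewrite /L /=.
  have E (b : R) : a *: b = a * b by [].
  by rewrite !E; ring.
pose LM := GRing.isLinear.Build _ _ _ _ _ Llin.
pose LL : {linear plane R -> R} := HB.pack L LM.
apply: (@is_diff_eps _ _ _ f LL).
  move=> v.
  apply: (@continuousD R _ _ (fun v : plane R => v.1 * f1 z0)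
    (fun v : plane R => v.2 * f2 z0)).
    by apply: continuousM; [exact: continuous_fst|exact: cst_continuous].
  by apply: continuousM; [exact: continuous_snd|exact: cst_continuous].
move=> e e0; have e20 : 0 < e / 2 by rewrite divr_gt0.
have n1 : \forall z \near z0, `|f1 z0 - f1 z| <= e / 2.
  by move/cvgrPdist_le : c1 => /(_ _ e20).
have n2 : \forall z \near z0, `|f2 z0 - f2 z| <= e / 2.
  by move/cvgrPdist_le : c2 => /(_ _ e20).
have [d d0 dP] := (near_planeP z0 _).1 (filterI fc (filterI fd1
  (filterI fd2 (filterI n1 n2)))).
apply/near_planeP; exists d => // x y; rewrite !addr0 => xd yd.
have lined (w : plane R) (v : plane R) (s : R) : {for s *: v + w, continuous f} ->
   {for s, continuous (fun r : R => f (r *: v + w))}.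
  move=> fcw; apply: (continuous_comp (f := fun r : R => r *: v + w) (g := f)) => //.
  apply: continuousD; last exact: cst_continuous.
  by apply: cvgZr_tmp; exact: cvg_id.
have S1 : `|f (x + z0.1, y + z0.2) - f (z0.1, y + z0.2) - x * f1 z0| <= e / 2 * `|x|.
  have [->|x0] := eqVneq x 0; first by rewrite add0r subrr mul0r subrr normr0 mulr0.
  have E (s : R) : s *: eX + (z0.1, y + z0.2) = (s + z0.1, y + z0.2).
    by congr pair; rewrite /= ?[_%:A]mulr1 // scaler0 add0r.
  have [||s] := @MVT_line _ f (z0.1, y + z0.2) eX x
     (fun s => f1 (s + z0.1, y + z0.2)) x0.
  - move=> s sx; apply: lined; rewrite E.
    by have [] := dP s y (le_lt_trans sx xd) yd.
  - move=> s /andP[_ sx]; rewrite E.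
    by have [_ []] := dP s y (lt_trans sx xd) yd.
  move=> /andP[_ sx]; rewrite E => ->; rewrite -mulrBr normrM mulrC.
  rewrite ler_wpM2r // distrC.
  by have [_ [_ [_ []]]] := dP s y (lt_trans sx xd) yd.
have zd : `|0 : R| < d by rewrite normr0.
have S2 : `|f (z0.1, y + z0.2) - f z0 - y * f2 z0| <= e / 2 * `|y|.
  have [->|y0] := eqVneq y 0.
    by rewrite add0r -surjective_pairing subrr mul0r subrr normr0 mulr0.
  have E (s : R) : s *: eY + z0 = (0 + z0.1, s + z0.2).
    by congr pair; rewrite /= ?[_%:A]mulr1 // scaler0 add0r.
  have [||s] := @MVT_line _ f z0 eY y
     (fun s => f2 (0 + z0.1, s + z0.2)) y0.
  - move=> s sx; apply: lined; rewrite E.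
    by have [] := dP 0 s zd (le_lt_trans sx yd).
  - move=> s /andP[_ sx]; rewrite E.
    by have [_ [_ []]] := dP 0 s zd (lt_trans sx yd).
  move=> /andP[_ sx]; rewrite E add0r => ->; rewrite -mulrBr normrM mulrC.
  rewrite ler_wpM2r // distrC.
  by have [_ [_ [_ []]]] := dP 0 s zd (lt_trans sx yd); rewrite add0r.
have -> : (x, y) + z0 = (x + z0.1, y + z0.2) by case: (z0).
have -> : f (x + z0.1, y + z0.2) - f z0 - LL (x, y) =
   (f (x + z0.1, y + z0.2) - f (z0.1, y + z0.2) - x * f1 z0) +
   (f (z0.1, y + z0.2) - f z0 - y * f2 z0) by rewrite /= /L /=; ring.
apply: (le_trans (ler_normD _ _)); apply: (le_trans (lerD S1 S2)).
rewrite {3}(splitr e) mulrDl; apply: lerD; rewrite ler_wpM2l //; try exact: ltW.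
  by rewrite prod_normE le_max lexx.
by rewrite prod_normE le_max lexx orbT.
Qed.

(** A coinduction principle: membership in a class of continuous functions closed under both partial
    derivatives gives all orders at once. It is made for the averages of Hadamard's lemma. *)
Lemma smooth_on_partials (D : set (plane R)) (P : (plane R -> R) -> Prop) :
  open D ->
  (forall k, P k -> forall z, D z -> {for z, continuous k}) ->
  (forall k, P k -> exists k1 k2, [/\ P k1, P k2 &
    forall z, D z -> is_derive z eX k (k1 z) /\ is_derive z eY k (k2 z)]) ->
  forall k, P k -> smooth_on D k.
Proof.
move=> oD Pc Pd k Pk n; elim: n k Pk => [|n IH] k Pk; first exact: Pc.
have [k1 [k2 [Pk1 Pk2 kd]]] := Pd _ Pk.
have nD z : D z -> \forall w \near z, D w.
  by move=> Dz; exact: open_nbhs_nbhs.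
apply: (@Cn_on_step _ _ _ _ _ _ (fun z v : plane R => v.1 * k1 z + v.2 * k2 z)) => //.
  move=> z Dz; apply: is_diff_partials; try exact: Pc;
    by apply: filterS (nD _ Dz) => w Dw; (exact: Pc || case: (kd _ Dw)).
move=> v; apply: Cn_onD => //.
  by apply: (@Cn_onZ _ _ _ _ _ (cst v.1)) => //; [exact: Cn_on_cst|exact: IH].
by apply: (@Cn_onZ _ _ _ _ _ (cst v.2)) => //; [exact: Cn_on_cst|exact: IH].
Qed.

End SmoothGerms.

(** * Hadamard's lemma *)

Section Hadamard.
Context {R : realType}.
Implicit Types V W : normedModType R.

Local Notation eX := ((1, 0) : plane R).
Local Notation eY := ((0, 1) : plane R).

Lemma smooth_onP V W (D : set V) (f : V -> W) : open D ->
  (smooth_on D f <-> forall x, D x -> smooth_germ x f).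
Proof.
move=> oD; split=> [fD x Dx|fD n]; first by exists D.
elim: n f fD => [|n IH] f fD; first by move=> x /fD/smooth_germ_cont.
split=> [x /fD/smooth_germ_diff//|v]; apply: IH => x /fD; exact: smooth_germ_derive.
Qed.

Lemma open_box (r : R) : open (box r : set (plane R)).
Proof.
have -> : (box r : set (plane R)) =
   ((fun z : plane R => `|z.1|) @^-1` [set x | x < r]) `&`
   ((fun z : plane R => `|z.2|) @^-1` [set x | x < r]) by [].
apply: openI; apply: open_comp; try exact: open_lt.
  move=> z _; apply: (continuous_comp (f := fst) (g := fun x : R => `|x|)).
    exact: continuous_fst.
  exact: norm_continuous.
move=> z _; apply: (continuous_comp (f := snd) (g := fun x : R => `|x|)).
  exact: continuous_snd.
exact: norm_continuous.
Qed.

Lemma near_boxP (P : set (plane R)) : (\forall z \near (0 : plane R), P z) <->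
  exists2 r : R, 0 < r & box r `<=` P.
Proof.
rewrite near_planeP /=; split=> -[d d0 dP]; exists d => //.
  by move=> [x y] [/= xd yd]; have := dP x y xd yd; rewrite !addr0.
by move=> x y xd yd; rewrite !addr0; apply: dP.
Qed.

Lemma is_derive_translate V W (f : V -> W) (x v w : V) d :
  is_derive (x + w) v f d -> is_derive x v (fun z => f (z + w)) d.
Proof.
have E : (fun h : R => h^-1 *: (((fun z => f (z + w)) \o shift x) (h *: v)
     - f (x + w))) =
   (fun h : R => h^-1 *: ((f \o shift (x + w)) (h *: v) - f (x + w))).
  by apply/funext => h /=; rewrite addrA.
by move=> [fd fe]; split; [rewrite /derivable E|rewrite /derive E].
Qed.

Lemma smooth_germ_is_derive V W (f : V -> W) x v : smooth_germ x f ->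
  is_derive x v f ('D_v f x).
Proof. by move/smooth_germ_diff/diff_derivable/derivableP; apply. Qed.

Lemma continuous_line V W (f : V -> W) (w v : V) (s : R) :
  {for s *: v + w, continuous f} ->
  {for s, continuous (fun r : R => f (r *: v + w))}.
Proof.
move=> fcw; apply: (continuous_comp (f := fun r : R => r *: v + w) (g := f)) => //.
apply: continuousD; last exact: cst_continuous.
by apply: cvgZr_tmp; exact: cvg_id.
Qed.

Lemma second_difference V (f : V -> R) v w x (h k : R) : h != 0 -> k != 0 ->
  (forall s t : R, `|s| <= `|h| -> `|t| <= `|k| ->
     smooth_germ (s *: v + (t *: w + x)) f) ->
  exists s t : R, [/\ `|s| <= `|h|, `|t| <= `|k| &
    f (h *: v + (k *: w + x)) - f (h *: v + x) - (f (k *: w + x) - f x) =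
    h * (k * 'D_w ('D_v f) (s *: v + (t *: w + x)))].
Proof.
move=> h0 k0 fs.
have fs0 (s : R) : `|s| <= `|h| -> smooth_germ (s *: v + x) f.
  move=> sh; have := fs s 0 sh; rewrite scale0r add0r normr0; exact.
pose F z := f (z + k *: w) - f z.
have FE z : F (z + x) = f (z + (k *: w + x)) - f (z + x).
  by rewrite /F -addrA [x + _]addrC.
have fsk (s : R) : `|s| <= `|h| -> smooth_germ (s *: v + x + k *: w) f.
  by move=> sh; rewrite -addrA [x + _]addrC; exact: fs.
have [||s /andP[_ sh]] := @MVT_line _ _ F x v h
    (fun s => 'D_v f (s *: v + x + k *: w) - 'D_v f (s *: v + x)) h0.
- move=> s sh; apply: continuous_line; apply: continuousB.
    apply: (continuous_comp (f := fun z => z + k *: w) (g := f)).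
      by apply: continuousD; [exact: cvg_id|exact: cst_continuous].
    exact: smooth_germ_cont (fsk _ sh).
  exact: smooth_germ_cont (fs0 _ sh).
- move=> s /andP[_ /ltW sh]; apply: is_deriveB.
    exact/is_derive_translate/smooth_germ_is_derive/fsk.
  exact/smooth_germ_is_derive/fs0.
have -> : F x = F (0 + x) by rewrite add0r.
rewrite !FE !add0r => ->.
have E (t : R) : t *: w + (s *: v + x) = s *: v + (t *: w + x) by rewrite addrCA.
have [||t /andP[_ tk]] := @MVT_line _ _ ('D_v f) (s *: v + x) w k
    (fun t => 'D_w ('D_v f) (s *: v + (t *: w + x))) k0.
- move=> t tk; apply: (@continuous_line _ _ ('D_v f)); rewrite E.
  by apply: smooth_germ_cont; apply: smooth_germ_derive; apply: fs => //; exact: ltW.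
- move=> t /andP[_ /ltW tk]; rewrite E.
  by apply/smooth_germ_is_derive/smooth_germ_derive/fs => //; exact: ltW.
rewrite [s *: v + x + _]addrC => ->.
by exists s, t; split => //; exact: ltW.
Qed.

(** Both mixed derivatives, taken at points near [x], are quotients of the same second difference;
    if they differed at [x], continuity would keep them apart nearby. *)
Lemma schwarz V (f : V -> R) x v w : smooth_germ x f ->
  'D_w ('D_v f) x = 'D_v ('D_w f) x.
Proof.
move=> fx.
have c v' w' : {for x, continuous ('D_w' ('D_v' f))}.
  by apply: smooth_germ_cont; do 2! apply: smooth_germ_derive.
have cancel (h y1 y2 y3 y4 A B : R) : h != 0 -> y1 - y2 - (y3 - y4) = h * (h * A) ->
    y1 - y3 - (y2 - y4) = h * (h * B) -> A = B.
  move=> h0 E1 E2; have : h * (h * A) = h * (h * B) by rewrite -E1 -E2; ring.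
  by move/(mulfI h0)/(mulfI h0).
have triangle (e a b m : R) : `|a - m| < e -> `|b - m| < e -> `|a - b| < e + e.
  move=> am bm; have -> : a - b = (a - m) - (b - m) by ring.
  by apply: (le_lt_trans (ler_normB _ _)); rewrite ltrD.
apply/eqP; apply/negPn/negP => ne.
pose e := `|'D_w ('D_v f) x - 'D_v ('D_w f) x| / 2.
have e0 : 0 < e by rewrite divr_gt0 // normr_gt0 subr_eq0.
have n1 : \forall z \near x, `|'D_w ('D_v f) x - 'D_w ('D_v f) z| < e.
  by have /cvgrPdist_lt := c v w; apply.
have n2 : \forall z \near x, `|'D_v ('D_w f) x - 'D_v ('D_w f) z| < e.
  by have /cvgrPdist_lt := c w v; apply.
have [d d0 dP] := (nbhs_normP _ _).1 (filterI (smooth_germ_near fx) (filterI n1 n2)).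
(* The increment [h] is such that the parallelogram spanned by [h v] and [h w] stays in the ball of
   radius [d]; the summand 1 keeps [M] positive. *)
pose M := 1 + `|v| + `|w|.
have M0 : 0 < M by rewrite /M -addrA ltr_pwDl // addr_ge0.
pose h := d / 2 / M.
have h0 : 0 < h by rewrite !divr_gt0.
have near (s t : R) : `|s| <= `|h| -> `|t| <= `|h| -> ball_ (fun y => `|y|) x d (s *: v + (t *: w + x)).
  move=> sh th; rewrite /ball_ /= addrA distrC addrK.
  apply: (le_lt_trans (ler_normD _ _)); rewrite !normrZ.
  have := lerD (ler_wpM2r (normr_ge0 v) sh) (ler_wpM2r (normr_ge0 w) th).
  move=> /le_lt_trans; apply; rewrite -mulrDr (gtr0_norm h0).
  apply: (@le_lt_trans _ _ (h * M)); last by rewrite divfK ?gt_eqF // ltr_pdivrMr // ltr_pMr // ltr1n.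
  by rewrite ler_pM2l // /M -addrA lerDr.
have hn : h != 0 by rewrite gt_eqF.
have [|s [t [sh th E1]]] := @second_difference _ f v w x h h hn hn.
  by move=> s t sh th; have [] := dP _ (near s t sh th).
have [|t' [s' [th' sh' E2]]] := @second_difference _ f w v x h h hn hn.
  move=> t2 s2 th2 sh2; have [] := dP _ (near s2 t2 sh2 th2).
  by rewrite addrCA.
have E : 'D_w ('D_v f) (s *: v + (t *: w + x)) = 'D_v ('D_w f) (t' *: w + (s' *: v + x)).
  rewrite [h *: w + (h *: v + x)]addrCA in E2.
  exact: (cancel _ _ _ _ _ _ _ hn E1 E2).
have [_ [a1 _]] := dP _ (near s t sh th).
have := near s' t' sh' th'; rewrite addrCA => /dP[_ [_ a2]].
rewrite -E in a2.
have := triangle _ _ _ _ a1 a2.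
by rewrite -splitr ltxx.
Qed.

(* [N = t^(b+1) K] and [d_t N = t^b g] mean that
   [K(u, t) = int_0^1 s^b g(u, s t) ds]; this family of averages is closed
   under both partial derivatives, so that smoothness needs no integrals. *)
Definition average_data (r : R) (b : nat) (g N : plane R -> R) :=
  [/\ forall z, box r z -> smooth_germ z g,
      forall z, box r z -> smooth_germ z N,
      forall z, box r z -> N (z.1, 0) = 0 &
      forall z, box r z -> 'D_eY N z = z.2 ^+ b * g z].

(** On the axis the quotient is replaced by its limit: the integral of [s^b] over the unit interval
    is [1 / (b+1)]. *)
Definition average (b : nat) (g N : plane R -> R) (z : plane R) : R :=
  if z.2 == 0 then g z / b.+1%:R else N z / z.2 ^+ b.+1.

Lemma shiftY (s : R) (x : R) : s *: eY + (x, 0) = (x, s).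
Proof. by congr pair; rewrite /= ?[_%:A]mulr1 ?scaler0 ?add0r ?addr0. Qed.

Lemma is_derive_snd (b : nat) (z v : plane R) :
  is_derive z v (fun w : plane R => w.2 ^+ b.+1) (b.+1%:R * z.2 ^+ b * v.2).
Proof.
have sd : is_derive z v (fun w : plane R => w.2) v.2.
  have sdf : is_diff z (snd : plane R -> R) snd.
    split; [apply: (@linear_differentiable _ _ _ snd)|apply: (@diff_lin _ _ _ snd)];
    exact: continuous_snd.
  split; first by apply: diff_derivable; case: sdf.
  by rewrite (is_diff_deriveE _ sdf).
have -> : (fun w : plane R => w.2 ^+ b.+1) = (fun w : plane R => w.2) ^+ b.+1.
  by apply/funext => w; rewrite exprfctE.
exact: (is_deriveX b.+1 sd).
Qed.

(** Cauchy's mean value theorem for [N] and [t^(b+1)]; [psi] is the usual auxiliary combination,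
    which vanishes at both ends. *)
Lemma average_mvt r b g N z : average_data r b g N -> box r z -> z.2 != 0 ->
  exists2 s, 0 < `|s| < `|z.2| & average b g N z = g (z.1, s) / b.+1%:R.
Proof.
move=> [gs Ns N0 Nt] [z1 z2] t0; rewrite /average (negbTE t0).
pose psi (w : plane R) := N w * z.2 ^+ b.+1 - N z * w.2 ^+ b.+1.
have bx (s : R) : `|s| <= `|z.2| -> box r (z.1, s).
  by move=> sz; split => //=; exact: le_lt_trans sz z2.
have psid (s : R) : `|s| <= `|z.2| -> is_derive (z.1, s) eY psi
   (s ^+ b * g (z.1, s) * z.2 ^+ b.+1 - N z * (b.+1%:R * s ^+ b)).
  move=> /bx sz; apply: is_deriveB.
    have dN := smooth_germ_is_derive eY (Ns _ sz).
    apply: is_derive_eq (is_deriveM dN (is_derive_cst (z.2 ^+ b.+1) (z.1, s) eY)) _.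
    by rewrite scaler0 add0r Nt //; exact: mulrC.
  apply: is_derive_eq (is_deriveM (is_derive_cst (N z) (z.1, s) eY)
    (is_derive_snd b (z.1, s) eY)) _.
  by rewrite scaler0 addr0 /= mulr1.
have psic (s : R) : `|s| <= `|z.2| -> {for (z.1, s), continuous psi}.
  move=> /bx sz; apply: smooth_germ_cont; apply: smooth_germB; apply: smooth_germM.
  - exact: Ns.
  - exact: smooth_germ_cst.
  - exact: smooth_germ_cst.
  - apply: smooth_germX; apply: smooth_germ_snd; exact: smooth_germ_id.
have [||s /andP[s0 st]] := @MVT_line _ _ psi (z.1, 0) eY z.2
  (fun s => s ^+ b * g (z.1, s) * z.2 ^+ b.+1 - N z * (b.+1%:R * s ^+ b)) t0.
- by move=> s sz; apply: continuous_line; rewrite shiftY; exact: psic.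
- by move=> s /andP[_ /ltW sz]; rewrite shiftY; exact: psid.
rewrite shiftY /psi -surjective_pairing /= N0 // expr0n /= subrr mul0r mulr0 !subrr.
move/esym/eqP; rewrite mulf_eq0 (negbTE t0) /=.
have -> : s ^+ b * g (z.1, s) * z.2 ^+ b.+1 - N z * (b.+1%:R * s ^+ b) =
  s ^+ b * (g (z.1, s) * z.2 ^+ b.+1 - N z * b.+1%:R) by ring.
rewrite mulf_eq0 expf_eq0 -normr_eq0 (gt_eqF s0) andbF /= subr_eq0 => /eqP E.
exists s; first by rewrite s0.
apply/eqP; rewrite eqr_div ?pnatr_eq0 // ?expf_neq0 //.
by rewrite E.
Qed.

Lemma average_cont r b g N z : average_data r b g N -> box r z ->
  {for z, continuous (average b g N)}.
Proof.
move=> D bz; have [gs Ns N0 Nt] := D.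
have [t0|t0] := eqVneq z.2 0; last first.
  apply: (@near_eq_continuous _ _ _ (fun w => N w / w.2 ^+ b.+1)).
    have := @continuous_snd R R R z; move/cvgr_neq0 => /(_ t0).
    by apply: filterS => w w0; rewrite /average (negbTE w0).
  apply: smooth_germ_cont; apply: smooth_germM; first exact: Ns.
  apply: smooth_germV; first exact: expf_neq0.
  by apply: smooth_germX; apply: smooth_germ_snd; exact: smooth_germ_id.
apply/cvgrPdist_lt => e e0.
have gc : {for z, continuous (fun w => g w / b.+1%:R)}.
  apply: smooth_germ_cont; apply: smooth_germM; first exact: gs.
  exact: smooth_germ_cst.
have n1 : \forall w \near z, `|g z / b.+1%:R - g w / b.+1%:R| < e.
  by move/cvgrPdist_lt: gc; apply.
have n2 : \forall w \near z, box r w by apply: open_nbhs_nbhs; split => //; exact: open_box.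
have [d d0 dP] := (near_planeP z _).1 (filterI n1 n2).
apply/near_planeP; exists d => // x y xd yd.
have [_ bw] := dP x y xd yd.
have az : average b g N z = g z / b.+1%:R by rewrite /average t0 eqxx.
rewrite az.
have [y0|y0] := eqVneq (y + z.2) 0.
  rewrite /average /= y0 eqxx -y0; by case: (dP x y xd yd).
have [s /andP[_ sy] ->] := average_mvt D bw y0.
move: sy; rewrite /= t0 addr0 => sy.
have [] := dP x s xd (lt_trans sy yd).
by rewrite t0 addr0.
Qed.

Lemma average_data_X r b g N : average_data r b g N ->
  average_data r b ('D_eX g) ('D_eX N).
Proof.
move=> [gs Ns N0 Nt]; split.
- by move=> z /gs; exact: smooth_germ_derive.
- by move=> z /Ns; exact: smooth_germ_derive.
- move=> z bz; have bz0 : box r (z.1, 0).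
    by case: bz => z1 z2; split; rewrite //= normr0 (le_lt_trans _ z2).
  pose L := (fun x : plane R => (x.1, 0) : plane R).
  have Ld : is_derive (z.1, 0) eX (N \o L) ('D_eX N (z.1, 0)).
    have Lz := smooth_germ_is_derive eX (Ns _ bz0).
    have E : (fun h : R => h^-1 *: (((N \o L) \o shift (z.1, 0)) (h *: eX)
       - (N \o L) (z.1, 0))) =
     (fun h : R => h^-1 *: ((N \o shift (z.1, 0)) (h *: eX) - N (z.1, 0))).
      apply/funext => h /=; congr (_ *: (N _ - _)).
      by apply: injective_projections; rewrite /= ?scaler0 ?addr0.
    by case: Lz => [fd fe]; split; [rewrite /derivable E|rewrite /derive E].
  rewrite -(@derive_val _ _ _ _ _ _ _ Ld).
  rewrite (@near_eq_derive _ _ _ _ (cst 0)) ?derive_cst //.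
  have : \forall w \near ((z.1, 0) : plane R), box r w.
    by apply: open_nbhs_nbhs; split => //; exact: open_box.
  by apply: filterS => w /N0.
- move=> z bz.
  have := schwarz eX eY (Ns _ bz).
  move=> ->.
  rewrite (@near_eq_derive _ _ _ _ (fun w : plane R => w.2 ^+ b * g w)); last first.
    have : \forall w \near z, box r w.
      by apply: open_nbhs_nbhs; split => //; exact: open_box.
    by apply: filterS => w /Nt.
  have gd := smooth_germ_is_derive eX (gs _ bz).
  have pd : is_derive z eX (fun w : plane R => w.2 ^+ b) 0.
    case: (b) => [|b']; first exact: is_derive_cst.
    by apply: is_derive_eq (is_derive_snd b' z eX) _; rewrite /= mulr0.
  rewrite (@derive_val _ _ _ _ _ _ _ (is_deriveM pd gd)).
  by rewrite scaler0 addr0.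
Qed.

(** Differentiation under the integral sign raises the weight from [s^b] to [s^(b+1)] and replaces
    [g] with [d_t g]. By the quotient rule, [t^(b+1) g - (b+1) N] is [t^(b+2)] times the [t]
    derivative of [N / t^(b+1)]. *)
Lemma average_data_Y r b g N : average_data r b g N ->
  average_data r b.+1 ('D_eY g) (fun z => z.2 ^+ b.+1 * g z - b.+1%:R * N z).
Proof.
move=> [gs Ns N0 Nt]; split.
- by move=> z /gs; exact: smooth_germ_derive.
- move=> z bz; apply: smooth_germB; apply: smooth_germM.
  + by apply: smooth_germX; apply: smooth_germ_snd; exact: smooth_germ_id.
  + exact: gs.
  + exact: smooth_germ_cst.
  + exact: Ns.
- by move=> z bz; rewrite /= N0 // expr0n /= mul0r mulr0 subrr.
- move=> z bz.
  have gd := smooth_germ_is_derive eY (gs _ bz).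
  have Nd := smooth_germ_is_derive eY (Ns _ bz).
  have d1 := is_deriveM (is_derive_snd b z eY) gd.
  have d2 := is_deriveM (is_derive_cst (b.+1%:R : R) z eY) Nd.
  rewrite (@derive_val _ _ _ _ _ _ _ (is_deriveB d1 d2)) Nt // scaler0 addr0.
  have E (x y : R) : x *: y = x * y by [].
  by rewrite !E /cst /=; ring.
Qed.

Lemma average_derive_X r b g N z : average_data r b g N -> box r z ->
  is_derive z eX (average b g N) (average b ('D_eX g) ('D_eX N) z).
Proof.
move=> D bz; have [gs Ns N0 Nt] := D.
pose K (w : plane R) := if z.2 == 0 then g w / b.+1%:R else N w / w.2 ^+ b.+1.
have E : (fun h : R => h^-1 *: ((average b g N \o shift z) (h *: eX)
       - average b g N z)) =
     (fun h : R => h^-1 *: ((K \o shift z) (h *: eX) - K z)).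
  by apply/funext => h; rewrite /= /K /average /= scaler0 add0r.
suff [fd fe] : is_derive z eX K (average b ('D_eX g) ('D_eX N) z).
  by split; [rewrite /derivable E|rewrite /derive E].
rewrite /K /average; have [t0|t0] := eqVneq z.2 0.
  have gd := smooth_germ_is_derive eX (gs _ bz).
  apply: is_derive_eq (is_deriveM gd (is_derive_cst (b.+1%:R^-1 : R) z eX)) _.
  by rewrite scaler0 add0r mulrC.
have Nd := smooth_germ_is_derive eX (Ns _ bz).
apply: is_derive_eq (is_derive_div _ Nd (is_derive_snd b z eX)) _.
  exact: expf_neq0.
rewrite /= !mulr0 subr0; move: (z.2 ^+ b.+1) (expf_neq0 b.+1 t0) => q q0.
by field.
Qed.

(** Off the axis this is the quotient rule. The resulting derivative is again an average, hence
    continuous up to the axis, and the mean value theorem then shows that its value on the axis is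
    the derivative there. *)
Lemma average_derive_Y r b g N z : average_data r b g N -> box r z ->
  is_derive z eY (average b g N)
   (average b.+1 ('D_eY g) (fun z => z.2 ^+ b.+1 * g z - b.+1%:R * N z) z).
Proof.
move=> D bz; have [gs Ns N0 Nt] := D.
set K' := average b.+1 _ _.
have off w : box r w -> w.2 != 0 -> is_derive w eY (average b g N) (K' w).
  move=> bw t0.
  have Nd := smooth_germ_is_derive eY (Ns _ bw).
  apply: near_eq_is_derive (is_derive_eq (is_derive_div _ Nd (is_derive_snd b w eY)) _).
  - have := @continuous_snd R R R w; move/cvgr_neq0 => /(_ t0).
    by apply: filterS => w' w0; rewrite /average (negbTE w0).
  - exact: expf_neq0.
  - rewrite /K' /average (negbTE t0) Nt // /= !exprS.
    move: (w.2 ^+ b) (expf_neq0 b t0) => q q0; field.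
    by rewrite q0.
have [t0|] := eqVneq z.2 0; last exact: off.
have K'c := average_cont (average_data_Y D) bz.
apply: is_derive_eps => e e0.
have n1 : \forall w \near z, `|K' z - K' w| < e by move/cvgrPdist_lt: K'c; apply.
have n2 : \forall w \near z, box r w by apply: open_nbhs_nbhs; split => //; exact: open_box.
have [d d0 dP] := (near_planeP z _).1 (filterI n1 n2).
apply/nbhs_normP; exists d => // h; rewrite /= sub0r normrN => hd h0.
have sh (s : R) : s *: eY + z = (0 + z.1, s + z.2).
  by congr pair; rewrite /= ?[_%:A]mulr1 ?scaler0.
have zd : `|0 : R| < d by rewrite normr0.
have [||s /andP[s0 hs]] := @MVT_line _ _ (average b g N) z eY h
  (fun s => K' (0 + z.1, s + z.2)) h0.
- move=> s shh; apply: continuous_line; rewrite sh.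
  apply: (average_cont D); by have [] := dP 0 s zd (le_lt_trans shh hd).
- move=> s /andP[s0 shh]; rewrite sh; apply: off.
    by have [] := dP 0 s zd (lt_trans shh hd).
  by rewrite /= t0 addr0 -normr_gt0.
move=> ->; rewrite -mulrBr normrM mulrC ler_wpM2r // distrC ltW //.
by have [] := dP 0 s zd (lt_trans hs hd).
Qed.

Lemma average_smooth r b g N z : average_data r b g N -> box r z ->
  smooth_germ z (average b g N).
Proof.
move=> D bz.
suff H : smooth_on (box r) (average b g N).
  have [/(_ H)] := smooth_onP (average b g N) (@open_box r).
  by move=> /(_ z bz).
pose P k := exists b g N, average_data r b g N /\ k = average b g N.
apply: (@smooth_on_partials _ _ P) => //; first exact: open_box.
- by move=> k [b' [g' [N' [D' ->]]]] w; exact: average_cont.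
- move=> k [b' [g' [N' [D' ->]]]].
  exists (average b' ('D_eX g') ('D_eX N')).
  exists (average b'.+1 ('D_eY g')
    (fun z => z.2 ^+ b'.+1 * g' z - b'.+1%:R * N' z)); split.
  + by exists b', ('D_eX g'), ('D_eX N'); split => //; exact: average_data_X.
  + exists b'.+1, ('D_eY g'), (fun z => z.2 ^+ b'.+1 * g' z - b'.+1%:R * N' z).
    by split => //; exact: average_data_Y.
  + by move=> w bw; split; [exact: (average_derive_X D')|exact: (average_derive_Y D')].
- by exists b, g, N.
Qed.

Lemma hadamard (h : plane R -> R) : smooth_germ 0 h ->
  (\forall u \near (0 : R), h (u, 0) = 0) ->
  exists2 k : plane R -> R, smooth_germ 0 k &
    \forall z \near (0 : plane R), h z = z.2 * k z.
Proof.
move=> hs h0.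
have h0' : \forall z \near (0 : plane R), h (z.1, 0) = 0.
  exact: (@continuous_fst R R R 0 _ h0).
have [r r0 rP] := (near_boxP _).1 (filterI (smooth_germ_near hs) h0').
have b0 : box r (0 : plane R) by split; rewrite /= normr0.
have D : average_data r 0 ('D_eY h) h.
  split.
  - by move=> z /rP[hz _]; exact: smooth_germ_derive.
  - by move=> z /rP[].
  - by move=> z /rP[].
  - by move=> z _; rewrite expr0 mul1r.
exists (average 0 ('D_eY h) h); first exact: average_smooth D b0.
apply/near_boxP; exists r => // z bz; rewrite /average expr1.
have [t0|t0] := eqVneq z.2 0; last by rewrite mulrC divfK.
by rewrite t0 mul0r [z in LHS]surjective_pairing t0; have [] := rP _ bz.
Qed.

End Hadamard.

Lemma continuous_pairf (R : realType) (V X Y : normedModType R) (f : V -> X)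
  (g : V -> Y) x : {for x, continuous f} -> {for x, continuous g} ->
  {for x, continuous (fun z => (f z, g z))}.
Proof. by move=> fc gc; apply: cvg_pair; [exact: fc|exact: gc]. Qed.

(** * The implicit function theorem *)

Section Implicit.
Context {R : realType} {V : normedModType R}.

Local Notation W := (V * R)%type.
Local Notation eW := ((0, 1) : W).

Section Positive.
Variables (G : W -> R) (p0 : V) (w0 d : R).
Hypothesis G0 : G (p0, w0) = 0.
Hypothesis d0 : 0 < d.
Hypothesis GP : forall p y, `|p - p0| < d -> `|y - w0| < d ->
  smooth_germ ((p, y) : W) G /\ 0 < 'D_eW G (p, y).

Lemma implicit_mvt p y h : h != 0 -> `|p - p0| < d -> `|y - w0| < d ->
  `|h + y - w0| < d -> exists2 s, `|s| < `|h| &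
   `|s + y - w0| < d /\ G (p, h + y) - G (p, y) = h * 'D_eW G (p, s + y).
Proof.
move=> h0 pd yd hyd.
have itv (s : R) : 0 <= s <= 1 -> `|s * h + y - w0| < d.
  move=> /andP[s0 s1].
  have -> : s * h + y - w0 = s * (h + y - w0) + (1 - s) * (y - w0) by ring.
  apply: (le_lt_trans (ler_normD _ _)).
  rewrite !normrM (ger0_norm s0) (@ger0_norm _ (1 - s)) ?subr_ge0 //.
  move: hyd yd; move: `|h + y - w0| `|y - w0| => a b ad bd.
  have s1' : 0 <= 1 - s by rewrite subr_ge0.
  have [ab|/ltW ab] := leP a b.
    apply: (le_lt_trans _ bd).
    by apply: (le_trans (lerD (ler_wpM2l s0 ab) (lexx _))); rewrite -mulrDl subrKC mul1r.
  apply: (le_lt_trans _ ad).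
  by apply: (le_trans (lerD (lexx _) (ler_wpM2l s1' ab))); rewrite -mulrDl subrKC mul1r.
have vline (s : R) : s *: eW + (p, y) = (p, s + y).
  by congr pair; rewrite /= ?[_%:A]mulr1 // scaler0 add0r.
have [||s /andP[s0 s1]] := @MVT_ray _ _ G (p, y) eW h (fun s => 'D_eW G (p, s + y)).
- move=> s s01; apply: continuous_line; rewrite vline mulrC.
  by have [/smooth_germ_cont] := GP pd (itv _ s01).
- move=> s /andP[/ltW s0 /ltW s1]; rewrite vline mulrC.
  have s01 : 0 <= s <= 1 by rewrite s0.
  by have [Gs _] := GP pd (itv s s01); exact: smooth_germ_is_derive.
rewrite vline => ->; exists (h * s).
  by rewrite normrM (gtr0_norm s0) gtr_pMr // normr_gt0.
by split => //; rewrite mulrC itv // (ltW s0) (ltW s1).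
Qed.

Lemma implicit_incr p y y' : `|p - p0| < d -> `|y - w0| < d -> `|y' - w0| < d ->
  y < y' -> G (p, y) < G (p, y').
Proof.
move=> pd yd yd' yy'.
have [||s _ [sd]] := @implicit_mvt p y (y' - y) _ pd yd.
- by rewrite subr_eq0 gt_eqF.
- by rewrite subrK.
rewrite subrK => E; rewrite -subr_gt0 E mulr_gt0 ?subr_gt0 //.
by have [] := GP pd sd.
Qed.

Lemma implicit_inj p y y' : `|p - p0| < d -> `|y - w0| < d -> `|y' - w0| < d ->
  G (p, y) = 0 -> G (p, y') = 0 -> y = y'.
Proof.
move=> pd yd yd' e1 e2.
by have [/(implicit_incr pd yd yd')|/(implicit_incr pd yd' yd)|//] := ltgtP y y';
  rewrite e1 e2 ltxx.
Qed.

Lemma implicit_cont_slice p y : `|p - p0| < d -> `|y - w0| < d ->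
  {for p, continuous (fun p => G (p, y))}.
Proof.
move=> pd yd; apply: (continuous_comp (f := fun p : V => (p, y) : W) (g := G)).
  apply: (@continuous_pairf _ _ _ _ id (cst y)); first exact: cvg_id.
  exact: cst_continuous.
by have [/smooth_germ_cont] := GP pd yd.
Qed.

(** [G(p, .)] is increasing and, for [p] near [p0], has opposite signs at [w0 - d/2] and [w0 + d/2];
    the intermediate value theorem gives a zero, and a choice function collects the zeros. For [p]
    outside the ball the value [0] is a mere placeholder. *)
Lemma implicit_exists : exists (d1 : R) (w : V -> R), [/\ 0 < d1, d1 <= d &
  forall p, `|p - p0| < d1 -> `|w p - w0| < d /\ G (p, w p) = 0].
Proof.
have dpos := d0; pose e := d / 2.
have e0 : 0 < e by rewrite divr_gt0.
have ed : e < d by rewrite /e; lra.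
have zd : `|p0 - p0| < d by rewrite subrr normr0.
have wd : `|w0 - w0| < d by rewrite subrr normr0.
have ped : `|w0 + e - w0| < d by rewrite addrC addKr gtr0_norm.
have med : `|w0 - e - w0| < d by rewrite addrC addKr normrN gtr0_norm.
have Gp : 0 < G (p0, w0 + e) by rewrite -G0 implicit_incr // ltrDl.
have Gm : G (p0, w0 - e) < 0 by rewrite -G0 implicit_incr // gtrDl oppr_lt0.
have n1 : \forall p \near p0, 0 < G (p, w0 + e).
  have := implicit_cont_slice zd ped; move/cvgr_gt; exact.
have n2 : \forall p \near p0, G (p, w0 - e) < 0.
  have := implicit_cont_slice zd med; move/cvgr_lt; exact.
have [d1 d10 dP] := (nbhs_normP _ _).1 (filterI n1 n2).
have H p : exists y, `|p - p0| < Num.min d d1 -> `|y - w0| < d /\ G (p, y) = 0.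
  have [pd|/negP pd] := boolP (`|p - p0| < Num.min d d1); last by exists 0.
  move: pd; rewrite lt_min => /andP[pd pd1].
  have [Gp' Gm'] : 0 < G (p, w0 + e) /\ G (p, w0 - e) < 0.
    by apply: dP; rewrite /= distrC.
  have [|||y] := @IVT R (fun y => G (p, y)) (w0 - e) (w0 + e) 0.
  - by rewrite lerD2l; lra.
  - apply: continuous_in_subspaceT => y; rewrite inE /= in_itv /= => /andP[y1 y2].
    apply: (continuous_comp (f := fun y : R => (p, y) : W) (g := G)).
      apply: (@continuous_pairf _ _ _ _ (cst p) id); first exact: cst_continuous.
      exact: cvg_id.
    have yd : `|y - w0| < d by rewrite ltr_norml; apply/andP; split; lra.
    by have [/smooth_germ_cont] := GP pd yd.
  - by rewrite ge_min le_max (ltW Gm') (ltW Gp') orbT.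
  rewrite in_itv /= => /andP[y1 y2] Gy; exists y => _; split => //.
  by rewrite ltr_norml; apply/andP; split; lra.
have [w wP] := choice H.
exists (Num.min d d1), w; split => //; first by rewrite lt_min d0.
by rewrite ge_min lexx.
Qed.

Variables (d1 : R) (w : V -> R).
Hypothesis d10 : 0 < d1.
Hypothesis d1d : d1 <= d.
Hypothesis wP : forall p, `|p - p0| < d1 -> `|w p - w0| < d /\ G (p, w p) = 0.

Let near_dom p : `|p - p0| < d1 -> \forall q \near p, `|q - p0| < d1.
Proof.
move=> pd; apply/nbhs_normP; exists (d1 - `|p - p0|); first by rewrite /= subr_gt0.
move=> q /=; rewrite ltrBrDr => H.
by apply: le_lt_trans (ler_distD p q p0) _; rewrite (distrC q).
Qed.

(** The signs of [G(q, w p + c)] and [G(q, w p - c)] persist for [q] near [p], and monotonicity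
    traps [w q] between [w p - c] and [w p + c]. *)
Lemma implicit_cont p : `|p - p0| < d1 -> {for p, continuous w}.
Proof.
move=> pd; have [wd Gw] := wP pd; apply/cvgrPdist_lt => e e0.
have pd' : `|p - p0| < d by exact: lt_le_trans pd d1d.
pose c := Num.min e (d - `|w p - w0|) / 2.
have m0 : 0 < Num.min e (d - `|w p - w0|) by rewrite lt_min e0 subr_gt0.
have c0 : 0 < c by rewrite divr_gt0.
have cm : c < Num.min e (d - `|w p - w0|) by rewrite /c; lra.
move: (cm); rewrite lt_min => /andP[ce cd].
have pc : `|w p + c - w0| < d.
  by rewrite addrAC (le_lt_trans (ler_normD _ _)) // (gtr0_norm c0); lra.
have mc : `|w p - c - w0| < d.
  by rewrite addrAC (le_lt_trans (ler_normB _ _)) // (gtr0_norm c0); lra.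
have Gp : 0 < G (p, w p + c) by rewrite -Gw implicit_incr // ltrDl.
have Gm : G (p, w p - c) < 0 by rewrite -Gw implicit_incr // gtrDl oppr_lt0.
have n1 : \forall q \near p, 0 < G (q, w p + c).
  have := implicit_cont_slice pd' pc; move/cvgr_gt; exact.
have n2 : \forall q \near p, G (q, w p - c) < 0.
  have := implicit_cont_slice pd' mc; move/cvgr_lt; exact.
near=> q.
have qd : `|q - p0| < d1 by near: q; exact: near_dom.
have qd' : `|q - p0| < d by exact: lt_le_trans qd d1d.
have [wqd Gq] := wP qd.
have q1 : 0 < G (q, w p + c) by near: q.
have q2 : G (q, w p - c) < 0 by near: q.
have l1 : w q < w p + c.
  rewrite ltNge; apply/negP; rewrite le_eqVlt => /orP[/eqP E|].
    by move: q1; rewrite E Gq ltxx.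
  move=> /(implicit_incr qd' pc wqd); rewrite Gq => q1'.
  by have := lt_trans q1 q1'; rewrite ltxx.
have l2 : w p - c < w q.
  rewrite ltNge; apply/negP; rewrite le_eqVlt => /orP[/eqP E|].
    by move: q2; rewrite -E Gq ltxx.
  move=> /(implicit_incr qd' wqd mc); rewrite Gq => q2'.
  by have := lt_trans q2 q2'; rewrite ltxx.
by rewrite ltr_norml; apply/andP; split; lra.
Unshelve. all: by end_near. Qed.

Let dw (p h : V) : R := - 'D_((h, 0) : W) G (p, w p) / 'D_eW G (p, w p).

Lemma implicit_diff p : `|p - p0| < d1 -> is_diff p w (dw p).
Proof.
move=> pd; have [wd Gw] := wP pd.
have pd' : `|p - p0| < d by exact: lt_le_trans pd d1d.
have [Gs Gpos] := GP pd' wd.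
have Gd := smooth_germ_diff Gs.
pose A (h : V) : R := 'd G (p, w p) ((h, 0) : W).
have Alin : linear A.
  move=> a u v; rewrite /A; have -> : ((a *: u + v, 0) : W) = a *: (u, 0) + (v, 0).
    by congr pair; rewrite /= scaler0 addr0.
  by rewrite linearP.
have Ac : continuous A.
  move=> h; apply: (continuous_comp (f := fun h : V => (h, 0) : W)
    (g := 'd G (p, w p))).
    apply: (@continuous_pairf _ _ _ _ id (cst 0)); first exact: cvg_id.
    exact: cst_continuous.
  exact: diff_continuous.
pose AL : {linear V -> R} := HB.pack A (GRing.isLinear.Build _ _ _ _ _ Alin).
pose g := 'D_eW G (p, w p).
have dwE : dw p = fun h => (- g^-1) * A h.
  by apply/funext => h; rewrite /dw deriveE // mulrC mulrN -mulNr.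
have Llin : linear (dw p).
  move=> a u v; rewrite dwE Alin mulrDr; congr (_ + _).
  by rewrite /GRing.scale /= mulrCA.
pose LL : {linear V -> R} := HB.pack (dw p) (GRing.isLinear.Build _ _ _ _ _ Llin).
have [M M0 AM] := linear_lipschitz (f := AL) Ac.
have LLc : continuous (dw p).
  rewrite dwE => h.
  by apply: (@continuousM _ _ (cst (- g^-1)) A); [exact: cst_continuous|exact: Ac].
apply: (@is_diff_eps _ _ _ w LL p LLc).
move=> e e0.
have gV : {for (p, w p), continuous (fun q : W => ('D_eW G q)^-1)}.
  apply: smooth_germ_cont; apply: smooth_germV; first by rewrite gt_eqF.
  exact: smooth_germ_derive.
(* The errors below add up to [e1 (g^-1 + 1 + M) |h|], and [e1 <= 1] gives the bound [g^-1 + 1] on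
   [k]. *)
pose e1 := Num.min 1 (e / (g^-1 + 1 + M)).
have gi0 : 0 < g^-1 by rewrite invr_gt0.
have B0 : 0 < g^-1 + 1 + M by rewrite !addr_gt0.
have e10 : 0 < e1 by rewrite lt_min ltr01 divr_gt0.
have n1 : \forall q \near ((p, w p) : W), `|g^-1 - ('D_eW G q)^-1| < e1.
  by move/cvgrPdist_lt : gV; apply.
have [d2 d20 dP] := (nbhs_normP _ _).1 n1.
have n2 : \forall h \near (0 : V), `|h| < d2.
  by apply/nbhs_normP; exists d2 => // h /=; rewrite sub0r normrN.
have n3 : \forall h \near (0 : V), `|w p - w (h + p)| < d2.
  have n3' : \forall q \near p, `|w p - w q| < d2.
    by have /cvgrPdist_lt := implicit_cont pd; apply.
  by move: n3'; rewrite (near_shift 0 p) subr0.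
have n4 : \forall h \near (0 : V), `|G (h + p, w p) - G (p, w p) - A h| <= e1 * `|h|.
  have c0 : {for (0 : V), continuous (fun h : V => (h, 0) : W)}.
    apply: (@continuous_pairf _ _ _ _ id (cst (0 : R))); first exact: cvg_id.
    exact: cst_continuous.
  have : \forall h \near (0 : V), `|G (((h, 0) : W) + (p, w p)) - G (p, w p)
      - 'd G (p, w p) ((h, 0) : W)| <= e1 * `|(h, 0) : W|.
    exact: c0 _ (diff_eps Gd e10).
  apply: filterS => h.
  rewrite -[(h, 0) + (p, w p)]/(h + p, 0 + w p) add0r.
  by rewrite prod_normE /= normr0 max_l.
have n5 : \forall h \near (0 : V), `|h + p - p0| < d1.
  by move: (near_dom pd); rewrite (near_shift 0 p) subr0.
near=> h.
have hd1 : `|h + p - p0| < d1 by near: h.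
have hd : `|h + p - p0| < d by exact: lt_le_trans hd1 d1d.
have [whd Gh] := wP hd1.
pose D := w (h + p) - w p.
have hG : `|G (h + p, w p) - A h| <= e1 * `|h|.
  rewrite -[X in X - A h]subr0 -Gw; near: h; exact: n4.
have hd2 : `|h| < d2 by near: h.
have wd2 : `|w p - w (h + p)| < d2 by near: h.
(* By the mean value theorem in the last variable, [k] is the inverse of the derivative of [G] at an
   intermediate point, close to [g^-1]. If [D = 0] then [G (h + p, w p) = 0] as well, and [k = g^-1]
   will do. *)
have [k [kg kD]] : exists k, `|g^-1 - k| <= e1 /\ D = - (k * G (h + p, w p)).
  have [D0|D0] := eqVneq D 0.
    exists g^-1; rewrite subrr normr0 (ltW e10); split => //.
    have -> : w p = w (h + p) by apply/esym/eqP; rewrite -subr_eq0 -/D D0.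
    by rewrite Gh mulr0 oppr0.
  have [|s sD [sd E]] := implicit_mvt D0 hd wd; first by rewrite /D subrK.
  move: E; rewrite {1}/D subrK Gh sub0r => E.
  have [_ gp] := GP hd sd.
  exists ('D_eW G (h + p, s + w p))^-1; split.
    apply: ltW; apply: dP; rewrite /= prod_normE /= gt_max; apply/andP; split.
      by rewrite opprD addrCA subrr addr0 normrN.
    rewrite opprD addrCA subrr addr0 normrN; apply: lt_trans sD _.
    by rewrite /D distrC.
  by rewrite -mulrN E mulrCA mulVf ?gt_eqF // mulr1.
have -> : w (h + p) - w p - LL h =
    (g^-1 - k) * A h - k * (G (h + p, w p) - A h).
  by rewrite -/D kD /= dwE; ring.
apply: (le_trans (ler_normB _ _)); rewrite !normrM.
have k1 : `|k| <= g^-1 + 1.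
  have -> : k = g^-1 - (g^-1 - k) by ring.
  apply: (le_trans (ler_normB _ _)); rewrite gtr0_norm // lerD2l.
  by apply: (le_trans kg); rewrite ge_min lexx.
apply: (@le_trans _ _ (e1 * (M * `|h|) + (g^-1 + 1) * (e1 * `|h|))).
  by apply: lerD; apply: ler_pM => //; exact: AM.
have -> : e1 * (M * `|h|) + (g^-1 + 1) * (e1 * `|h|) = e1 * (g^-1 + 1 + M) * `|h| by ring.
by rewrite ler_wpM2r // -ler_pdivlMr // ge_min lexx orbT.
Unshelve. all: by end_near. Qed.

(** Bootstrapping: the differential of [w] at [p] is a smooth function of [(p, w p)], so [w] of
    class [C^n] has a differential of class [C^n] and is of class [C^(n+1)]. *)
Lemma implicit_smooth : has_coords W -> smooth_germ p0 w.
Proof.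
move=> Wc; pose N : set V := ball_ (fun y => `|y|) p0 d1.
have NE p : N p -> `|p - p0| < d1 by rewrite /N /ball_ /= distrC.
have oN : open N.
  rewrite openE => p /NE /near_dom; apply: filterS => q.
  by rewrite /N /ball_ /= distrC.
pose N' : set W := [set q | `|q.1 - p0| < d /\ `|q.2 - w0| < d].
have oN' : open N'.
  have -> : N' = (fun q : W => `|q.1 - p0|) @^-1` [set x | x < d] `&`
    (fun q : W => `|q.2 - w0|) @^-1` [set x | x < d] by [].
  apply: openI; apply: open_comp; try exact: open_lt; move=> q _.
    apply: (continuous_comp (f := fun q : W => q.1 - p0) (g := fun x => `|x|)).
      by apply: continuousB; [exact: continuous_fst|exact: cst_continuous].
    exact: norm_continuous.
  apply: (continuous_comp (f := fun q : W => q.2 - w0) (g := fun x : R => `|x|)).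
    by apply: continuousB; [exact: continuous_snd|exact: cst_continuous].
  exact: norm_continuous.
have NN' p : N p -> N' (p, w p).
  by move=> /NE pd; have [] := wP pd; split => //=; exact: lt_le_trans d1d.
exists N; split => //; first by rewrite /N /ball_ /= subrr normr0.
elim=> [|n IH]; first by move=> p /NE; exact: implicit_cont.
apply: (Cn_on_step oN (df := dw)) => [p /NE|v]; first exact: implicit_diff.
have gC : Cn_on n N (fun p => (p, w p) : W).
  apply: Cn_on_pair => //; apply: (@Cn_on_linear _ _ _ _ _ idfun) => //.
  by move=> x; exact: cvg_id.
pose F (q : W) := (- 'D_((v, 0) : W) G q) / 'D_eW G q.
apply: (@Cn_on_comp _ _ _ _ _ _ N' (fun p => (p, w p) : W) F) => //.
apply: (smooth_onP _ oN').2 => q [q1 q2].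
have [Gs Gp] := GP q1 q2; rewrite -surjective_pairing in Gs Gp.
apply: smooth_germM; first by apply: smooth_germN; exact: smooth_germ_derive.
by apply: smooth_germV; [rewrite gt_eqF|exact: smooth_germ_derive].
Qed.

End Positive.

(** The last clause, local uniqueness, is what turns the solution of [g(x, t) = u] for [x] into a
    left inverse, and not only a right inverse, of [(g, t)]. *)
Lemma implicit_function (G : W -> R) (p0 : V) (w0 : R) : has_coords W ->
  smooth_germ ((p0, w0) : W) G -> G (p0, w0) = 0 -> 'D_eW G (p0, w0) != 0 ->
  exists w : V -> R, [/\ smooth_germ p0 w, w p0 = w0,
    \forall p \near p0, G (p, w p) = 0 &
    \forall q \near ((p0, w0) : W), G q = 0 -> q.2 = w q.1].
Proof.
move=> Wc; wlog Gpos : G / 0 < 'D_eW G (p0, w0).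
  move=> H Gs G0 G1; move: (G1); rewrite neq_lt => /orP[Gneg|Gpos]; last exact: H.
  have D v : 'D_v (fun q => - G q) (p0, w0) = - 'D_v G (p0, w0).
    by rewrite deriveN //; exact/diff_derivable/smooth_germ_diff.
  have [||||w [ws ww wG wu]] := H (fun q => - G q).
  - by rewrite D oppr_gt0.
  - exact: smooth_germN.
  - by rewrite G0 oppr0.
  - by rewrite D oppr_eq0.
  exists w; split => //.
    by apply: filterS wG => p /eqP; rewrite oppr_eq0 => /eqP.
  by apply: filterS wu => q H' Gq; apply: H'; rewrite Gq oppr0.
move=> Gs G0 _.
have n1 : \forall q \near ((p0, w0) : W), 0 < 'D_eW G q.
  by have /smooth_germ_cont/cvgr_gt := smooth_germ_derive eW Gs; apply.
have [d d0 dP] := (nbhs_normP _ _).1 (filterI (smooth_germ_near Gs) n1).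
have GP p y : `|p - p0| < d -> `|y - w0| < d ->
    smooth_germ ((p, y) : W) G /\ 0 < 'D_eW G (p, y).
  by move=> pd yd; apply: dP; rewrite /= prod_normE gt_max /= !(distrC _ p) !(distrC _ y) pd.
have [d1 [w [d10 d1d wP]]] := implicit_exists G0 d0 GP.
have z1 : `|p0 - p0| < d1 by rewrite subrr normr0.
have [wd0 Gw0] := wP _ z1.
exists w; split.
- exact: (implicit_smooth GP d10 d1d wP Wc).
- by apply: (implicit_inj GP _ wd0 _ Gw0 G0); rewrite subrr normr0.
- by apply/nbhs_normP; exists d1 => // p /=; rewrite distrC => /wP[].
- apply/nbhs_normP; exists d1 => // -[p y] /=; rewrite prod_normE gt_max /=.
  rewrite distrC => /andP[pd yd] Gq; have [wd Gw] := wP _ pd.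
  apply: (implicit_inj GP _ _ wd Gq Gw); first exact: lt_le_trans d1d.
  by rewrite distrC; exact: lt_le_trans d1d.
Qed.

End Implicit.

(** * Diffeomorphism germs and left-right equivalence *)

Section ChainRule.
Context {R : realType}.
Implicit Types V W X : normedModType R.

Local Notation eX := ((1, 0) : plane R).
Local Notation eY := ((0, 1) : plane R).

Lemma derive_linear V W (L : {linear V -> W}) x v : continuous L ->
  'D_v L x = L v.
Proof. by move=> Lc; rewrite deriveE ?diff_lin //; exact: linear_differentiable. Qed.

Lemma derive_linear_comp V W X (L : {linear W -> X}) (f : V -> W) x v :
  continuous L -> differentiable f x ->
  'D_v (fun y => L (f y)) x = L ('D_v f x).
Proof.
move=> Lc fx; rewrite [in RHS]deriveE //.
have Ld : is_diff (f x) L L.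
  by split; [exact: linear_differentiable|exact: diff_lin].
exact: is_diff_deriveE (is_diff_comp (differentiableP fx) Ld).
Qed.

Lemma derive_fst V W X (f : V -> W * X) x v : differentiable f x ->
  'D_v (fun y => (f y).1) x = ('D_v f x).1.
Proof. by move=> fx; apply: (@derive_linear_comp _ _ _ fst) => // y; exact: cvg_fst. Qed.

Lemma derive_snd V W X (f : V -> W * X) x v : differentiable f x ->
  'D_v (fun y => (f y).2) x = ('D_v f x).2.
Proof. by move=> fx; apply: (@derive_linear_comp _ _ _ snd) => // y; exact: cvg_snd. Qed.

Lemma derive_pair V W X (f : V -> W) (g : V -> X) x v : differentiable f x ->
  differentiable g x -> 'D_v (fun y => (f y, g y)) x = ('D_v f x, 'D_v g x).
Proof.
move=> fx gx; rewrite !deriveE //; last exact: differentiable_pair.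
by rewrite diff_pair.
Qed.

Lemma derive_comp V W X (f : V -> W) (g : W -> X) x v : differentiable f x ->
  differentiable g (f x) -> 'D_v (fun y => g (f y)) x = 'D_('D_v f x) g (f x).
Proof.
move=> fx gx; rewrite (deriveE _ gx) (deriveE _ fx).
exact: is_diff_deriveE (is_diff_comp (differentiableP fx) (differentiableP gx)).
Qed.

Lemma derive_plane W (f : plane R -> W) (z v : plane R) : differentiable f z ->
  'D_v f z = v.1 *: 'D_eX f z + v.2 *: 'D_eY f z.
Proof.
move=> fz; rewrite !deriveE //.
have -> : 'd f z v = 'd f z (v.1 *: eX + v.2 *: eY).
  congr ('d f z _); case: v => a b; apply: injective_projections => /=.
    by rewrite [_%:A]mulr1 scaler0 addr0.
  by rewrite [_%:A]mulr1 scaler0 add0r.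
by rewrite linearD !linearZ.
Qed.

Lemma derive_comp2 V W (a b : V -> R) (f : plane R -> W) x v :
  differentiable a x -> differentiable b x -> differentiable f (a x, b x) ->
  'D_v (fun y => f (a y, b y)) x =
  'D_v a x *: 'D_eX f (a x, b x) + 'D_v b x *: 'D_eY f (a x, b x).
Proof.
move=> ax bx fx; rewrite (derive_comp (f := fun y => (a y, b y))) //.
  by rewrite derive_plane // derive_pair.
exact: differentiable_pair.
Qed.

Lemma deriveM_smooth V (a b : V -> R) x v : differentiable a x ->
  differentiable b x ->
  'D_v (fun y => a y * b y) x = a x * 'D_v b x + b x * 'D_v a x.
Proof. by move=> ax bx; rewrite deriveM //; exact: diff_derivable. Qed.

Lemma deriveB_smooth V W (a b : V -> W) x v : differentiable a x ->
  differentiable b x -> 'D_v (fun y => a y - b y) x = 'D_v a x - 'D_v b x.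
Proof. by move=> ax bx; rewrite deriveB //; exact: diff_derivable. Qed.

Lemma deriveD_smooth V W (a b : V -> W) x v : differentiable a x ->
  differentiable b x -> 'D_v (fun y => a y + b y) x = 'D_v a x + 'D_v b x.
Proof. by move=> ax bx; rewrite deriveD //; exact: diff_derivable. Qed.

Lemma smooth_fst V W (x : V * W) : smooth_germ x fst.
Proof. by apply: smooth_germ_linear => y; exact: cvg_fst. Qed.

Lemma smooth_snd V W (x : V * W) : smooth_germ x snd.
Proof. by apply: smooth_germ_linear => y; exact: cvg_snd. Qed.

Lemma smooth_germ_comp2 V W (a b : V -> R) (f : plane R -> W) x :
  smooth_germ x a -> smooth_germ x b -> smooth_germ (a x, b x) f ->
  smooth_germ x (fun y => f (a y, b y)).
Proof.
move=> ax bx fx; apply: (smooth_germ_comp (g := fun y => (a y, b y))) => //.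
  exact: has_coords_plane.
exact: smooth_germ_pair.
Qed.

End ChainRule.

Section Diffeos.
Context {R : realType}.
Implicit Types f g h phi psi : plane R -> plane R.

Local Notation eX := ((1, 0) : plane R).
Local Notation eY := ((0, 1) : plane R).

Lemma near_comp (V W : normedModType R) (f : V -> W) (x : V) (P : W -> Prop) :
  {for x, continuous f} -> (\forall y \near f x, P y) -> \forall z \near x, P (f z).
Proof. by move=> fc Pf; exact: fc Pf. Qed.

Lemma near_comp0 (V W : normedModType R) (f : V -> W) (P : W -> Prop) :
  smooth_germ 0 f -> f 0 = 0 -> (\forall y \near (0 : W), P y) ->
  \forall z \near (0 : V), P (f z).
Proof.
by move=> /smooth_germ_cont fc f0 Pf; apply: near_comp => //; rewrite f0.
Qed.

Lemma near_all (V : normedModType R) (x : V) (P : V -> Prop) :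
  (forall z, P z) -> \forall z \near x, P z.
Proof. by move=> H; near=> z; exact: H. Unshelve. all: by end_near. Qed.

Lemma diffeo_germ_sym phi phi' : diffeo_germ phi phi' -> diffeo_germ phi' phi.
Proof. by move=> [? ? ? ? [? ?]]; split. Qed.

Lemma diffeo_germ_id : diffeo_germ (id : plane R -> plane R) id.
Proof.
by split => //; try exact: smooth_germ_id; split; apply: near_all => z.
Qed.

Lemma diffeo_germ_comp phi phi' psi psi' : diffeo_germ phi phi' ->
  diffeo_germ psi psi' ->
  diffeo_germ (fun z => psi (phi z)) (fun z => phi' (psi' z)).
Proof.
move=> [s1 s1' z1 z1' [i1 i1']] [s2 s2' z2 z2' [i2 i2']]; split.
- by apply: smooth_germ_comp => //; [exact: has_coords_plane|rewrite z1].
- by apply: smooth_germ_comp => //; [exact: has_coords_plane|rewrite z2'].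
- by rewrite z1 z2.
- by rewrite z2' z1'.
- split.
    have := near_comp0 s1 z1 i2; apply: filterS2 i1 => z e1 e2.
    by rewrite e2.
  have := near_comp0 s2' z2' i1'; apply: filterS2 i2' => z e1 e2.
  by rewrite e2.
Qed.

Lemma A_equiv_intro f g phi phi' psi psi' : diffeo_germ phi phi' ->
  diffeo_germ psi psi' -> (\forall z \near (0 : plane R), g z = psi (f (phi z))) ->
  A_equiv f g.
Proof.
by move=> /diffeo_germ_sym d1 d2 E; exists phi', phi, psi, psi'.
Qed.

Lemma A_equiv_target f psi psi' : diffeo_germ psi psi' ->
  A_equiv f (fun z => psi (f z)).
Proof. by move=> d; apply: (A_equiv_intro diffeo_germ_id d); apply: near_all => z. Qed.

Lemma A_equiv_trans f g h : A_equiv f g -> A_equiv g h -> A_equiv f h.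
Proof.
move=> [p1 [p1' [q1 [q1' [dp1 dq1 E1]]]]] [p2 [p2' [q2 [q2' [dp2 dq2 E2]]]]].
exists (fun z => p2 (p1 z)), (fun z => p1' (p2' z)),
  (fun z => q2 (q1 z)), (fun z => q1' (q2' z)).
split; [exact: diffeo_germ_comp|exact: diffeo_germ_comp|].
have [_ s _ z0 _] := dp2.
have := near_comp0 s z0 E1; apply: filterS2 E2 => z e1 e2.
by rewrite e1 e2.
Qed.

(* No value of [f] is prescribed at the origin, so the symmetry of the relation
   requires [f] to be a germ fixing the origin. *)
Lemma A_equiv_sym f g : f 0 = 0 -> {for 0, continuous f} ->
  A_equiv f g -> A_equiv g f.
Proof.
move=> f0 fc [p [p' [q [q' [dp dq E]]]]].
exists p', p, q', q; split; [exact: diffeo_germ_sym|exact: diffeo_germ_sym|].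
have [s _ z0 _ [i _]] := dp; have [_ _ _ _ [j _]] := dq.
have n1 := near_comp0 s z0 E.
have n2 : \forall z \near (0 : plane R), q' (q (f z)) = f z.
  by apply: (near_comp (P := fun y => q' (q y) = y) fc); rewrite f0.
apply: filterS3 i n1 n2 => z e1 e2 e3.
by rewrite e2 e1 e3.
Qed.

Lemma diffeo_germ_swap : diffeo_germ (fun z : plane R => (z.2, z.1))
  (fun z : plane R => (z.2, z.1)).
Proof.
have s : smooth_germ 0 (fun z : plane R => (z.2, z.1)).
  by apply: smooth_germ_pair; [exact: smooth_snd|exact: smooth_fst].
by split => //; split; apply: near_all => -[].
Qed.

(** The inverse solves the single equation [g(x, t) = u] for [x]. The coordinate changes of the
    normal forms are built from such triangular maps and the swap of coordinates, so a scalar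
    implicit function theorem is enough. *)
Lemma diffeo_germ_triX (g : plane R -> R) : smooth_germ 0 g -> g 0 = 0 ->
  'D_eX g 0 != 0 -> exists phi', diffeo_germ (fun z => (g z, z.2)) phi'.
Proof.
move=> gs g0 gx.
pose G (q : plane R * R) := g (q.2, q.1.2) - q.1.1.
have s2 x : smooth_germ x (fun q : plane R * R => q.1.2).
  by apply: smooth_germ_snd; exact: smooth_fst.
have s1 x : smooth_germ x (fun q : plane R * R => q.1.1).
  by apply: smooth_germ_fst; exact: smooth_fst.
have sg : smooth_germ ((0 : plane R), (0 : R)) (fun q : plane R * R => g (q.2, q.1.2)).
  by apply: smooth_germ_comp2 => //; exact: smooth_snd.
have [||||w [ws w0 wG wu]] := @implicit_function R (plane R) G 0 0.
- by apply: has_coords_prod; [exact: has_coords_plane|exact: has_coords_R].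
- by apply: smooth_germB.
- by rewrite /G /= [g _]g0 subrr.
- rewrite deriveB_smooth; try exact: smooth_germ_diff.
  rewrite (@derive_comp2 _ _ _ snd) /=; try exact: smooth_germ_diff; last first.
    exact: smooth_germ_diff (smooth_snd _).
  rewrite (derive_linear (L := snd)) /=; last by move=> y; exact: cvg_snd.
  rewrite (derive_snd (f := fst)); last exact: smooth_germ_diff (smooth_fst _).
  rewrite (derive_fst (f := fst)); last exact: smooth_germ_diff (smooth_fst _).
  rewrite (derive_linear (L := fst)) /=; last by move=> y; exact: cvg_fst.
  by rewrite scale1r scale0r addr0 subr0.
exists (fun z => (w z, z.2)); split.
- by apply: smooth_germ_pair => //; exact: smooth_snd.
- by apply: smooth_germ_pair => //; exact: smooth_snd.
- by rewrite g0.
- by rewrite w0.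
- split.
    have c : {for (0 : plane R), continuous (fun z : plane R => ((g z, z.2), z.1) : plane R * R)}.
      apply: smooth_germ_cont; apply: smooth_germ_pair; last exact: smooth_fst.
      by apply: smooth_germ_pair => //; exact: smooth_snd.
    have := near_comp c; rewrite /= g0 => /(_ _ wu).
    apply: filterS => z /=; rewrite /G /= -surjective_pairing subrr => /(_ erefl) <-.
    by rewrite -surjective_pairing.
  apply: filterS wG => z; rewrite /G /= => /subr0_eq ->.
  by rewrite -surjective_pairing.
Qed.

Lemma diffeo_germ_triY (g : plane R -> R) : smooth_germ 0 g -> g 0 = 0 ->
  'D_eY g 0 != 0 -> exists phi', diffeo_germ (fun z => (z.1, g z)) phi'.
Proof.
move=> gs g0 gy.
have gs' : smooth_germ 0 (fun z : plane R => g (z.2, z.1)).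
  by apply: smooth_germ_comp2 => //; [exact: smooth_snd|exact: smooth_fst].
have [//||phi' d] := @diffeo_germ_triX (fun z => g (z.2, z.1)) gs'.
  rewrite (@derive_comp2 _ _ _ snd fst) /=; try exact: smooth_germ_diff; try
    by apply: smooth_germ_diff; (exact: smooth_snd || exact: smooth_fst).
  rewrite (derive_linear (L := snd)) /=; last by move=> y; exact: cvg_snd.
  rewrite (derive_linear (L := fst)) /=; last by move=> y; exact: cvg_fst.
  by rewrite scale1r scale0r add0r.
have := diffeo_germ_comp (diffeo_germ_comp diffeo_germ_swap d) diffeo_germ_swap.
move=> /= d'; exists (fun z => ((phi' (z.2, z.1)).2, (phi' (z.2, z.1)).1)).
have -> // : (fun z => (z.1, g z)) = (fun z : plane R => (z.1, g (z.1, z.2))).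
by apply/funext => z; rewrite -surjective_pairing.
Qed.

Lemma smooth_germ_translate (V W : normedModType R) (f : V -> W) (q x : V) :
  smooth_germ (q + x) f -> smooth_germ x (fun z => f (q + z)).
Proof.
move=> fq.
have := @smooth_germ_affine _ _ _ _ x idfun q f; rewrite /= addrC => /(_ _ fq) H.
apply: smooth_germ_ext (H _); last by move=> y; exact: cvg_id.
by apply: nearW => z; rewrite addrC.
Qed.

Lemma near_translate (V : normedModType R) (q : V) (P : V -> Prop) :
  (\forall x \near q, P x) -> \forall z \near (0 : V), P (q + z).
Proof.
move=> H; have c : {for (0 : V), continuous (fun z => q + z)}.
  by apply: continuousD; [exact: cst_continuous|exact: cvg_id].
by apply: (near_comp c); rewrite addr0.
Qed.

Lemma germ_at_smooth f q : smooth_germ q f -> smooth_germ 0 (germ_at f q).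
Proof.
move=> fq; apply: smooth_germB; last exact: smooth_germ_cst.
by apply: smooth_germ_translate; rewrite addr0.
Qed.

Lemma germ_at0 f q : germ_at f q 0 = 0.
Proof. by rewrite /germ_at addr0 subrr. Qed.

(** Stability compares germs at displaced points, so a coordinate change at the origin has to induce
    one at every nearby point. *)
Lemma diffeo_germ_at phi phi' : diffeo_germ phi phi' ->
  \forall q \near (0 : plane R),
    diffeo_germ (germ_at phi q) (germ_at phi' (phi q)).
Proof.
move=> [s s' z0 z0' [i i']].
have n1 := near_comp0 s z0 (smooth_germ_near s').
have n3 := smooth_germ_near s.
have n4 : \forall q \near (0 : plane R), \forall w \near q, phi' (phi w) = w.
  have [D [oD D0 DP]] := nbhs_openE i.
  apply: filterS (open_nbhs_nbhs (conj oD D0)) => q Dq.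
  exact: filterS (open_nbhs_nbhs (conj oD Dq)).
have n5 : \forall q \near (0 : plane R), \forall w \near phi q, phi (phi' w) = w.
  have [D [oD D0 DP]] := nbhs_openE i'.
  apply: (near_comp0 (P := fun y => \forall w \near y, phi (phi' w) = w) s z0).
  apply: filterS (open_nbhs_nbhs (conj oD D0)) => q Dq.
  exact: filterS (open_nbhs_nbhs (conj oD Dq)).
near=> q.
have i1 : \forall w \near q, phi' (phi w) = w by near: q.
have i2 : \forall w \near phi q, phi (phi' w) = w by near: q.
have e1 := nbhs_singleton i1.
split.
- by apply: germ_at_smooth; near: q.
- by apply: germ_at_smooth; near: q.
- exact: germ_at0.
- exact: germ_at0.
- split.
    have := near_translate i1; apply: filterS => z.
    by rewrite /germ_at subrKC e1 => ->; rewrite addrC addKr.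
  have := near_translate i2; apply: filterS => z.
  by rewrite /germ_at e1 subrKC => ->; rewrite addrC addKr.
Unshelve. all: by end_near. Qed.

End Diffeos.

(** * Normal forms *)

Section Prenormal.
Context {R : realType}.
Implicit Types f g : plane R -> plane R.

Local Notation eX := ((1, 0) : plane R).
Local Notation eY := ((0, 1) : plane R).

Lemma near_axis (P : plane R -> Prop) :
  (\forall z \near (0 : plane R), P z) -> \forall u \near (0 : R), P (u, 0).
Proof.
move=> H; apply: (@near_comp0 _ _ _ (fun u : R => (u, 0) : plane R)) => //.
by apply: smooth_germ_pair; [exact: smooth_germ_id|exact: smooth_germ_cst].
Qed.

Lemma near_fst (P : R -> Prop) :
  (\forall u \near (0 : R), P u) -> \forall z \near (0 : plane R), P z.1.
Proof.
by move=> H; apply: (@near_comp0 _ _ _ (fst : plane R -> R)) => //; exact: smooth_fst.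
Qed.

Lemma near_near (V : normedModType R) (x : V) (P : V -> Prop) :
  (\forall z \near x, P z) -> \forall z \near x, \forall w \near z, P w.
Proof.
move=> /nbhs_openE[D [oD Dx DP]].
apply: filterS (open_nbhs_nbhs (conj oD Dx)) => z Dz.
exact: filterS (open_nbhs_nbhs (conj oD Dz)).
Qed.

Lemma derive_planeY (z : plane R) : 'D_eY (snd : plane R -> R) z = 1.
Proof. by rewrite (derive_linear (L := snd)) //; move=> y; exact: cvg_snd. Qed.

Lemma derive_planeX2 (z : plane R) : 'D_eX (snd : plane R -> R) z = 0.
Proof. by rewrite (derive_linear (L := snd)) //; move=> y; exact: cvg_snd. Qed.

Lemma derive_planeX (z : plane R) : 'D_eX (fst : plane R -> R) z = 1.
Proof. by rewrite (derive_linear (L := fst)) //; move=> y; exact: cvg_fst. Qed.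

Lemma derive_planeY1 (z : plane R) : 'D_eY (fst : plane R -> R) z = 0.
Proof. by rewrite (derive_linear (L := fst)) //; move=> y; exact: cvg_fst. Qed.

Lemma derive_mulY (k : plane R -> R) (z : plane R) : smooth_germ z k ->
  'D_eY (fun w : plane R => w.2 * k w) z = k z + z.2 * 'D_eY k z.
Proof.
move=> ks; rewrite deriveM_smooth; try exact: smooth_germ_diff; last first.
  exact: smooth_germ_diff (smooth_snd _).
by rewrite derive_planeY mulr1 addrC.
Qed.

Lemma hadamard2 (h : plane R -> R) : smooth_germ 0 h ->
  (\forall u \near (0 : R), h (u, 0) = 0) ->
  (\forall u \near (0 : R), 'D_eY h (u, 0) = 0) ->
  exists2 c : plane R -> R, smooth_germ 0 c &
    \forall z \near (0 : plane R), h z = z.2 ^+ 2 * c z.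
Proof.
move=> hs h0 h1; have [k ks hk] := hadamard hs h0.
have k0 : \forall u \near (0 : R), k (u, 0) = 0.
  have n1 := near_axis (near_near hk).
  have n2 := near_axis (smooth_germ_near ks).
  apply: filterS3 h1 n1 n2 => u h1u n1u n2u.
  move: h1u; rewrite (near_eq_derive _ n1u) derive_mulY //=.
  by rewrite mul0r addr0.
have [c cs kc] := hadamard ks k0.
exists c => //; apply: filterS2 hk kc => z -> ->.
by rewrite expr2 mulrA.
Qed.

Lemma hadamard1 (a : R -> R) : smooth_germ 0 a -> a 0 = 0 ->
  exists k : R -> R, [/\ smooth_germ 0 k, k 0 = 'D_1 a 0 &
    \forall x \near (0 : R), a x = x * k x].
Proof.
move=> as_ a0.
have hs : smooth_germ 0 (fun z : plane R => a z.2).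
  by apply: (smooth_germ_comp (g := snd)) => //; [exact: has_coords_R|exact: smooth_snd].
have [|k ks hk] := hadamard hs; first by apply: near_all => u.
have ps : smooth_germ 0 (fun x : R => (0, x) : plane R).
  by apply: smooth_germ_pair; [exact: smooth_germ_cst|exact: smooth_germ_id].
have kps : smooth_germ 0 (fun x : R => k (0, x)).
  by apply: (smooth_germ_comp (g := fun x : R => (0, x) : plane R)) => //; exact: has_coords_plane.
have E : \forall x \near (0 : R), a x = x * k (0, x).
  exact: (near_comp0 (P := fun z : plane R => a z.2 = z.2 * k z) ps).
exists (fun x => k (0, x)); split => //.
rewrite (near_eq_derive _ E) deriveM_smooth; last 2 first.
- exact: smooth_germ_diff (smooth_germ_id _).
- exact: smooth_germ_diff.
by rewrite mul0r add0r derive_id mulr1.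
Qed.

Definition jac f (z : plane R) : R :=
  ('D_eX f z).1 * ('D_eY f z).2 - ('D_eY f z).1 * ('D_eX f z).2.

Lemma jac_comp f g z : differentiable f z -> differentiable g (f z) ->
  jac (fun w => g (f w)) z = jac g (f z) * jac f z.
Proof.
move=> fz gz; rewrite /jac (etrans (derive_comp eX fz gz) (derive_plane _ gz)).
rewrite (etrans (derive_comp eY fz gz) (derive_plane _ gz)).
move: ('D_eX g (f z)) ('D_eY g (f z)) ('D_eX f z) ('D_eY f z).
move=> [a b] [c d] [a' b'] [c' d'] /=.
have E (x y : R) : x *: y = x * y by [].
by rewrite !E; ring.
Qed.

Lemma jac_near f g z : (\forall w \near z, f w = g w) -> jac f z = jac g z.
Proof. by move=> fg; rewrite /jac !(near_eq_derive _ fg). Qed.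

Lemma jac_smooth f z : smooth_germ z f -> smooth_germ z (jac f).
Proof.
move=> fz; apply: smooth_germB; apply: smooth_germM;
  (apply: smooth_germ_fst || apply: smooth_germ_snd); exact: smooth_germ_derive.
Qed.

Lemma derive_pairl (h : plane R -> R) z v : differentiable h z ->
  'D_v (fun w => (w.1, h w)) z = (v.1, 'D_v h z).
Proof.
move=> hz; rewrite (derive_pair (f := fst)) //; last exact: smooth_germ_diff (smooth_fst _).
by rewrite (derive_linear (L := fst)) //; move=> y; exact: cvg_fst.
Qed.

Lemma jac_pairl (h : plane R -> R) z : differentiable h z ->
  jac (fun w => (w.1, h w)) z = 'D_eY h z.
Proof. by move=> hz; rewrite /jac !derive_pairl //= mul1r mul0r subr0. Qed.

(** The first component of [f] is taken as the new coordinate [u]. This change keeps the axis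
    [t = 0], so the vanishing of the Jacobian determinant there becomes [d_t h = 0] for the second
    component [h]. Subtracting [h(u, 0)] in the target straightens the support, and Hadamard's lemma
    applies twice. *)
Lemma prenormal_fst f : f 0 = 0 -> smooth_germ 0 f -> ('D_eX f 0).1 != 0 ->
  (\forall u \near (0 : R), jac f (u, 0) = 0) ->
  exists2 c : plane R -> R, smooth_germ 0 c &
    A_equiv f (fun z => (z.1, z.2 ^+ 2 * c z)).
Proof.
move=> f0 fs fx fj.
have f1s : smooth_germ 0 (fun z => (f z).1) by exact: smooth_germ_fst.
have [||phi' d] := diffeo_germ_triX f1s; first by rewrite f0.
  by rewrite derive_fst //; exact: smooth_germ_diff.
have [_ ps _ p0 [_ pK]] := d.
pose h z := (f (phi' z)).2.
have fps : smooth_germ 0 (fun z => f (phi' z)).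
  by apply: smooth_germ_comp => //; [exact: has_coords_plane|rewrite p0].
have hs : smooth_germ 0 h by exact: smooth_germ_snd.
have fh : \forall z \near (0 : plane R), f (phi' z) = (z.1, h z).
  apply: filterS pK => z /= e; rewrite /h -{2}e /=; exact: surjective_pairing.
have h1 : \forall u \near (0 : R), 'D_eY h (u, 0) = 0.
  have n1 := near_axis (near_near fh).
  have n2 := near_axis (smooth_germ_near hs).
  have n3 := near_axis (smooth_germ_near ps).
  have n4 := near_axis (near_comp0 ps p0 (smooth_germ_near fs)).
  have n5 : \forall u \near (0 : R), jac f (phi' (u, 0)) = 0.
    have ps1 : smooth_germ 0 (fun u : R => (phi' (u, 0)).1).
      apply: smooth_germ_fst; apply: smooth_germ_comp2 => //.
        exact: smooth_germ_id.
      exact: smooth_germ_cst.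
    have := near_comp0 ps1 _ fj; rewrite p0 => /(_ erefl).
    apply: filterS2 (near_axis pK) => u /= e.
    by rewrite [phi' (u, 0) in X in _ -> X]surjective_pairing; case: e => _ ->.
  near=> u.
  rewrite -jac_pairl; last by apply: smooth_germ_diff; near: u.
  rewrite -(@jac_near (fun z => f (phi' z))); last by near: u.
  rewrite jac_comp; [|by apply: smooth_germ_diff; near: u..].
  by rewrite (near n5 u) // mul0r.
pose h2 z := h z - h (z.1, 0).
have hxs : smooth_germ 0 (fun z : plane R => h (z.1, 0)).
  apply: smooth_germ_comp2 => //; [exact: smooth_fst|exact: smooth_germ_cst].
have h2s : smooth_germ 0 h2 by apply: smooth_germB.
have h20 : \forall u \near (0 : R), h2 (u, 0) = 0.
  by apply: near_all => u; rewrite /h2 subrr.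
have h21 : \forall u \near (0 : R), 'D_eY h2 (u, 0) = 0.
  have n2 := near_axis (smooth_germ_near hs).
  apply: filterS2 h1 n2 => u h1u hsu.
  have hd := smooth_germ_diff hsu.
  rewrite deriveB_smooth //; last first.
    apply: smooth_germ_diff; apply: smooth_germ_comp2 => //; [exact: smooth_fst|exact: smooth_germ_cst].
  rewrite h1u sub0r (@derive_comp2 _ _ _ fst (cst 0)) //; last first.
    exact: smooth_germ_diff (smooth_fst _).
  by rewrite derive_planeY1 derive_cst !scale0r addr0 oppr0.
have [c cs hc] := hadamard2 h2s h20 h21.
exists c => //.
have [psi' dp] : exists psi', diffeo_germ (fun z : plane R => (z.1, z.2 - h (z.1, 0))) psi'.
  apply: diffeo_germ_triY.
  - by apply: smooth_germB => //; exact: smooth_snd.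
  - by rewrite /h p0 f0 /= subrr.
  - rewrite deriveB_smooth; last 2 first.
    + exact: smooth_germ_diff (smooth_snd _).
    + exact: smooth_germ_diff.
    rewrite derive_planeY (@derive_comp2 _ _ _ fst (cst 0)) //; last 2 first.
    + exact: smooth_germ_diff (smooth_fst _).
    + exact: smooth_germ_diff.
    by rewrite derive_planeY1 derive_cst !scale0r addr0 subr0 oner_neq0.
apply: (A_equiv_intro (diffeo_germ_sym d) dp).
by apply: filterS2 hc fh => z <- ->.
Unshelve. all: by end_near. Qed.

Lemma prenormal f : f 0 = 0 -> smooth_germ 0 f -> 'D_eX f 0 != 0 ->
  (\forall u \near (0 : R), jac f (u, 0) = 0) ->
  exists2 c : plane R -> R, smooth_germ 0 c &
    A_equiv f (fun z => (z.1, z.2 ^+ 2 * c z)).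
Proof.
move=> f0 fs fx fj.
have [x0|x0] := eqVneq ('D_eX f 0).1 0; last exact: prenormal_fst.
have x1 : ('D_eX f 0).2 != 0.
  by apply: contra fx => /eqP x1; rewrite [X in X == _]surjective_pairing x0 x1.
pose sw (z : plane R) : plane R := (z.2, z.1).
have sws z : smooth_germ z sw by apply: smooth_germ_pair; [exact: smooth_snd|exact: smooth_fst].
have Dsw z v : 'D_v sw z = sw v.
  rewrite /sw derive_pair; try exact: smooth_germ_diff (smooth_snd _); last first.
    exact: smooth_germ_diff (smooth_fst _).
  rewrite (derive_linear (L := fst)); last by move=> y; exact: cvg_fst.
  by rewrite (derive_linear (L := snd)) //; move=> y; exact: cvg_snd.
have d := diffeo_germ_swap (R := R).
have [||||c cs E] := @prenormal_fst (fun z => sw (f z)).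
- by rewrite /sw f0.
- by apply: smooth_germ_comp => //; exact: has_coords_plane.
- by rewrite derive_comp ?Dsw //; exact: smooth_germ_diff.
- apply: filterS2 fj (near_axis (smooth_germ_near fs)) => u fju fsu.
  by rewrite jac_comp ?fju ?mulr0 //; exact: smooth_germ_diff.
exists c => //; apply: A_equiv_trans E.
exact: A_equiv_target d.
Qed.

Lemma tangential_prenormal f : tangential_family_germ f ->
  [/\ f 0 = 0, smooth_germ 0 f, 'D_eX f 0 != 0 &
   \forall u \near (0 : R), jac f (u, 0) = 0].
Proof.
move=> [f0 [r r0 [fs ft fp _]]].
have b0 : box r (0 : plane R) by split; rewrite /= normr0.
split => //.
- by exists (box r); split => //; exact: open_box.
- have z0 : `|0 : R| < r by rewrite normr0.
  by have [+ _ _] := fp 0 z0; rewrite /d_xi -[(0, 0)]/(0 : plane R).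
- have n : \forall u \near (0 : R), `|u| < r.
    by apply/nbhs_normP; exists r => // u /=; rewrite sub0r normrN.
  apply: filterS n => u /fp[_ _ [k]]; rewrite /jac /d_xi /d_t.
  move: ('D_eX f (u, 0)) ('D_eY f (u, 0)) => a [b1 b2] -> /=.
  have E (x y : R) : x *: y = x * y by [].
  by rewrite !E; ring.
Qed.

End Prenormal.

(** * From [(u, t^2 c)] to the normal forms of I and II *)

Section NormalForms.
Context {R : realType}.
Implicit Types f g : plane R -> plane R.

Local Notation eX := ((1, 0) : plane R).
Local Notation eY := ((0, 1) : plane R).

Definition prefold (c : plane R -> R) (z : plane R) : plane R :=
  (z.1, z.2 ^+ 2 * c z).

Lemma prefold0 c : prefold c 0 = 0.
Proof. by rewrite /prefold /= expr0n mul0r. Qed.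

Lemma prefold_smooth c z : smooth_germ z c -> smooth_germ z (prefold c).
Proof.
move=> cs; apply: smooth_germ_pair; first exact: smooth_fst.
by apply: smooth_germM => //; apply: smooth_germX; exact: smooth_snd.
Qed.

Lemma derive_param (V : normedModType R) (a : V -> R) (p : V) (w : R) :
  smooth_germ p a -> 'D_((0, 1) : V * R) (fun q : V * R => a q.1) (p, w) = 0.
Proof.
move=> as_; rewrite (derive_comp (f := fst)); last 2 first.
- exact: smooth_germ_diff (smooth_fst _).
- exact: smooth_germ_diff.
by rewrite (derive_linear (L := fst)) ?derive0 //= => y; exact: cvg_fst.
Qed.

Lemma smooth_param (V : normedModType R) (W : normedModType R) (a : V -> W)
  (q : V * R) : smooth_germ q.1 a -> smooth_germ q (fun q : V * R => a q.1).
Proof.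
move=> as_.
have H := @smooth_germ_affine _ _ _ _ q (fst : V * R -> V) 0 a (@continuous_fst R V R).
apply: (smooth_germ_ext (f := fun y : V * R => a (y.1 + 0))); last first.
  by apply: H; rewrite /= addr0.
by apply: near_all => y; rewrite addr0.
Qed.

Lemma derive_paramX (V : normedModType R) (a : V -> R) (p : V) (w : R) n :
  smooth_germ p a ->
  'D_((0, 1) : V * R) (fun q : V * R => a q.1 * q.2 ^+ n.+1) (p, w) =
  a p * (n.+1%:R * w ^+ n).
Proof.
move=> as_.
have sd : is_derive (p, w) ((0, 1) : V * R) (fun q : V * R => q.2) 1.
  split; first by apply: diff_derivable; exact: smooth_germ_diff (smooth_snd _).
  by rewrite (derive_linear (L := snd)) //= => y; exact: cvg_snd.
have pd : is_derive (p, w) ((0, 1) : V * R) (fun q : V * R => q.2 ^+ n.+1)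
    (n.+1%:R * w ^+ n).
  have -> : (fun q : V * R => q.2 ^+ n.+1) = (fun q : V * R => q.2) ^+ n.+1.
    by apply/funext => q; rewrite exprfctE.
  by apply: is_derive_eq (is_deriveX n.+1 sd) _; rewrite /= [_%:A]mulr1.
have ad := smooth_germ_is_derive ((0, 1) : V * R) (smooth_param (q := (p, w)) as_).
rewrite derive_param // in ad.
by rewrite (@derive_val _ _ _ _ _ _ _ (is_deriveM ad pd)) scaler0 addr0.
Qed.

(** Factoring out [a 0] makes the radicand 1 at the origin, so even roots exist whatever the sign of
    [a 0]. *)
Lemma smooth_root (V : normedModType R) (n : nat) (a : V -> R) :
  has_coords (V * R : normedModType R)%type -> smooth_germ 0 a -> a 0 != 0 ->
  exists w : V -> R, [/\ smooth_germ 0 w, w 0 = 1 &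
    \forall x \near (0 : V), a x = a 0 * w x ^+ n.+1].
Proof.
move=> Vc as_ a0.
pose b x := a x / a 0.
have bs : smooth_germ 0 b by apply: smooth_germM => //; exact: smooth_germ_cst.
pose G (q : V * R) := 1 * q.2 ^+ n.+1 - b q.1.
have sn q : smooth_germ q (fun q : V * R => 1 * q.2 ^+ n.+1).
  apply: smooth_germM; first exact: smooth_germ_cst.
  by apply: smooth_germX; exact: smooth_snd.
have sb : smooth_germ ((0 : V), 1 : R) (fun q : V * R => b q.1) by exact: smooth_param.
have [|||w [ws w0 wG _]] := @implicit_function R V G 0 1 Vc.
- exact: smooth_germB.
- by rewrite /G /= expr1n mulr1 /b divff // subrr.
- rewrite deriveB_smooth; try exact: smooth_germ_diff.
  rewrite derive_param // (@derive_paramX _ (cst 1)); last exact: smooth_germ_cst.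
  by rewrite /= expr1n !mul1r subr0 mulr1 pnatr_eq0.
exists w; split => //; apply: filterS wG => x; rewrite /G /= mul1r => /subr0_eq ->.
by rewrite /b mulrC divfK.
Qed.

Lemma diffeo_germ_scaleY (k : R) : k != 0 ->
  exists psi', diffeo_germ (fun z : plane R => (z.1, k * z.2)) psi'.
Proof.
move=> k0; apply: diffeo_germ_triY.
- by apply: smooth_germM; [exact: smooth_germ_cst|exact: smooth_snd].
- by rewrite /= mulr0.
- rewrite deriveM_smooth; last 2 first.
  + exact: smooth_germ_diff (smooth_germ_cst _ _).
  + exact: smooth_germ_diff (smooth_snd _).
  by rewrite derive_planeY derive_cst mulr0 addr0 mulr1.
Qed.

Lemma germI_prefold (k : R) : k != 0 -> A_equiv (germI R) (prefold (fun=> k)).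
Proof.
move=> k0; have [psi' dp] := diffeo_germ_scaleY k0.
have [|||phi' dq] := @diffeo_germ_triX R (fun z : plane R => z.1 - z.2).
- by apply: smooth_germB; [exact: smooth_fst|exact: smooth_snd].
- by rewrite /= subrr.
- rewrite deriveB_smooth; last 2 first.
  + exact: smooth_germ_diff (smooth_fst _).
  + exact: smooth_germ_diff (smooth_snd _).
  by rewrite derive_planeX derive_planeX2 subr0 oner_neq0.
apply: (A_equiv_intro dq dp); apply: near_all => z.
by rewrite /prefold /germI /= subrK mulrC.
Qed.

Lemma germII_prefold : A_equiv (germII R) (prefold (fun z => z.1 - z.2)).
Proof.
have [|||phi' dq] := @diffeo_germ_triX R (fun z : plane R => z.1 - z.2).
- by apply: smooth_germB; [exact: smooth_fst|exact: smooth_snd].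
- by rewrite /= subrr.
- rewrite deriveB_smooth; last 2 first.
  + exact: smooth_germ_diff (smooth_fst _).
  + exact: smooth_germ_diff (smooth_snd _).
  by rewrite derive_planeX derive_planeX2 subr0 oner_neq0.
apply: (A_equiv_intro dq (diffeo_germ_id (R := R))); apply: near_all => z.
by rewrite /prefold /germII /= subrK.
Qed.

Lemma derive_mulY0 (k : plane R -> R) : smooth_germ 0 k ->
  'D_eY (fun w : plane R => w.2 * k w) 0 = k 0.
Proof. by move=> ks; rewrite derive_mulY //= mul0r addr0. Qed.

Lemma diffeo_germ_stretchY (k : plane R -> R) : smooth_germ 0 k -> k 0 != 0 ->
  exists phi', diffeo_germ (fun z : plane R => (z.1, z.2 * k z)) phi'.
Proof.
move=> ks k0; apply: diffeo_germ_triY.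
- by apply: smooth_germM => //; exact: smooth_snd.
- by rewrite /= mul0r.
- by rewrite derive_mulY0.
Qed.

Lemma prefold_unit c : smooth_germ 0 c -> c 0 != 0 ->
  A_equiv (germI R) (prefold c).
Proof.
move=> cs c0.
have Pc : has_coords (plane R * R : normedModType R)%type.
  by apply: has_coords_prod; [exact: has_coords_plane|exact: has_coords_R].
have [w [ws w0 wc]] := smooth_root 1 Pc cs c0.
have [|phi' d] := diffeo_germ_stretchY ws; first by rewrite w0 oner_neq0.
apply: A_equiv_trans (germI_prefold c0) _.
apply: (A_equiv_intro d (diffeo_germ_id (R := R))).
apply: filterS wc => z E; rewrite /prefold /= E; congr pair; ring.
Qed.

Lemma diffeo_germ_stretchX (k : R -> R) : smooth_germ 0 k -> k 0 != 0 ->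
  exists phi', diffeo_germ (fun z : plane R => (z.1 * k z.1, z.2)) phi'.
Proof.
move=> ks k0.
have ks1 : smooth_germ 0 (fun z : plane R => k z.1).
  by apply: (@smooth_germ_comp _ _ _ _ _ fst) => //; [exact: has_coords_R|exact: smooth_fst].
apply: diffeo_germ_triX.
- by apply: smooth_germM => //; exact: smooth_fst.
- by rewrite /= mul0r.
- rewrite deriveM_smooth; last 2 first.
  + exact: smooth_germ_diff (smooth_fst _).
  + exact: smooth_germ_diff.
  by rewrite /= mul0r add0r derive_planeX mulr1.
Qed.

(* If [h] has the same critical points and critical values as the cubic
   [H = 3 A tau t^2 - 2 A t^3] on each line [u = const], then [h = H + q^2 K] with
   [q = d_t H], and Taylor's formula turns [h = H(t + q w)] into an equation for
   [w] that the implicit function theorem solves. *)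
Lemma cubic_absorb (A tau : R -> R) (K : plane R -> R) :
  smooth_germ 0 A -> smooth_germ 0 tau -> tau 0 = 0 -> smooth_germ 0 K ->
  exists k : plane R -> R, [/\ smooth_germ 0 k, k 0 = 1 &
    \forall z \near (0 : plane R),
      let T := z.2 * k z in
      let q := - 6 * A z.1 * z.2 * (z.2 - tau z.1) in
      3 * A z.1 * tau z.1 * z.2 ^+ 2 - 2 * A z.1 * z.2 ^+ 3 + q ^+ 2 * K z =
      3 * A z.1 * tau z.1 * T ^+ 2 - 2 * A z.1 * T ^+ 3].
Proof.
move=> As taus tau0 Ks.
have s1 (a : R -> R) : smooth_germ 0 a -> smooth_germ 0 (fun z : plane R => a z.1).
  move=> as_; apply: (@smooth_germ_comp _ _ _ _ _ fst) => //; [exact: has_coords_R|exact: smooth_fst].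
have A1 := s1 _ As; have tau1 := s1 _ taus.
have y1 : smooth_germ 0 (snd : plane R -> R) by exact: smooth_snd.
have cs (k : R) : smooth_germ 0 (fun _ : plane R => k) by exact: smooth_germ_cst.
(* [a2] is half the second [t] derivative of [H], and [a3] is [q] times a sixth of the third. After
   division by [q^2] the equation [H + q^2 K = H(t + q w)] becomes [K = w + a2 w^2 + a3 w^3]; both
   coefficients vanish at the origin, where [w = K 0] is a simple solution. *)
pose a2 (z : plane R) := 3 * A z.1 * (tau z.1 - 2 * z.2).
pose a3 (z : plane R) := 12 * A z.1 ^+ 2 * z.2 * (z.2 - tau z.1).
have a2s : smooth_germ 0 a2.
  apply: smooth_germM; first exact: smooth_germM.
  by apply: smooth_germB => //; exact: smooth_germM.
have a3s : smooth_germ 0 a3.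
  apply: smooth_germM; last exact: smooth_germB.
  apply: smooth_germM => //; apply: smooth_germM => //; exact: smooth_germX.
pose G (q : plane R * R) := 1 * q.2 ^+ 1 + a2 q.1 * q.2 ^+ 2 + a3 q.1 * q.2 ^+ 3 - K q.1.
have ps (a : plane R -> R) w : smooth_germ 0 a ->
    smooth_germ ((0 : plane R), w : R) (fun q : plane R * R => a q.1).
  by move=> as_; exact: smooth_param.
have pX (a : plane R -> R) w n : smooth_germ 0 a ->
    smooth_germ ((0 : plane R), w : R) (fun q : plane R * R => a q.1 * q.2 ^+ n).
  move=> as_; apply: smooth_germM; first exact: ps.
  by apply: smooth_germX; exact: smooth_snd.
have a20 : a2 0 = 0 by rewrite /a2 /= tau0 mulr0 subrr mulr0.
have a30 : a3 0 = 0 by rewrite /a3 /= mulr0 mul0r.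
have [||||w [ws w0 wG _]] := @implicit_function R (plane R) G 0 (K 0).
- by apply: has_coords_prod; [exact: has_coords_plane|exact: has_coords_R].
- apply: smooth_germB; last exact: ps.
  apply: smooth_germD; last exact: pX.
  apply: smooth_germD; last exact: pX.
  exact: (@pX (fun=> 1)).
- by rewrite /G /= a20 a30 !mul0r !addr0 mul1r expr1 subrr.
- rewrite deriveB_smooth; last 2 first.
  + apply: smooth_germ_diff; apply: smooth_germD; last exact: pX.
    by apply: smooth_germD; [exact: (@pX (fun=> 1))|exact: pX].
  + by apply: smooth_germ_diff; exact: ps.
  rewrite derive_param // deriveD_smooth; last 2 first.
  + apply: smooth_germ_diff.
    by apply: smooth_germD; [exact: (@pX (fun=> 1))|exact: pX].
  + by apply: smooth_germ_diff; exact: pX.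
  rewrite deriveD_smooth; last 2 first.
  + by apply: smooth_germ_diff; exact: (@pX (fun=> 1)).
  + by apply: smooth_germ_diff; exact: pX.
  rewrite !derive_paramX // (@derive_paramX _ (fun=> 1)) // a20 a30 !mul0r !addr0.
  by rewrite subr0 mul1r expr0 mulr1 pnatr_eq0.
(* With this factor, [z.2 * k z] is [t + q w]. *)
exists (fun z => 1 - 6 * A z.1 * (z.2 - tau z.1) * w z); split.
- apply: smooth_germB => //; apply: smooth_germM => //.
  by apply: smooth_germM; [exact: smooth_germM|exact: smooth_germB].
- by rewrite /= tau0 subrr mulr0 mul0r subr0.
- apply: filterS wG => z; rewrite /G /= mul1r expr1 => /subr0_eq <-.
  by rewrite /a2 /a3; ring.
Qed.

Lemma derive_fst_only (a : R -> R) (z : plane R) :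
  'D_eY (fun z : plane R => a z.1) z = 0.
Proof.
apply: lim_near_cst => //=; near=> h.
by rewrite scaler0 add0r subrr scaler0.
Unshelve. all: by end_near. Qed.

(** Since [t m] is the [t] derivative of [t^2 c], the zero [tau] of [m] is the second critical point
    of the fibre map. The cubic with the same critical points and values differs from [t^2 c] by a
    function vanishing to second order on [t = 0] and on [t = tau], that is by a multiple of [q^2],
    which [cubic_absorb] removes. It remains to normalize the coefficients of the cubic. *)
Lemma prefold_beaks c : smooth_germ 0 c -> c 0 = 0 -> 'D_eX c 0 != 0 ->
  'D_eY c 0 != 0 -> A_equiv (germII R) (prefold c).
Proof.
have arith1 (a b x : R) : 2 * a + x * (3 * b) = 0 -> 3 * b * x = - 2 * a by lra.
have arith2 (a b x : R) : 3 * b * x = - 2 * a -> 3 * (a + x * b) = a by lra.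
have arith4 (K0z A0 t0 r om z1 z2 : R) : A0 * om ^+ 3 != 0 ->
    3 * (A0 * om ^+ 3) * (z1 * t0) * z2 ^+ 2 - 2 * (A0 * om ^+ 3) * z2 ^+ 3 +
    (- 6 * (A0 * om ^+ 3) * z2 * (z2 - z1 * t0)) ^+ 2 *
      (K0z / (36 * (A0 * om ^+ 3) ^+ 2)) =
    3 * (A0 * om ^+ 3) * (z1 * t0) * (z2 * r) ^+ 2 - 2 * (A0 * om ^+ 3) * (z2 * r) ^+ 3 ->
    z2 ^+ 2 * ((z2 - z1 * t0) ^+ 2 * K0z + 3 * (A0 * om ^+ 3 * t0) * z1 -
      2 * (A0 * om ^+ 3) * z2) =
    2 * A0 * ((z2 * (r * om)) ^+ 2 * (z1 * (3 / 2 * t0 * om) - z2 * (r * om))).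
  move=> An E; have -> : 2 * A0 * ((z2 * (r * om)) ^+ 2 * (z1 * (3 / 2 * t0 * om) - z2 * (r * om)))
    = 3 * (A0 * om ^+ 3) * (z1 * t0) * (z2 * r) ^+ 2 - 2 * (A0 * om ^+ 3) * (z2 * r) ^+ 3.
    by field.
  by rewrite -E; move: An {E}; move: (A0 * om ^+ 3) => B Bn; field.
have arith3 (a b x k : R) : 3 * b * x = - 2 * a -> 3 * k = a -> 2 * k = - b * x by lra.
move=> cs c0 al0 be0.
set al := 'D_eX c 0 in al0; set be := 'D_eY c 0 in be0.
have cYs : smooth_germ 0 ('D_eY c) by exact: smooth_germ_derive.
have xs : smooth_germ 0 (fst : plane R -> R) by exact: smooth_fst.
have ys : smooth_germ 0 (snd : plane R -> R) by exact: smooth_snd.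
have cst_s (k : R) : smooth_germ 0 (fun _ : plane R => k) by exact: smooth_germ_cst.
pose m (z : plane R) := 2 * c z + z.2 * 'D_eY c z.
have tcs : smooth_germ 0 (fun z : plane R => z.2 * 'D_eY c z) by exact: smooth_germM.
have c2s : smooth_germ 0 (fun z : plane R => 2 * c z) by exact: smooth_germM.
have ms : smooth_germ 0 m by exact: smooth_germD.
have c2d v : 'D_v (fun z : plane R => 2 * c z) 0 = 2 * 'D_v c 0.
  rewrite deriveM_smooth; [|exact: smooth_germ_diff..].
  by rewrite derive_cst mulr0 addr0.
have mY : 'D_eY m 0 = 3 * be.
  rewrite deriveD_smooth; [|exact: smooth_germ_diff..].
  rewrite derive_mulY0 // c2d -/be; ring.
have mX : 'D_eX m 0 = 2 * al.
  rewrite deriveD_smooth; [|exact: smooth_germ_diff..].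
  rewrite c2d deriveM_smooth; [|exact: smooth_germ_diff..].
  by rewrite derive_planeX2 mulr0 addr0 /= mul0r addr0.
have [||||tau [taus tau0 taum _]] := @implicit_function R R m 0 0.
- exact: has_coords_plane.
- exact: ms.
- by rewrite /m /= [c _]c0 mul0r mulr0 addr0.
- by have := mY; rewrite -[0 in X in X -> _]/((0 : R), (0 : R)) => ->; rewrite mulf_neq0 // pnatr_eq0.
have [t0 [t0s t00 tauE]] := hadamard1 taus tau0.
have id_s : smooth_germ 0 (id : R -> R) by exact: smooth_germ_id.
have t0v : 3 * be * t0 0 = - 2 * al.
  have : 'D_1 (fun u : R => m (u, tau u)) 0 = 0.
    by rewrite (near_eq_derive (g := cst 0)) ?derive_cst.
  rewrite (derive_comp2 (a := id) (b := tau)); last first.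
  - by rewrite tau0; exact: smooth_germ_diff.
  - exact: smooth_germ_diff.
  - exact: smooth_germ_diff.
  rewrite derive_id tau0 -t00 scale1r -[(0, 0)]/(0 : plane R) mX mY.
  have E (x y : R) : x *: y = x * y by [].
  by rewrite E; exact: arith1.
have t0n : t0 0 != 0.
  apply/eqP => E; move: t0v; rewrite E mulr0 => /esym/eqP.
  by rewrite mulNr oppr_eq0 mulf_eq0 pnatr_eq0 (negbTE al0).
have cts : smooth_germ 0 (fun u : R => c (u, tau u)).
  by apply: smooth_germ_comp2 => //; rewrite tau0.
have [|ka [kas ka0 kaE]] := hadamard1 cts; first by rewrite tau0.
have kav : 3 * ka 0 = al.
  rewrite ka0 (derive_comp2 (a := id) (b := tau)); last first.
  - by rewrite tau0; exact: smooth_germ_diff.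
  - exact: smooth_germ_diff.
  - exact: smooth_germ_diff.
  rewrite derive_id tau0 -t00 scale1r -[(0, 0)]/(0 : plane R) -/al -/be.
  have E (x y : R) : x *: y = x * y by [].
  by rewrite E; exact: arith2.
have kan : ka 0 != 0 by apply: contra al0 => /eqP E; rewrite -kav E mulr0.
(* The critical value of the cubic at [tau] is [A tau^3], that of [t^2 c] is [tau^2 u ka]; with
   [tau = u t0] this forces [A = ka / t0], smooth also at [u = 0]. *)
pose A u := ka u / t0 u.
have As : smooth_germ 0 A by apply: smooth_germM => //; exact: smooth_germV.
have An : A 0 != 0 by rewrite mulf_neq0 // invr_eq0.
have Av : 2 * A 0 = - be.
  rewrite /A; apply: (mulIf t0n); rewrite -mulrA divfK //.
  exact: arith3 t0v kav.
have s1 (a : R -> R) : smooth_germ 0 a -> smooth_germ 0 (fun z : plane R => a z.1).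
  by move=> as_; apply: (@smooth_germ_comp _ _ _ _ _ fst) => //; exact: has_coords_R.
have A1 := s1 _ As; have tau1 := s1 _ taus; have ka1 := s1 _ kas.
(* [t^2 k] is the difference between [t^2 c] and the cubic, as [ka u = A tau]; [kh] is [k] with the
   line [t = tau] moved to the axis. *)
pose k z := c z - 3 * ka z.1 * z.1 + 2 * A z.1 * z.2.
pose kh (z : plane R) := k (z.1, z.2 + tau z.1).
have ks : smooth_germ 0 k.
  apply: smooth_germD; first apply: smooth_germB => //.
    by apply: smooth_germM => //; exact: smooth_germM.
  by apply: smooth_germM => //; exact: smooth_germM.
have khs : smooth_germ 0 kh.
  apply: smooth_germ_comp2 => //; first exact: smooth_germD.
  by rewrite /= tau0 addr0.
have t0near : \forall u \near (0 : R), t0 u != 0.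
  exact: cvgr_neq0 (smooth_germ_cont t0s) t0n.
have kh0 : \forall u \near (0 : R), kh (u, 0) = 0.
  apply: filterS3 kaE tauE t0near => u e1 e2 e3.
  by rewrite /kh /k /= add0r e1 /A e2; field.
have gs : smooth_germ 0 (fun u : R => (u, tau u) : plane R) by exact: smooth_germ_pair.
have kh1 : \forall u \near (0 : R), 'D_eY kh (u, 0) = 0.
  have n1 : \forall u \near (0 : R), smooth_germ (u, tau u) c.
    apply: (near_comp0 (P := fun z => smooth_germ z c) gs); first by rewrite tau0.
    exact: smooth_germ_near.
  have n2 := near_axis (smooth_germ_near ka1).
  have n3 := near_axis (smooth_germ_near A1).
  have n4 := near_axis (smooth_germ_near tau1).
  have cY : \forall u \near (0 : R), 'D_eY c (u, tau u) + 2 * A u = 0.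
    apply: filterS3 (filterI taum kaE) tauE t0near => u [+ e2] e3 e4.
    rewrite /m e2 /= e3.
    (* At [u = 0] the equation [m = 0] cannot be divided by [tau]; there [Av], obtained from the
       derivatives of [c] at the origin, gives the claim. *)
    have [->|u0] := eqVneq u 0.
      by rewrite !mul0r => _; rewrite -[(0, 0)]/(0 : plane R) -/be Av subrr.
    move: ('D_eY c _) => d E; apply: (mulfI u0); apply: (mulfI e4).
    by rewrite mulr0 mulr0 /A mulrDr mulrDr -[RHS]E; field.
  near=> u.
  have c_s : smooth_germ (u, tau u) c by near: u.
  have kas_ : smooth_germ ((u, 0) : plane R) (fun z => ka z.1) by near: u.
  have As_ : smooth_germ ((u, 0) : plane R) (fun z => A z.1) by near: u.
  have taus_ : smooth_germ ((u, 0) : plane R) (fun z => tau z.1) by near: u.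
  have ys_ (z : plane R) : smooth_germ z snd by exact: smooth_snd.
  have xs_ (z : plane R) : smooth_germ z fst by exact: smooth_fst.
  have dfst := derive_fst_only.
  have shs : smooth_germ ((u, 0) : plane R) (fun z => z.2 + tau z.1) by exact: smooth_germD.
  have E1 : smooth_germ ((u, 0) : plane R) (fun z : plane R => c (z.1, z.2 + tau z.1)).
    by apply: smooth_germ_comp2 => //=; rewrite add0r.
  have E2 : smooth_germ ((u, 0) : plane R) (fun z : plane R => (3 * ka z.1 * z.1 : R)).
    by apply: smooth_germM => //; apply: smooth_germM => //; exact: smooth_germ_cst.
  have E3 : smooth_germ ((u, 0) : plane R) (fun z : plane R => (2 * A z.1 : R)).
    by apply: smooth_germM => //; exact: smooth_germ_cst.
  rewrite /kh /k /= deriveD_smooth; last 2 first.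
  - by apply: smooth_germ_diff; exact: smooth_germB.
  - by apply: smooth_germ_diff; exact: smooth_germM.
  rewrite deriveB_smooth; [|exact: smooth_germ_diff..].
  rewrite (dfst (fun x => 3 * ka x * x)) subr0.
  rewrite deriveM_smooth; [|exact: smooth_germ_diff..].
  rewrite (dfst (fun x => 2 * A x)) mulr0 addr0 /=.
  rewrite deriveD_smooth; [|exact: smooth_germ_diff..].
  rewrite (dfst tau) addr0 derive_planeY mulr1.
  rewrite (derive_comp2 (a := fst) (b := fun z => z.2 + tau z.1)); last first.
  - by rewrite /= add0r; exact: smooth_germ_diff.
  - exact: smooth_germ_diff.
  - exact: smooth_germ_diff.
  rewrite deriveD_smooth; [|exact: smooth_germ_diff..].
  rewrite derive_planeY1 derive_planeY (dfst tau) addr0 scale0r add0r scale1r /= add0r.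
  by near: u.
have [K0 K0s khK] := hadamard2 khs kh0 kh1.
pose sh (z : plane R) : plane R := (z.1, z.2 - tau z.1).
have shs : smooth_germ 0 sh by apply: smooth_germ_pair => //; exact: smooth_germB.
have sh0 : sh 0 = 0 by rewrite /sh /= tau0 subr0.
have kK : \forall z \near (0 : plane R), k z = (z.2 - tau z.1) ^+ 2 * K0 (sh z).
  have := near_comp0 shs sh0 khK; apply: filterS => z <-.
  by rewrite /kh /sh /= subrK -surjective_pairing.
(* The denominator compensates for [q^2 = 36 A^2 t^2 (t - tau)^2]. *)
pose K z := K0 (sh z) / (36 * A z.1 ^+ 2).
have A2n : 36 * A 0 ^+ 2 != 0 by rewrite mulf_neq0 ?pnatr_eq0 // expf_neq0.
have Ks : smooth_germ 0 K.
  apply: smooth_germM.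
    by apply: smooth_germ_comp => //; [exact: has_coords_plane|rewrite sh0].
  apply: smooth_germV => //; apply: smooth_germM => //.
  exact: (smooth_germX 2 A1).
have [r [rs r0 rE]] := cubic_absorb As taus tau0 Ks.
have [om [oms om0 omE]] := smooth_root 2 (has_coords_plane (R := R)) As An.
have om1 := s1 _ oms.
(* With [A = A 0 om^3] and [T = t r om], the cubic reads [2 (A 0) T^2 (u U - T)]: the form
   [T^2 (u - T)] up to the change [u U] of the first coordinate and a constant factor in the
   target. *)
pose U u := 3 / 2 * t0 u * om u.
have Us : smooth_germ 0 U.
  by apply: smooth_germM => //; apply: smooth_germM => //; exact: smooth_germ_cst.
have Un : U 0 != 0.
  by rewrite /U om0 mulr1 mulf_neq0 // mulf_neq0 ?invr_eq0 ?pnatr_eq0.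
have [chi' dchi] := diffeo_germ_stretchX Us Un.
have ros : smooth_germ 0 (fun z => r z * om z.1) by exact: smooth_germM.
have [|rho' drho] := diffeo_germ_stretchY ros; first by rewrite r0 om0 mulr1 oner_neq0.
have [|psi' dpsi] := @diffeo_germ_scaleY (2 * A 0).
  by rewrite mulf_neq0 // pnatr_eq0.
have An1 : \forall z \near (0 : plane R), A z.1 != 0.
  exact: cvgr_neq0 (smooth_germ_cont A1) An.
apply: A_equiv_trans germII_prefold _.
(* Replacing [u] with [u U] in the source also alters the first component of the germ; the same
   change in the target undoes this. *)
apply: (@A_equiv_trans _ _ (fun z => ((prefold c z).1 * U (prefold c z).1, (prefold c z).2))).
  apply: (A_equiv_intro (diffeo_germ_comp drho dchi) dpsi).
  have nt := near_fst tauE; have no := near_fst omE.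
  have nk := near_fst kaE; have n0 := near_fst t0near.
  near=> z.
  have e1 : tau z.1 = z.1 * t0 z.1 by near: z.
  have e2 : A z.1 = A 0 * om z.1 ^+ 3 by near: z.
  have e3 : k z = (z.2 - tau z.1) ^+ 2 * K0 (sh z) by near: z.
  have e4 : t0 z.1 != 0 by near: z.
  have e5 : A z.1 != 0 by near: z.
  have e6 : let T := z.2 * r z in let q := - 6 * A z.1 * z.2 * (z.2 - tau z.1) in
      3 * A z.1 * tau z.1 * z.2 ^+ 2 - 2 * A z.1 * z.2 ^+ 3 + q ^+ 2 * K z =
      3 * A z.1 * tau z.1 * T ^+ 2 - 2 * A z.1 * T ^+ 3 by near: z.
  rewrite /prefold /=; congr pair.
  have e7 : ka z.1 = A z.1 * t0 z.1 by rewrite /A divfK.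
  have e8 : c z = k z + 3 * ka z.1 * z.1 - 2 * A z.1 * z.2 by rewrite /k; ring.
  rewrite e8; move: e6; rewrite /= /K e7 e3 e1 /U; move: e5; rewrite e2.
  exact: arith4.
apply: A_equiv_sym; [exact: prefold0|exact/smooth_germ_cont/prefold_smooth|].
exact: A_equiv_target dchi.
Unshelve. all: by end_near. Qed.

End NormalForms.

(** * Invariants of the singularities *)

Section Invariants.
Context {R : realType}.
Implicit Types f g phi psi : plane R -> plane R.

Local Notation eX := ((1, 0) : plane R).
Local Notation eY := ((0, 1) : plane R).

Definition hessdet (j : plane R -> R) (q : plane R) : R :=
  'D_eX ('D_eX j) q * 'D_eY ('D_eY j) q - 'D_eX ('D_eY j) q * 'D_eY ('D_eX j) q.

Definition critical f (q : plane R) : Prop :=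
  jac f q = 0 /\ forall v, 'D_v (jac f) q = 0.

(** The second condition on [v] makes it nonzero. The sign of the Hessian determinant is left free:
    where [J] vanishes along a smooth curve the tangent of the curve is isotropic, so the form is
    indefinite and the lips singularity is excluded. *)
Definition beaks f (q : plane R) : Prop :=
  [/\ critical f q, hessdet (jac f) q != 0 &
    exists2 v, 'D_v f q = 0 & 'D_v ('D_v (jac f)) q != 0].

Lemma derive_translate (V W : normedModType R) (f : V -> W) (q x v : V) (c : W) :
  'D_v (fun z => f (q + z) - c) x = 'D_v f (q + x).
Proof.
rewrite /derive; congr (lim (_ @ 0^')); apply/funext => h /=.
by rewrite opprB addrA subrK addrCA.
Qed.

#[local] Opaque derive.

Lemma jac_germ_at f q : jac (germ_at f q) = fun z => jac f (q + z).
Proof. by apply/funext => z; rewrite /jac !derive_translate. Qed.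

Lemma derive_shift (W : normedModType R) (f : plane R -> W) (q x v : plane R) :
  'D_v (fun z => f (q + z)) x = 'D_v f (q + x).
Proof.
rewrite -(derive_translate f q x v 0).
by congr ('D_v _ x); apply/funext => w; rewrite subr0.
Qed.

Lemma derive_shift0 (W : normedModType R) (f : plane R -> W) (q v : plane R) :
  'D_v (fun z => f (q + z)) 0 = 'D_v f q.
Proof. exact: etrans (derive_shift f q 0 v) (congr1 (fun x => 'D_v f x) (addr0 q)). Qed.

Lemma derive2_shift0 (W : normedModType R) (f : plane R -> W) (q v w : plane R) :
  'D_v ('D_w (fun z => f (q + z))) 0 = 'D_v ('D_w f) q.
Proof.
have F : 'D_w (fun z => f (q + z)) = fun z => 'D_w f (q + z).
  by apply/funext => z; exact: derive_shift.
rewrite F; exact: derive_shift0.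
Qed.

Lemma critical_germ_at f q : critical (germ_at f q) 0 <-> critical f q.
Proof.
rewrite /critical jac_germ_at addr0.
have E v := derive_shift0 (jac f) q v.
split=> -[j0 H]; split; try exact: j0; move=> v.
  exact: etrans (esym (E v)) (H v).
exact: etrans (E v) (H v).
Qed.

Let det4 (a a' b b' c c' d d' : R) : a = a' -> b = b' -> c = c' -> d = d' ->
  a * b - c * d = a' * b' - c' * d'.
Proof. by move=> -> -> -> ->. Qed.

Lemma beaks_germ_at f q : beaks (germ_at f q) 0 <-> beaks f q.
Proof.
have E v w : 'D_v ('D_w (jac (germ_at f q))) 0 = 'D_v ('D_w (jac f)) q.
  rewrite jac_germ_at; exact: derive2_shift0.
have E1 v : 'D_v (germ_at f q) 0 = 'D_v f q.
  rewrite derive_translate addr0; exact: erefl.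
have E2 : hessdet (jac (germ_at f q)) 0 = hessdet (jac f) q.
  exact (det4 (E eX eX) (E eY eY) (E eX eY) (E eY eX)).
split=> -[C D [v vf vh]]; split.
- exact ((critical_germ_at f q).1 C).
- by rewrite -E2.
- exists v; first exact (etrans (esym (E1 v)) vf).
  rewrite -(E v v); exact vh.
- exact ((critical_germ_at f q).2 C).
- by rewrite E2.
- exists v; first exact (etrans (E1 v) vf).
  rewrite (E v v); exact vh.
Qed.

Lemma deriveM_zero (a b : plane R -> R) v : smooth_germ 0 a -> smooth_germ 0 b ->
  a 0 = 0 -> 'D_v (fun z => a z * b z) 0 = b 0 * 'D_v a 0.
Proof.
move=> as_ bs a0; rewrite deriveM_smooth; [|exact: smooth_germ_diff..].
by rewrite a0 mul0r add0r.
Qed.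

Lemma derive_lincomb (f g : plane R -> R) (x y : R) (q u : plane R) :
  smooth_germ q f -> smooth_germ q g ->
  'D_u (fun z => x * f z + y * g z) q = x * 'D_u f q + y * 'D_u g q.
Proof.
move=> fs gs.
have cs (k : R) : smooth_germ q (fun _ : plane R => k) by exact: smooth_germ_cst.
rewrite deriveD_smooth; last 2 first.
- by apply: smooth_germ_diff; exact: smooth_germM.
- by apply: smooth_germ_diff; exact: smooth_germM.
rewrite deriveM_smooth; [|exact: smooth_germ_diff..].
rewrite deriveM_smooth; [|exact: smooth_germ_diff..].
by rewrite !derive_cst !mulr0 !addr0.
Qed.

Lemma deriveM_zero2 (a b k l : plane R -> R) v : smooth_germ 0 a ->
  smooth_germ 0 b -> smooth_germ 0 k -> smooth_germ 0 l -> a 0 = 0 -> b 0 = 0 ->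
  'D_v (fun z => a z * k z + b z * l z) 0 = k 0 * 'D_v a 0 + l 0 * 'D_v b 0.
Proof.
move=> as_ bs ks ls a0 b0; rewrite deriveD_smooth; last 2 first.
- by apply: smooth_germ_diff; exact: smooth_germM.
- by apply: smooth_germ_diff; exact: smooth_germM.
by rewrite (deriveM_zero _ as_ ks a0) (deriveM_zero _ bs ls b0).
Qed.

Lemma derive2_comb (j : plane R -> R) (q u v a b : plane R) (x y : R) :
  smooth_germ q j -> (\forall z \near q, 'D_v j z = x * 'D_a j z + y * 'D_b j z) ->
  'D_u ('D_v j) q = x * 'D_u ('D_a j) q + y * 'D_u ('D_b j) q.
Proof.
move=> js n; rewrite (near_eq_derive _ n).
exact (derive_lincomb x y u (smooth_germ_derive a js) (smooth_germ_derive b js)).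
Qed.

Lemma derive2_plane (j : plane R -> R) (q u v : plane R) : smooth_germ q j ->
  'D_u ('D_v j) q = v.1 * 'D_u ('D_eX j) q + v.2 * 'D_u ('D_eY j) q.
Proof.
move=> js; apply: derive2_comb => //.
apply: filterS (smooth_germ_near js) => z jz.
exact: derive_plane (smooth_germ_diff jz).
Qed.

(** Since [j] and its differential vanish at the origin, the derivatives of the factor [U] and the
    second derivatives of [phi] drop out: the Hessian is transported as a bilinear form. *)
Lemma critical_comp (j U : plane R -> R) phi : smooth_germ 0 j ->
  smooth_germ 0 U -> smooth_germ 0 phi -> phi 0 = 0 -> j 0 = 0 ->
  (forall v, 'D_v j 0 = 0) ->
  (forall v, 'D_v (fun z => j (phi z) * U z) 0 = 0) /\
  forall w v, 'D_w ('D_v (fun z => j (phi z) * U z)) 0 =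
    U 0 * 'D_('D_w phi 0) ('D_('D_v phi 0) j) 0.
Proof.
move=> js Us ps p0 j0 dj.
have jps : smooth_germ 0 (fun z => j (phi z)).
  by apply: smooth_germ_comp => //; [exact: has_coords_plane|rewrite p0].
have jp0 : j (phi 0) = 0 by rewrite p0.
have Djp (k : plane R -> R) v : smooth_germ 0 k ->
    'D_v (fun z => k (phi z)) 0 = 'D_('D_v phi 0) k 0.
  move=> ks; have kd : differentiable k (phi 0) by rewrite p0; exact: smooth_germ_diff.
  by rewrite (derive_comp v (smooth_germ_diff ps) kd) p0.
have djp v : 'D_v (fun z => j (phi z)) 0 = 0 by rewrite Djp.
split=> [v|w v].
  by rewrite (deriveM_zero _ jps Us jp0) djp mulr0.
have sUv : smooth_germ 0 ('D_v U) by exact: smooth_germ_derive.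
pose J z := 'D_v (fun z => j (phi z)) z.
have Js : smooth_germ 0 J by exact: (smooth_germ_derive v jps).
have n : \forall z \near (0 : plane R), 'D_v (fun z => j (phi z) * U z) z =
    j (phi z) * 'D_v U z + J z * U z.
  apply: filterS2 (smooth_germ_near jps) (smooth_germ_near Us) => z jpz Uz.
  by rewrite deriveM_smooth; [rewrite [U z * _]mulrC|exact: smooth_germ_diff..].
rewrite (near_eq_derive _ n) (deriveM_zero2 w jps Js sUv Us jp0 (djp v)) djp mulr0 add0r.
suff E : 'D_w J 0 = 'D_('D_w phi 0) ('D_('D_v phi 0) j) 0 by rewrite E.
pose a z := ('D_v phi z).1; pose b z := ('D_v phi z).2.
pose X z := 'D_eX j (phi z); pose Y z := 'D_eY j (phi z).
have n2 : \forall z \near (0 : plane R), J z = X z * a z + Y z * b z.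
  apply: filterS2 (smooth_germ_near ps) (near_comp0 ps p0 (smooth_germ_near js)) => z pz jz.
  have := derive_comp v (smooth_germ_diff pz) (smooth_germ_diff jz).
  rewrite (derive_plane ('D_v phi z) (smooth_germ_diff jz)) /J => ->.
  by congr (_ + _); exact: mulrC.
have pvs : smooth_germ 0 ('D_v phi) by exact: smooth_germ_derive.
have as_ : smooth_germ 0 a by exact: smooth_germ_fst.
have bs : smooth_germ 0 b by exact: smooth_germ_snd.
have js_ e : smooth_germ 0 (fun z => 'D_e j (phi z)).
  apply: (smooth_germ_comp (f := 'D_e j)) => //; first exact: has_coords_plane.
  by rewrite p0; exact: smooth_germ_derive.
have j0_ e : 'D_e j (phi 0) = 0 by rewrite p0.
rewrite (near_eq_derive _ n2) (derive2_plane _ _ js).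
rewrite (deriveM_zero2 w (js_ eX) (js_ eY) as_ bs (j0_ eX) (j0_ eY)).
have DX := Djp _ w (smooth_germ_derive eX js).
have DY := Djp _ w (smooth_germ_derive eY js).
exact (congr2 (fun s t => a 0 * s + b 0 * t) DX DY).
Qed.

Lemma jac_id (z : plane R) : jac id z = 1.
Proof. by rewrite /jac !derive_id /= mulr1 mulr0 subr0. Qed.

Lemma diffeo_jac_neq0 phi phi' : diffeo_germ phi phi' -> jac phi 0 != 0.
Proof.
move=> [s s' z0 z0' [i _]].
have := @jac_near R (fun z => phi' (phi z)) id 0 i.
rewrite jac_id jac_comp; last 2 first.
- exact: smooth_germ_diff.
- by apply: smooth_germ_diff; rewrite z0.
by move=> E; apply/eqP => E0; move/eqP: E; rewrite E0 mulr0 eq_sym oner_eq0.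
Qed.

(** The unit [U] is the product of the Jacobian determinants of the two coordinate changes. *)
Lemma A_equiv_jac f g : smooth_germ 0 f -> f 0 = 0 -> A_equiv f g ->
  exists U phi phi' psi, [/\ smooth_germ 0 U /\ U 0 != 0, diffeo_germ phi phi',
    smooth_germ 0 psi /\ psi 0 = 0,
    \forall z \near (0 : plane R), g z = psi (f (phi z)) &
    \forall z \near (0 : plane R), jac g z = jac f (phi z) * U z].
Proof.
move=> fs f0 [p [p' [q [q' [dp dq E]]]]].
have [_ ps _ p0 _] := dp; have [qs _ q0 _ _] := dq.
have fps : smooth_germ 0 (fun z => f (p' z)).
  by apply: smooth_germ_comp => //; [exact: has_coords_plane|rewrite p0].
have fp0 : f (p' 0) = 0 by rewrite p0.
exists (fun z => jac q (f (p' z)) * jac p' z), p', p, q.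
have sq : smooth_germ 0 (fun z => jac q (f (p' z))).
  apply: smooth_germ_comp => //; first exact: has_coords_plane.
  by rewrite fp0; exact: jac_smooth.
have U0 : jac q (f (p' 0)) * jac p' 0 != 0.
  rewrite fp0; apply: mulf_neq0; first exact (diffeo_jac_neq0 dq).
  exact (diffeo_jac_neq0 (diffeo_germ_sym dp)).
split.
- by split; [exact (smooth_germM sq (jac_smooth ps))|exact U0].
- exact (diffeo_germ_sym dp).
- by split.
- exact E.
have n4 := near_near E.
have n1 := smooth_germ_near ps.
have n2 := near_comp0 ps p0 (smooth_germ_near fs).
have n3 := near_comp0 fps fp0 (smooth_germ_near qs).
near=> z.
have s1 : differentiable p' z by apply: smooth_germ_diff; near: z.
have s2 : differentiable f (p' z) by apply: smooth_germ_diff; near: z.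
have s3 : differentiable q (f (p' z)) by apply: smooth_germ_diff; near: z.
rewrite (@jac_near _ g (fun z => q (f (p' z)))); last first.
  by near: z; exact: n4.
have s4 : differentiable (fun z => f (p' z)) z by exact: (differentiable_comp s1 s2).
rewrite (jac_comp s4 s3) (jac_comp s1 s2); exact: mulrCA.
Unshelve. all: by end_near. Qed.

Lemma A_equiv_critical f g : smooth_germ 0 f -> f 0 = 0 -> A_equiv f g ->
  critical f 0 -> critical g 0.
Proof.
move=> fs f0 fg [j0 dj].
have [U [p [p' [q [[Us U0] dp [qs q0] _ E]]]]] := A_equiv_jac fs f0 fg.
have [ps _ p0 _ _] := dp.
have [d _] := critical_comp (jac_smooth fs) Us ps p0 j0 dj.
split; first by rewrite (nbhs_singleton E) p0 j0 mul0r.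
by move=> v; rewrite (near_eq_derive _ E).
Qed.

Lemma derive2_expand (j : plane R -> R) (q a b : plane R) : smooth_germ q j ->
  'D_a ('D_b j) q =
  b.1 * (a.1 * 'D_eX ('D_eX j) q + a.2 * 'D_eY ('D_eX j) q) +
  b.2 * (a.1 * 'D_eX ('D_eY j) q + a.2 * 'D_eY ('D_eY j) q).
Proof.
move=> js; apply: etrans (derive2_plane a b js) _.
have dX := derive_plane a (smooth_germ_diff (smooth_germ_derive eX js)).
have dY := derive_plane a (smooth_germ_diff (smooth_germ_derive eY js)).
exact (congr2 (fun s t : R => b.1 * s + b.2 * t) dX dY).
Qed.

Lemma hessdet_transform (h : plane R -> plane R -> R) (a b : plane R)
    (u XX XY YX YY : R) :
  (forall p q : plane R, h p q =
    q.1 * (p.1 * XX + p.2 * YX) + q.2 * (p.1 * XY + p.2 * YY)) ->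
  u * h a a * (u * h b b) - u * h a b * (u * h b a) =
  u ^+ 2 * (a.1 * b.2 - b.1 * a.2) ^+ 2 * (XX * YY - XY * YX).
Proof. by case: a b => [a1 a2] [b1 b2] H; rewrite !H /=; ring. Qed.

Lemma A_equiv_beaks f g : smooth_germ 0 f -> f 0 = 0 -> A_equiv f g ->
  beaks f 0 -> beaks g 0.
Proof.
move=> fs f0 fg [fc fD [v vf vh]].
have [U [p [p' [q [[Us U0] dp [qs q0] Eg E]]]]] := A_equiv_jac fs f0 fg.
have [ps ps' p0 p0' [_ pK]] := dp; have [j0 dj] := fc.
have js := jac_smooth fs.
have [d h] := critical_comp js Us ps p0 j0 dj.
have Eh w w' : 'D_w ('D_w' (jac g)) 0 = U 0 * 'D_('D_w p 0) ('D_('D_w' p 0) (jac f)) 0.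
  rewrite -h; apply: near_eq_derive.
  apply: filterS (near_near E) => z Ez; exact (near_eq_derive _ Ez).
have pd : differentiable p 0 := smooth_germ_diff ps.
have pd' : differentiable p' 0 := smooth_germ_diff ps'.
have pdp : differentiable p (p' 0) by rewrite p0'.
have pv : 'D_('D_v p' 0) p 0 = v.
  have := near_eq_derive v pK; rewrite derive_id => Ev.
  have DC := derive_comp v pd' pdp.
  rewrite p0' in DC.
  exact (etrans (esym DC) Ev).
split.
- exact (A_equiv_critical fs f0 fg fc).
- have Ed a b := derive2_expand a b js.
  have H : hessdet (jac g) 0 = U 0 ^+ 2 * jac p 0 ^+ 2 * hessdet (jac f) 0.
    exact (etrans (det4 (Eh eX eX) (Eh eY eY) (Eh eX eY) (Eh eY eX))
      (hessdet_transform _ _ _ Ed)).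
  rewrite H; apply: mulf_neq0; last exact fD.
  by apply: mulf_neq0; apply: expf_neq0; [exact U0|exact (diffeo_jac_neq0 dp)].
(* The kernel vector is carried back by the differential of the inverse source change. *)
- exists ('D_v p' 0).
  + rewrite (near_eq_derive _ Eg).
    have fpd : differentiable f (p 0) by rewrite p0; exact (smooth_germ_diff fs).
    have fp : differentiable (fun z => f (p z)) 0 by exact: (differentiable_comp pd fpd).
    have qd : differentiable q (f (p 0)) by rewrite p0 f0; exact (smooth_germ_diff qs).
    by rewrite (derive_comp _ fp qd) (derive_comp _ pd fpd) pv p0 vf derive0.
  + rewrite Eh pv; apply: mulf_neq0; [exact U0|exact vh].
Qed.

(** * The invariants of [(u, t^2 c)] *)

Section Prefold.
Variable c : plane R -> R.

(** [t m] is the derivative of [t^2 c] in [t]: off the support the zeros of [m] are the remaining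
    critical points of the fibre maps. *)
Definition prefold_m (z : plane R) : R := 2 * c z + z.2 * 'D_eY c z.

Lemma jac_prefold z : smooth_germ z c -> jac (prefold c) z = z.2 * prefold_m z.
Proof.
move=> cs.
have s2 : smooth_germ z (fun w : plane R => w.2 * c w).
  by apply: smooth_germM => //; exact: smooth_snd.
have E : prefold c = fun w => (w.1, w.2 * (w.2 * c w)).
  by apply/funext => w; rewrite /prefold expr2 mulrA.
rewrite E jac_pairl; last first.
  by apply: smooth_germ_diff; apply: smooth_germM => //; exact: smooth_snd.
by rewrite (derive_mulY s2) (derive_mulY cs) /prefold_m; ring.
Qed.

Lemma prefold_m_smooth z : smooth_germ z c -> smooth_germ z prefold_m.
Proof.
move=> cs; apply: smooth_germD; apply: smooth_germM => //.
- exact: smooth_germ_cst.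
- exact: smooth_snd.
- exact: smooth_germ_derive.
Qed.

Lemma derive_mulX (k : plane R -> R) (z : plane R) : smooth_germ z k ->
  'D_eX (fun w : plane R => w.2 * k w) z = z.2 * 'D_eX k z.
Proof.
move=> ks; rewrite deriveM_smooth; last 2 first.
- exact: smooth_germ_diff (smooth_snd _).
- exact: smooth_germ_diff.
by rewrite derive_planeX2 mulr0 addr0.
Qed.

Variable z : plane R.
Hypothesis cs : smooth_germ z c.

Let ms : smooth_germ z prefold_m. Proof. exact: prefold_m_smooth. Qed.

Let jX w : smooth_germ w c -> 'D_eX (jac (prefold c)) w = w.2 * 'D_eX prefold_m w.
Proof.
move=> cw; have n : \forall w' \near w, jac (prefold c) w' = w'.2 * prefold_m w'.
  by apply: filterS (smooth_germ_near cw) => w'; exact: jac_prefold.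
by rewrite (near_eq_derive _ n) derive_mulX //; exact: prefold_m_smooth.
Qed.

Let jY w : smooth_germ w c ->
  'D_eY (jac (prefold c)) w = prefold_m w + w.2 * 'D_eY prefold_m w.
Proof.
move=> cw; have n : \forall w' \near w, jac (prefold c) w' = w'.2 * prefold_m w'.
  by apply: filterS (smooth_germ_near cw) => w'; exact: jac_prefold.
by rewrite (near_eq_derive _ n) derive_mulY //; exact: prefold_m_smooth.
Qed.

Lemma critical_prefold : critical (prefold c) z <->
  [/\ prefold_m z = 0, z.2 * 'D_eX prefold_m z = 0 & z.2 * 'D_eY prefold_m z = 0].
Proof.
have JX := jX cs; have JY := jY cs; have J := jac_prefold cs.
have jd := smooth_germ_diff (jac_smooth (prefold_smooth cs)).
split=> [[m0 d]|[m0 mX mY]].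
  have dX := etrans (esym JX) (d eX).
  have dY := etrans (esym JY) (d eY).
  have tm := etrans (esym J) m0.
  have mz : prefold_m z = 0.
    have [t0|t0] := eqVneq z.2 0.
      by move: dY; rewrite t0 mul0r addr0.
    by move: tm => /eqP; rewrite mulf_eq0 (negbTE t0) /= => /eqP.
  by split; [exact mz|exact dX|rewrite mz add0r in dY; exact dY].
split; first by rewrite J m0 mulr0.
move=> v; rewrite (derive_plane v jd).
have EX := etrans JX mX.
have EY : 'D_eY (jac (prefold c)) z = 0 by rewrite JY m0 mY addr0.
apply: etrans (congr2 (fun s t : R => v.1 *: s + v.2 *: t) EX EY) _.
by rewrite !scaler0 addr0.
Qed.

Let jXX : z.2 = 0 -> 'D_eX ('D_eX (jac (prefold c))) z = 0.
Proof.
move=> t0.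
have n : \forall w \near z, 'D_eX (jac (prefold c)) w = w.2 * 'D_eX prefold_m w.
  by apply: filterS (smooth_germ_near cs) => w; exact: jX.
rewrite (near_eq_derive _ n) derive_mulX ?t0 ?mul0r //; exact: smooth_germ_derive.
Qed.

Let jYX : z.2 = 0 -> 'D_eY ('D_eX (jac (prefold c))) z = 'D_eX prefold_m z.
Proof.
move=> t0.
have n : \forall w \near z, 'D_eX (jac (prefold c)) w = w.2 * 'D_eX prefold_m w.
  by apply: filterS (smooth_germ_near cs) => w; exact: jX.
by rewrite (near_eq_derive _ n) derive_mulY ?t0 ?mul0r ?addr0 //; exact: smooth_germ_derive.
Qed.

Let jYY : z.2 = 0 -> 'D_eY ('D_eY (jac (prefold c))) z = 2 * 'D_eY prefold_m z.
Proof.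
move=> t0.
have n : \forall w \near z, 'D_eY (jac (prefold c)) w =
    prefold_m w + w.2 * 'D_eY prefold_m w.
  by apply: filterS (smooth_germ_near cs) => w; exact: jY.
have dms : smooth_germ z ('D_eY prefold_m) by exact: smooth_germ_derive.
rewrite (near_eq_derive _ n) deriveD_smooth; last 2 first.
- exact: smooth_germ_diff.
- by apply: smooth_germ_diff; apply: smooth_germM => //; exact: smooth_snd.
by rewrite derive_mulY // t0 mul0r addr0 mulr_natl mulr2n.
Qed.

(* On [t = 0] the kernel of [d(prefold c)] is the line of [eY]. *)
Lemma beaks_prefold : z.2 = 0 -> beaks (prefold c) z <->
  [/\ prefold_m z = 0, 'D_eX prefold_m z != 0 & 'D_eY prefold_m z != 0].
Proof.
move=> t0.
have js : smooth_germ z (jac (prefold c)) by exact (jac_smooth (prefold_smooth cs)).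
have XX := jXX t0; have YY := jYY t0; have YX := jYX t0.
have XY := etrans (schwarz eY eX js) YX.
have s2 : smooth_germ z (fun w : plane R => w.2 * c w).
  by apply: smooth_germM cs; exact: smooth_snd.
have s3 : smooth_germ z (fun w : plane R => w.2 * (w.2 * c w)).
  by apply: smooth_germM s2; exact: smooth_snd.
have pE v : 'D_v (prefold c) z = (v.1, 0).
  have -> : prefold c = fun w => (w.1, w.2 * (w.2 * c w)).
    by apply/funext => w; rewrite /prefold expr2 mulrA.
  rewrite (derive_pairl v (smooth_germ_diff s3)); congr pair.
  rewrite (derive_plane v (smooth_germ_diff s3)).
  have EX := derive_mulX s2; have EY := derive_mulY s2; rewrite t0 mul0r in EX.
  rewrite t0 !mul0r addr0 in EY.
  apply: etrans (congr2 (fun s t : R => v.1 *: s + v.2 *: t) EX EY) _.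
  by rewrite !scaler0 addr0.
(* On [t = 0] the Hessian matrix of [t m] has the rows [(0, d_u m)] and [(d_u m, 2 d_t m)]. *)
have HD : hessdet (jac (prefold c)) z = - ('D_eX prefold_m z) ^+ 2.
  apply: etrans (det4 XX YY XY YX) _.
  by rewrite mul0r sub0r.
have Hvv v : v.1 = 0 -> 'D_v ('D_v (jac (prefold c))) z =
    v.2 * (v.2 * (2 * 'D_eY prefold_m z)).
  move=> v0; apply: etrans (derive2_plane v v js) _.
  rewrite v0 mul0r add0r.
  rewrite (derive_plane v (smooth_germ_diff (smooth_germ_derive eY js))) v0 scale0r add0r.
  by rewrite YY.
have nz1 (a b : R) : a = - b ^+ 2 -> b != 0 -> a != 0.
  by move=> -> b0; rewrite oppr_eq0 expf_neq0.
have nz2 (a b : R) : a = 1 * (1 * (2 * b)) -> b != 0 -> a != 0.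
  by move=> -> b0; rewrite !mul1r mulf_neq0 // pnatr_eq0.
split=> [[C D [v vf vh]]|[m0 mX mY]].
  have [m0 _ _] := critical_prefold.1 C.
  have v0 : v.1 = 0 by have := pE v; rewrite vf => -[].
  rewrite (Hvv v v0) in vh; rewrite HD in D.
  split; first exact m0.
    by apply: contra D => /eqP ->; rewrite expr0n oppr0.
  by apply: contra vh => /eqP ->; rewrite !mulr0.
split.
- have e1 (x : R) : z.2 * x = 0 by rewrite t0 mul0r.
  exact (critical_prefold.2 (And3 m0 (e1 _) (e1 _))).
- exact (nz1 _ _ HD mX).
- exists eY; first exact (pE eY).
  exact (nz2 _ _ (Hvv eY (erefl _)) mY).
Qed.

End Prefold.

End Invariants.

(** * Stability of I and II *)

Section Slices.
Context {R : realType} {p : nat}.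
Local Notation P := 'rV[R]_p.
Local Notation V := (plane R * P)%type.

Local Notation eX := ((1, 0) : plane R).
Local Notation eY := ((0, 1) : plane R).

Lemma derive_slice (W : normedModType R) (F : V -> W) (z v : plane R) (l : P) :
  'D_v (fun z => F (z, l)) z = 'D_((v, 0) : V) F (z, l).
Proof.
rewrite /derive; congr (lim (_ @ 0^')); apply/funext => h /=.
congr (_ *: (F _ - _)); apply: injective_projections => //=.
by rewrite scaler0 add0r.
Qed.

(** The Jacobian determinant in the source variables, taken as a function of point and parameter
    together: its joint smoothness makes nonvanishing conditions persist for small parameters. *)
Definition jac_family (F : V -> plane R) (w : V) : R :=
  ('D_((eX, 0) : V) F w).1 * ('D_((eY, 0) : V) F w).2 -
  ('D_((eY, 0) : V) F w).1 * ('D_((eX, 0) : V) F w).2.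

Lemma jac_slice (F : V -> plane R) (l : P) :
  jac (fun z => F (z, l)) = fun z => jac_family F (z, l).
Proof. by apply/funext => z; rewrite /jac !derive_slice. Qed.

Lemma jac_family_smooth (F : V -> plane R) w : smooth_germ w F ->
  smooth_germ w (jac_family F).
Proof.
move=> Fs.
by apply: smooth_germB; apply: smooth_germM;
  (apply: smooth_germ_fst || apply: smooth_germ_snd); apply: smooth_germ_derive.
Qed.

Lemma derive_jac_slice (F : V -> plane R) (l : P) (z v : plane R) :
  'D_v (jac (fun z => F (z, l))) z = 'D_((v, 0) : V) (jac_family F) (z, l).
Proof. rewrite jac_slice; exact: derive_slice. Qed.

Lemma derive2_jac_slice (F : V -> plane R) (l : P) (z u v : plane R) :
  'D_u ('D_v (jac (fun z => F (z, l)))) z =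
  'D_((u, 0) : V) ('D_((v, 0) : V) (jac_family F)) (z, l).
Proof.
rewrite jac_slice.
have E : 'D_v (fun z => jac_family F (z, l)) =
    fun z => 'D_((v, 0) : V) (jac_family F) (z, l).
  by apply/funext => w; exact: derive_slice.
rewrite E; exact: derive_slice.
Qed.

Lemma near_pair (Q : V -> Prop) : (\forall w \near (0 : V), Q w) <->
  exists2 d : R, 0 < d & forall z l, `|z| < d -> `|l| < d -> Q (z, l).
Proof.
split=> [/nbhs_normP[d d0 dP]|[d d0 dP]].
  exists d => // z l zd ld; apply: dP.
  by rewrite /= sub0r normrN prod_normE gt_max zd.
apply/nbhs_normP; exists d => // -[z l].
by rewrite /= sub0r normrN prod_normE gt_max => /andP[zd ld]; exact: dP.
Qed.

Lemma norm_axis (x : R) : `|(x, 0) : plane R| = `|x|.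
Proof. by rewrite prod_normE /= normr0 max_l. Qed.

Lemma smooth_slice (W : normedModType R) (F : V -> W) (z : plane R) (l : P) :
  smooth_germ (z, l) F -> smooth_germ z (fun z => F (z, l)).
Proof.
move=> Fs.
pose L (x : plane R) : V := (x, 0).
have Llin : linear L.
  by move=> a u v; apply: injective_projections; rewrite //= scaler0 addr0.
pose LL : {linear plane R -> V} := HB.pack L (GRing.isLinear.Build _ _ _ _ _ Llin).
have Lc : continuous LL.
  move=> x; apply: (@continuous_pairf _ _ _ _ id (cst (0 : P))); first exact: cvg_id.
  exact: cst_continuous.
have LE (x : plane R) : LL x + ((0, l) : V) = (x, l).
  by apply: injective_projections; rewrite /= ?addr0 ?add0r.
have := @smooth_germ_affine R V W (plane R) z LL (0, l) F Lc.
rewrite LE => /(_ Fs); apply: smooth_germ_ext.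
by apply: near_all => x; rewrite LE.
Qed.

End Slices.

(** * Recognition of I and II by their invariants *)

Section Pretangential.
Context {R : realType}.
Implicit Types f g : plane R -> plane R.

Local Notation eX := ((1, 0) : plane R).
Local Notation eY := ((0, 1) : plane R).

(** The facts about a tangential family on which its normal form rests; after translation they hold
    at every point of the support. *)
Definition pretangential f : Prop :=
  [/\ f 0 = 0, smooth_germ 0 f, 'D_eX f 0 != 0 &
   \forall u \near (0 : R), jac f (u, 0) = 0].

Lemma prefold_m0 (c : plane R -> R) : prefold_m c 0 = 2 * c 0.
Proof. by rewrite /prefold_m /= mul0r addr0. Qed.

Lemma derive_prefold_mX (c : plane R -> R) z : z.2 = 0 -> smooth_germ z c ->
  'D_eX (prefold_m c) z = 2 * 'D_eX c z.
Proof.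
move=> t0 cs; have cYs : smooth_germ z ('D_eY c) by exact: smooth_germ_derive.
rewrite /prefold_m deriveD_smooth; last 2 first.
- by apply: smooth_germ_diff; apply: smooth_germM cs; exact: smooth_germ_cst.
- by apply: smooth_germ_diff; apply: smooth_germM cYs; exact: smooth_snd.
rewrite derive_mulX // t0 mul0r addr0 deriveM_smooth; last 2 first.
- exact: smooth_germ_diff (smooth_germ_cst _ _).
- exact: smooth_germ_diff.
by rewrite derive_cst mulr0 addr0.
Qed.

Lemma derive_prefold_mY (c : plane R -> R) z : z.2 = 0 -> smooth_germ z c ->
  'D_eY (prefold_m c) z = 3 * 'D_eY c z.
Proof.
move=> t0 cs; have cYs : smooth_germ z ('D_eY c) by exact: smooth_germ_derive.
rewrite /prefold_m deriveD_smooth; last 2 first.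
- by apply: smooth_germ_diff; apply: smooth_germM cs; exact: smooth_germ_cst.
- by apply: smooth_germ_diff; apply: smooth_germM cYs; exact: smooth_snd.
rewrite derive_mulY // t0 mul0r addr0 deriveM_smooth; last 2 first.
- exact: smooth_germ_diff (smooth_germ_cst _ _).
- exact: smooth_germ_diff.
by rewrite derive_cst mulr0 addr0; move: ('D_eY c z) => x; ring.
Qed.

Lemma critical_prefold0 (c : plane R -> R) : smooth_germ 0 c ->
  critical (prefold c) 0 <-> c 0 = 0.
Proof.
move=> cs; have E := critical_prefold cs.
split=> [C|c0].
  have [m0 _ _] := E.1 C; move: m0; rewrite prefold_m0 => /eqP.
  by rewrite mulf_eq0 pnatr_eq0 /= => /eqP.
have m0 : prefold_m c 0 = 0 by rewrite prefold_m0 c0 mulr0.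
exact (E.2 (And3 m0 (mul0r _) (mul0r _))).
Qed.

Lemma beaks_prefold0 (c : plane R -> R) : smooth_germ 0 c ->
  beaks (prefold c) 0 <-> [/\ c 0 = 0, 'D_eX c 0 != 0 & 'D_eY c 0 != 0].
Proof.
move=> cs; have E := beaks_prefold cs (erefl : (0 : plane R).2 = 0).
have mX := derive_prefold_mX (erefl : (0 : plane R).2 = 0) cs.
have mY := derive_prefold_mY (erefl : (0 : plane R).2 = 0) cs.
have nz (k a b : R) : k != 0 -> a = k * b -> b != 0 -> a != 0.
  by move=> k0 ->; exact: mulf_neq0.
have zn (k a b : R) : a = k * b -> a != 0 -> b != 0.
  by move=> ->; rewrite mulf_eq0 negb_or => /andP[].
have z0 (k a b : R) : k != 0 -> a = k * b -> a = 0 -> b = 0.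
  by move=> k0 -> /eqP; rewrite mulf_eq0 (negbTE k0) => /eqP.
have n2 : (2 : R) != 0 by rewrite pnatr_eq0.
have n3 : (3 : R) != 0 by rewrite pnatr_eq0.
have m0 := prefold_m0 c.
split=> [B|[c0 cX cY]].
  have [m00 X0 Y0] := E.1 B.
  exact (And3 (z0 _ _ _ n2 m0 m00) (zn _ _ _ mX X0) (zn _ _ _ mY Y0)).
have m00 : prefold_m c 0 = 0 by rewrite m0 c0 mulr0.
exact (E.2 (And3 m00 (nz _ _ _ n2 mX cX) (nz _ _ _ n3 mY cY))).
Qed.

Lemma germI_smooth z : smooth_germ z (germI R).
Proof.
apply: smooth_germ_pair.
  by apply: smooth_germD; [exact: smooth_fst|exact: smooth_snd].
by apply: smooth_germX; exact: smooth_snd.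
Qed.

Lemma germII_smooth z : smooth_germ z (germII R).
Proof.
apply: smooth_germ_pair.
  by apply: smooth_germD; [exact: smooth_fst|exact: smooth_snd].
by apply: smooth_germM; [apply: smooth_germX; exact: smooth_snd|exact: smooth_fst].
Qed.

Lemma germI0 : germI R 0 = 0.
Proof. by rewrite /germI /= addr0 expr0n. Qed.

Lemma germII0 : germII R 0 = 0.
Proof. by rewrite /germII /= addr0 expr0n mul0r. Qed.

Lemma A_equiv_smooth f g : smooth_germ 0 f -> f 0 = 0 -> A_equiv f g ->
  smooth_germ 0 g /\ g 0 = 0.
Proof.
move=> fs f0 [p [p' [q [q' [[_ ps _ p0 _] [qs _ q0 _ _] E]]]]].
split; last by rewrite (nbhs_singleton E) p0 f0 q0.
apply: (smooth_germ_ext (f := fun z => q (f (p' z)))).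
  by apply: filterS E => z.
apply: smooth_germ_comp; [exact: has_coords_plane| |by rewrite p0 f0].
by apply: smooth_germ_comp; [exact: has_coords_plane|exact: ps|rewrite p0].
Qed.

Lemma A_equiv_sym_smooth f g : smooth_germ 0 f -> f 0 = 0 -> A_equiv f g ->
  A_equiv g f.
Proof. by move=> fs f0; apply: A_equiv_sym => //; exact: smooth_germ_cont. Qed.

Lemma germI_not_critical : ~ critical (germI R) 0.
Proof.
move=> C; have s1 : smooth_germ 0 (fun _ : plane R => (1 : R)) by exact: smooth_germ_cst.
have := A_equiv_critical (germI_smooth 0) germI0 (germI_prefold (oner_neq0 R)) C.
by move/(critical_prefold0 s1)/eqP; rewrite oner_eq0.
Qed.

Lemma germII_beaks : beaks (germII R) 0.
Proof.
have s1 : smooth_germ 0 (fun z : plane R => z.1 - z.2).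
  by apply: smooth_germB; [exact: smooth_fst|exact: smooth_snd].
have E := A_equiv_sym_smooth (germII_smooth 0) germII0 germII_prefold.
apply: A_equiv_beaks E _; [exact: prefold_smooth|exact: prefold0|].
apply/(beaks_prefold0 s1); split; first by rewrite /= subrr.
  rewrite deriveB_smooth; last 2 first.
  - exact: smooth_germ_diff (smooth_fst _).
  - exact: smooth_germ_diff (smooth_snd _).
  by rewrite derive_planeX derive_planeX2 subr0 oner_neq0.
rewrite deriveB_smooth; last 2 first.
- exact: smooth_germ_diff (smooth_fst _).
- exact: smooth_germ_diff (smooth_snd _).
by rewrite derive_planeY derive_planeY1 sub0r oppr_eq0 oner_neq0.
Qed.

Lemma pretangential_classI f : pretangential f -> ~ critical f 0 ->
  A_equiv (germI R) f.
Proof.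
move=> [f0 fs fx fj] nC; have [c cs fc] := prenormal f0 fs fx fj.
have cf : A_equiv (prefold c) f := A_equiv_sym_smooth fs f0 fc.
have c0 : c 0 != 0.
  apply/eqP => c0; apply: nC.
  exact (A_equiv_critical (prefold_smooth cs) (prefold0 c) cf ((critical_prefold0 cs).2 c0)).
exact (A_equiv_trans (prefold_unit cs c0) cf).
Qed.

Lemma pretangential_classII f : pretangential f -> beaks f 0 ->
  A_equiv (germII R) f.
Proof.
move=> [f0 fs fx fj] B; have [c cs fc] := prenormal f0 fs fx fj.
have cf : A_equiv (prefold c) f := A_equiv_sym_smooth fs f0 fc.
have [c0 cX cY] := (beaks_prefold0 cs).1 (A_equiv_beaks fs f0 fc B).
exact (A_equiv_trans (prefold_beaks cs c0 cX cY) cf).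
Qed.

End Pretangential.

(** * Tangential deformations and the stability of I *)

Section Deformations.
Context {R : realType}.
Implicit Types f g : plane R -> plane R.

Local Notation eX := ((1, 0) : plane R).
Local Notation eY := ((0, 1) : plane R).

Lemma tangential_jac r f u : tangential_on r f -> `|u| < r -> jac f (u, 0) = 0.
Proof.
move=> [fs ft fp _] /fp[_ _ [k]]; rewrite /jac /d_xi /d_t.
move: ('D_eX f (u, 0)) ('D_eY f (u, 0)) => a [b1 b2] -> /=.
have E (x y : R) : x *: y = x * y by [].
by rewrite !E; ring.
Qed.

Lemma tangential_smooth r f z : tangential_on r f -> box r z -> smooth_germ z f.
Proof. by move=> [fs _ _ _]; exact ((smooth_onP f (@open_box R r)).1 fs z). Qed.

Lemma pretangential_germ_at r f x : tangential_on r f -> `|x| < r ->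
  pretangential (germ_at f (x, 0)).
Proof.
move=> T xr; have [fs ft fp _] := T; split.
- exact: germ_at0.
- apply: germ_at_smooth; apply: tangential_smooth T _.
  by split; rewrite //= normr0 (le_lt_trans _ xr).
- have [fX _ _] := fp _ xr; rewrite derive_translate addr0; exact fX.
- have n : \forall u \near (0 : R), `|x + u| < r.
    have c : {for (0 : R), continuous (fun u : R => `|x + u|)}.
      apply: (continuous_comp (f := fun u : R => x + u) (g := fun u : R => `|u|)).
        by apply: continuousD; [exact: cst_continuous|exact: cvg_id].
      exact: norm_continuous.
    by move/cvgr_lt: c; apply; rewrite addr0.
  apply: filterS n => u xu; rewrite jac_germ_at.
  have -> : ((x, 0) : plane R) + (u, 0) = (x + u, 0).
    by apply: injective_projections; rewrite /= ?addr0.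
  exact: tangential_jac T xu.
Qed.

Lemma pretangential_family f : tangential_family_germ f -> pretangential f.
Proof. exact: tangential_prenormal. Qed.

Section Family.
Variable p : nat.
Local Notation P := 'rV[R]_p.
Local Notation V := (plane R * P)%type.

Lemma open_domain (r s : R) :
  open (box r `*` [set l : P | `|l| < s] : set V).
Proof.
apply: openI; apply: open_comp.
- by move=> w _; exact: continuous_fst.
- exact: open_box.
- by move=> w _; exact: continuous_snd.
- have -> : [set l : P | `|l| < s] = (fun l : P => `|l|) @^-1` [set x | x < s] by [].
  by apply: open_comp; [move=> l _; exact: norm_continuous|exact: open_lt].
Qed.

Lemma deformation_smooth (r s : R) (F : V -> plane R) w :
  smooth_on (box r `*` [set l | `|l| < s]) F -> box r w.1 -> `|w.2| < s ->
  smooth_germ w F.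
Proof.
move=> Fs w1 w2.
exact ((smooth_onP F (@open_domain r s)).1 Fs w (conj w1 w2)).
Qed.

(** Reduces a deformation of a germ in the orbit to one of a genuine tangential family, whose
    support lies on the axis: the singularity of [F_l] at [q] is that of [G_l] at [phi q], for all
    [(q, l)] near the origin at once. *)
Lemma deformation_transfer g (G : V -> plane R) : tangential_deformation g G ->
  exists f phi (F : V -> plane R),
    [/\ tangential_family_germ f, A_equiv f g, smooth_germ 0 phi /\ phi 0 = 0,
      tangential_deformation0 f F &
      \forall w \near (0 : V), A_equiv (germ_at (fun z => F (z, w.2)) w.1)
        (germ_at (fun z => G (z, w.2)) (phi w.1))].
Proof.
move=> [f [phi [phi' [psi [psi' [F [tf [dphi dpsi] E dF EG]]]]]]].
exists f, phi, F; split=> //.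
- exact: A_equiv_intro (diffeo_germ_sym dphi) dpsi E.
- by have [? _ ? _ _] := dphi.
have [r [s [r0 s0 Fs _ F0]]] := dF.
have b0 : box r (0 : plane R) by split; rewrite /= normr0.
have Fs0 : smooth_germ (0 : V) F.
  by apply: (deformation_smooth Fs); rewrite //= normr0.
have F00 : F 0 = 0.
  have [f0 _] := tf.
  have := nbhs_singleton F0; rewrite -[(0, 0)]/(0 : V) => ->; exact: f0.
have [ps ps' p0 p0' [pK _]] := dphi.
have sf : smooth_germ (0 : V) fst by exact: smooth_fst.
have n1 := near_comp0 sf (erefl : (0 : V).1 = 0) (diffeo_germ_at dphi).
have n2 := near_comp0 Fs0 F00 (diffeo_germ_at dpsi).
have n3 := near_comp0 sf (erefl : (0 : V).1 = 0) pK.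
have ms : smooth_germ (0 : V) (fun w : V => (phi w.1, w.2) : V).
  apply: smooth_germ_pair; last exact: smooth_snd.
  by apply: (smooth_germ_comp (g := fst)) => //; exact: has_coords_plane.
have m0 : (fun w : V => (phi w.1, w.2) : V) 0 = 0 by rewrite /= p0.
have n4 := near_comp0 ms m0 (near_near EG).
apply: filterS3 (filterI n1 n2) n3 n4 => -[q l] [/= d1 d2] e3 e4.
apply: (A_equiv_intro (diffeo_germ_sym d1) d2).
have c : {for (0 : plane R), continuous (fun z : plane R => (phi q + z, l) : V)}.
  apply: (@continuous_pairf _ _ _ _ (fun z => phi q + z) (cst l)).
    by apply: continuousD; [exact: cst_continuous|exact: cvg_id].
  exact: cst_continuous.
have e4' : \forall y \near ((phi q + 0, l) : V), G y = psi (F (phi' y.1, y.2)).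
  by rewrite addr0.
have := near_comp c e4'; apply: filterS => z /= Ez.
have E0 := nbhs_singleton e4; rewrite /= in E0.
by rewrite /germ_at Ez E0 /= !e3 subrKC subrKC.
Qed.

Lemma near_param (Q : V -> Prop) : (\forall w \near (0 : V), Q w) ->
  \forall l \near (0 : P), Q (0, l).
Proof.
move=> /near_pair[d d0 dP]; apply/nbhs_normP; exists d => // l.
by rewrite /= sub0r normrN => ld; apply: dP; rewrite ?normr0.
Qed.

Lemma deformation_cont (r s : R) (F : V -> plane R) (u : V) : 0 < r -> 0 < s ->
  smooth_on (box r `*` [set l | `|l| < s]) F ->
  smooth_germ 0 ('D_u (jac_family F)).
Proof.
move=> r0 s0 Fs; apply: smooth_germ_derive; apply: jac_family_smooth.
by apply: (deformation_smooth Fs); rewrite /= ?normr0 //; split; rewrite /= normr0.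
Qed.

End Family.

Lemma not_criticalP f : jac f 0 = 0 -> ~ critical f 0 ->
  exists v, 'D_v (jac f) 0 != 0.
Proof.
move=> j0 nC; apply: contrapT => H; apply: nC; split; first exact j0.
move=> v; apply/eqP; apply/negPn/negP => vn; apply: H; exists v; exact vn.
Qed.

Lemma near_param_lt p (s : R) : 0 < s -> \forall l \near (0 : 'rV[R]_p), `|l| < s.
Proof.
by move=> s0; apply/nbhs_normP; exists s => // l /=; rewrite sub0r normrN.
Qed.

(** Some directional derivative of [J] at the origin is nonzero and remains so for nearby
    parameters; the origin itself is then the required point for every small [l]. *)
Lemma singularityI_stable : stable (singularityI R).
Proof.
move=> g gI p G dG U U0.
have [f [phi [F [tf fg [ps p0] [r [s [r0 s0 Fs Ft F0]]] tr]]]] := deformation_transfer dG.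
have [f0 fs fX fj] := pretangential_family tf.
have [gs g0] := A_equiv_smooth (germI_smooth 0) germI0 gI.
have gI' := A_equiv_sym_smooth (germI_smooth 0) germI0 gI.
have nC : ~ critical f 0.
  move=> C; apply: (@germI_not_critical R).
  exact (A_equiv_critical gs g0 gI' (A_equiv_critical fs f0 fg C)).
have [v vn] := not_criticalP (nbhs_singleton fj) nC.
have Jv0 : 'D_((v, 0) : plane R * 'rV[R]_p) (jac_family F) 0 != 0.
  have := derive_jac_slice F 0 0 v; rewrite -[(0, 0)]/(0 : plane R * 'rV[R]_p) => <-.
  suff -> : 'D_v (jac (fun z => F (z, 0))) 0 = 'D_v (jac f) 0 by exact vn.
  apply: near_eq_derive; apply: filterS (near_near F0) => z; exact: jac_near.
have Jc := smooth_germ_cont (deformation_cont ((v, 0) : plane R * 'rV[R]_p) r0 s0 Fs).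
have n0 : \forall w \near (0 : plane R * 'rV[R]_p),
    'D_((v, 0) : plane R * 'rV[R]_p) (jac_family F) w != 0.
  exact: cvgr_neq0 Jc Jv0.
have n1 := near_param n0.
apply: filterS3 (near_param tr) n1 (near_param_lt p s0) => l e1 e2 ls.
exists 0; first exact: nbhs_singleton.
rewrite /= p0 in e1; apply: A_equiv_trans gI' _; apply: A_equiv_trans e1.
have r0' : `|0 : R| < r by rewrite normr0.
apply: (pretangential_classI (pretangential_germ_at (Ft _ ls) r0')).
move/critical_germ_at => [_ C].
have Cv := C v; rewrite derive_jac_slice in Cv.
by move/eqP: e2; apply; exact Cv.
Qed.

End Deformations.

(** * Stability of II *)

Section StableII.
Context {R : realType}.
Implicit Types f g : plane R -> plane R.

Local Notation eX := ((1, 0) : plane R).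
Local Notation eY := ((0, 1) : plane R).

Lemma derive_axis0 (j : plane R -> R) (u : R) :
  (\forall x \near u, j (x, 0) = 0) -> 'D_eX j (u, 0) = 0.
Proof.
move=> j0.
have c : {for (0 : R), continuous (fun h : R => h + u)}.
  by apply: continuousD; [exact: cvg_id|exact: cst_continuous].
have n : \forall h \near (0 : R), j (h + u, 0) = 0.
  by apply: (near_comp (P := fun x => j (x, 0) = 0) c); rewrite add0r.
have E (h : R) : h *: eX + (u, 0) = (h + u, 0).
  by apply: injective_projections; rewrite /= ?[_%:A]mulr1 // scaler0 addr0.
apply: lim_near_cst => //=; near=> h.
rewrite E (nbhs_singleton j0).
have -> : j (h + u, 0) = 0 by near: h; exact: nbhs_dnbhs n.
by rewrite subrr scaler0.
Unshelve. all: by end_near. Qed.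

(* [kernel_vector a b e] spans the kernel of a rank-one matrix with columns
   [a], [b] as soon as [a.1 * e.1 + a.2 * e.2 != 0]. *)
Definition kernel_vector (a b e : plane R) : plane R :=
  (- (b.1 * e.1 + b.2 * e.2), a.1 * e.1 + a.2 * e.2).

Lemma kernel_vectorP (a b e : plane R) : a.1 * b.2 - b.1 * a.2 = 0 ->
  (kernel_vector a b e).1 *: a + (kernel_vector a b e).2 *: b = 0.
Proof.
case: a b e => [a1 a2] [b1 b2] [e1 e2] /= D.
have E (x y : R) : x *: y = x * y by [].
apply: injective_projections; rewrite /= !E.
  have -> : - (b1 * e1 + b2 * e2) * a1 + (a1 * e1 + a2 * e2) * b1 =
    - e2 * (a1 * b2 - b1 * a2) by ring.
  by rewrite D mulr0.
have -> : - (b1 * e1 + b2 * e2) * a2 + (a1 * e1 + a2 * e2) * b2 =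
  e1 * (a1 * b2 - b1 * a2) by ring.
by rewrite D mulr0.
Qed.

(** With [m = a.1 * e.1 + a.2 * e.2], the kernel equation gives [v.2 k = m v], so the values of the
    form at [k] and at [v] differ by the factors [v.2 ^+ 2] and [m ^+ 2]. *)
Lemma kernel_vector_quadratic (a b e v : plane R) (XX YX XY YY : R) :
  v.1 *: a + v.2 *: b = 0 ->
  (a.1 * e.1 + a.2 * e.2) != 0 ->
  v.1 * (v.1 * XX + v.2 * YX) + v.2 * (v.1 * XY + v.2 * YY) != 0 ->
  let k := kernel_vector a b e in
  k.1 * (k.1 * XX + k.2 * YX) + k.2 * (k.1 * XY + k.2 * YY) != 0.
Proof.
case: a b e v => [a1 a2] [b1 b2] [e1 e2] [v1 v2] /= [].
have E (x y : R) : x *: y = x * y by [].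
rewrite !E => D1 D2 m0 q0; rewrite /kernel_vector /=.
set m := a1 * e1 + a2 * e2 in m0 *; set n := b1 * e1 + b2 * e2.
have D : v1 * m = - (v2 * n).
  have -> : v1 * m = e1 * (v1 * a1 + v2 * b1) + e2 * (v1 * a2 + v2 * b2) - v2 * n.
    by rewrite /m /n; ring.
  by rewrite D1 D2 !mulr0 addr0 add0r.
apply: contra q0 => /eqP q0.
have : v2 ^+ 2 * (- n * (- n * XX + m * YX) + m * (- n * XY + m * YY)) =
    m ^+ 2 * (v1 * (v1 * XX + v2 * YX) + v2 * (v1 * XY + v2 * YY)).
  have -> : v2 ^+ 2 * (- n * (- n * XX + m * YX) + m * (- n * XY + m * YY)) =
   - (v2 * n) * (- (v2 * n) * XX + m * v2 * YX) + m * v2 * (- (v2 * n) * XY + m * v2 * YY).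
    by ring.
  by rewrite -D; ring.
rewrite q0 mulr0 => /esym/eqP; rewrite mulf_eq0 expf_eq0 /= (negbTE m0) /=.
by [].
Qed.

Lemma norm2_neq0 (a : plane R) : a != 0 -> a.1 * a.1 + a.2 * a.2 != 0.
Proof.
apply: contra; rewrite -!expr2 paddr_eq0 ?sqr_ge0 // !sqrf_eq0 => /andP[/eqP a1 /eqP a2].
by apply/eqP; apply: injective_projections.
Qed.

(** On the support [J_l] vanishes identically, so only a zero of its [t] derivative has to be found
    there. At [l = 0] this derivative is [x k x] with [k 0 != 0]; it changes sign, still does so
    between fixed points for small [l], and the intermediate value theorem applies. The other
    conditions of [beaks] are open. *)
Lemma singularityII_stable : stable (singularityII R).
Proof.
move=> g gI p G dG U U0.
have [f [phi [F [tf fg [ps p0] [r [s [r0 s0 Fs Ft F0]]] tr]]]] := deformation_transfer dG.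
have [f0 fs fX fj] := pretangential_family tf.
have [gs g0] := A_equiv_smooth (germII_smooth 0) germII0 gI.
have gI' := A_equiv_sym_smooth (germII_smooth 0) germII0 gI.
have gB := A_equiv_beaks (germII_smooth 0) germII0 gI (@germII_beaks R).
have [[_ fd] fD [v vf vh]] :=
  A_equiv_beaks gs g0 (A_equiv_sym_smooth fs f0 fg) gB.
pose Jb := jac_family F.
pose H u w := 'D_((u, 0) : plane R * 'rV[R]_p) ('D_((w, 0) : plane R * 'rV[R]_p) Jb).
have b0 : box r (0 : plane R) by split; rewrite /= normr0.
have Fw w : box r w.1 -> `|w.2| < s -> smooth_germ w F.
  exact: deformation_smooth.
have Fs0 : smooth_germ (0 : plane R * 'rV[R]_p) F by apply: Fw; rewrite //= normr0.
have Js := jac_family_smooth Fs0.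
have Hs u w : smooth_germ 0 (H u w).
  exact (smooth_germ_derive _ (smooth_germ_derive _ Js)).
have Ej : \forall z \near (0 : plane R), jac (fun z => F (z, 0)) z = jac f z.
  apply: filterS (near_near F0) => z; exact: jac_near.
have EH u w : H u w 0 = 'D_u ('D_w (jac f)) 0.
  have E0 : H u w 0 = 'D_u ('D_w (jac (fun z => F (z, 0)))) 0.
    exact (esym (derive2_jac_slice F 0 0 u w)).
  rewrite E0; apply: near_eq_derive; apply: filterS (near_near Ej) => z; exact: near_eq_derive.
have XX0 : 'D_eX ('D_eX (jac f)) 0 = 0.
  apply: derive_axis0; apply: filterS (near_near fj) => u; exact: derive_axis0.
pose a := 'D_((eY, 0) : plane R * 'rV[R]_p) Jb.
pose al (x : R) := 'D_eY (jac f) (x, 0).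
have jfs := jac_smooth fs.
have jYs : smooth_germ 0 ('D_eY (jac f)) := smooth_germ_derive eY jfs.
have als : smooth_germ 0 al.
  apply: (smooth_germ_comp2 (a := id) (b := cst 0) (f := 'D_eY (jac f))) => //.
    exact: smooth_germ_id.
  exact: smooth_germ_cst.
have al0 : al 0 = 0 by exact (fd eY).
have [k [ks k0 ke]] := hadamard1 als al0.
(* [k 0] is the mixed second derivative of [J]. Since the second derivative along the support is
   zero, the Hessian determinant is minus the product of the mixed derivatives. *)
have kn : k 0 != 0.
  rewrite k0 (derive_comp2 (a := id) (b := cst 0) (f := 'D_eY (jac f))); last first.
  - exact: smooth_germ_diff jYs.
  - exact: smooth_germ_diff (smooth_germ_cst _ _).
  - exact: smooth_germ_diff (smooth_germ_id _).
  rewrite derive_id derive_cst scale1r scale0r addr0.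
  have nz (x y z w : R) : x = 0 -> x * y - z * w != 0 -> z != 0.
    by move=> ->; rewrite mul0r sub0r oppr_eq0 mulf_eq0 negb_or => /andP[].
  exact (nz _ _ _ _ XX0 fD).
pose e := 'D_eX f 0.
pose FX := 'D_((eX, 0) : plane R * 'rV[R]_p) F.
pose FY := 'D_((eY, 0) : plane R * 'rV[R]_p) F.
have FXs : smooth_germ 0 FX := smooth_germ_derive _ Fs0.
have FYs : smooth_germ 0 FY := smooth_germ_derive _ Fs0.
have FE u : 'D_((u, 0) : plane R * 'rV[R]_p) F 0 = 'D_u f 0.
  apply: etrans (esym (derive_slice F 0 u 0)) _.
  exact: near_eq_derive F0.
(* The kernel direction has to depend smoothly on point and parameter. With [e] equal to [d_u f] at
   the origin, the factor required to be nonzero is there the squared length of [e]. *)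
pose kv w := kernel_vector (FX w) (FY w) e.
pose Q w := (kv w).1 * ((kv w).1 * H eX eX w + (kv w).2 * H eY eX w) +
            (kv w).2 * ((kv w).1 * H eX eY w + (kv w).2 * H eY eY w).
have FX1 := smooth_germ_fst FXs; have FX2 := smooth_germ_snd FXs.
have FY1 := smooth_germ_fst FYs; have FY2 := smooth_germ_snd FYs.
have cs (c : R) : smooth_germ (0 : plane R * 'rV[R]_p) (fun=> c) by exact: smooth_germ_cst.
have kv1 : smooth_germ 0 (fun w => (kv w).1).
  exact (smooth_germN (smooth_germD (smooth_germM FY1 (cs e.1)) (smooth_germM FY2 (cs e.2)))).
have kv2 : smooth_germ 0 (fun w => (kv w).2).
  exact (smooth_germD (smooth_germM FX1 (cs e.1)) (smooth_germM FX2 (cs e.2))).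
have Qs : smooth_germ 0 Q.
  apply: smooth_germD; [apply: (smooth_germM kv1)|apply: (smooth_germM kv2)];
    exact (smooth_germD (smooth_germM kv1 (Hs _ _)) (smooth_germM kv2 (Hs _ _))).
have Q0 : Q 0 != 0.
  have FX0 : FX 0 = e := FE eX.
  have vf' : v.1 *: FX 0 + v.2 *: FY 0 = 0.
    rewrite /FX /FY; apply: etrans (congr2 (fun s t => v.1 *: s + v.2 *: t) (FE eX) (FE eY)) _.
    by rewrite -(derive_plane v (smooth_germ_diff fs)).
  apply: (kernel_vector_quadratic vf'); first by rewrite FX0; exact: norm2_neq0.
  have := derive2_expand v v jfs => Ev; rewrite Ev in vh.
  have E4 (x x' y y' z z' t t' : R) : x = x' -> y = y' -> z = z' -> t = t' ->
    v.1 * (v.1 * x' + v.2 * y') + v.2 * (v.1 * z' + v.2 * t') != 0 ->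
    v.1 * (v.1 * x + v.2 * y) + v.2 * (v.1 * z + v.2 * t) != 0.
    by move=> -> -> -> ->.
  exact (E4 _ _ _ _ _ _ _ _ (EH _ _) (EH _ _) (EH _ _) (EH _ _) vh).
pose D w := H eX eX w * H eY eY w - H eX eY w * H eY eX w.
have Ds : smooth_germ 0 D.
  exact (smooth_germB (smooth_germM (Hs _ _) (Hs _ _)) (smooth_germM (Hs _ _) (Hs _ _))).
have D0 : D 0 != 0.
  have E4 (x x' y y' z z' t t' : R) : x = x' -> y = y' -> z = z' -> t = t' ->
    x' * y' - z' * t' != 0 -> x * y - z * t != 0 by move=> -> -> -> ->.
  exact (E4 _ _ _ _ _ _ _ _ (EH _ _) (EH _ _) (EH _ _) (EH _ _) fD).
have nQ : \forall w \near (0 : plane R * 'rV[R]_p), Q w != 0.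
  exact: cvgr_neq0 (smooth_germ_cont Qs) Q0.
have nD : \forall w \near (0 : plane R * 'rV[R]_p), D w != 0.
  exact: cvgr_neq0 (smooth_germ_cont Ds) D0.
have nU : \forall w \near (0 : plane R * 'rV[R]_p), U (phi w.1).
  have := near_comp0 ps p0 U0.
  exact: near_comp0 (smooth_fst _) (erefl : (0 : plane R * 'rV[R]_p).1 = 0).
have [d d0 dP] := (near_pair _).1 (filterI (filterI nQ nD) (filterI nU tr)).
have kp : 0 < k 0 * k 0 by rewrite -expr2 exprn_even_gt0.
have nk : \forall x \near (0 : R), 0 < k x * k 0.
  have kks : smooth_germ 0 (fun x => k x * k 0).
    by apply: smooth_germM => //; exact: smooth_germ_cst.
  by have /cvgr_gt := smooth_germ_cont kks; apply.
have na : \forall x \near (0 : R), a ((x, 0), 0) = al x.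
  apply: filterS (near_axis (near_near Ej)) => x Ex.
  rewrite /a /al -(near_eq_derive eY Ex); exact (esym (derive_jac_slice F 0 (x, 0) eY)).
have [rho rho0 rhoP] := (nbhs_normP _ _).1 (filterI (filterI ke nk) na).
(* [rho] bounds the range of the expansion at [l = 0], [d] the neighbourhood where the open
   conditions hold, [r] the domain of the deformation. *)
pose eta := Num.min rho (Num.min d r) / 2.
have m0 : 0 < Num.min rho (Num.min d r) by rewrite !lt_min rho0 d0 r0.
have eta0 : 0 < eta by rewrite divr_gt0.
have : eta < Num.min rho (Num.min d r) by rewrite /eta ltr_pdivrMr // ltr_pMr // ltr1n.
rewrite !lt_min => /and3P[etarho etad etar].
have aE x : `|x| < rho -> a ((x, 0), 0) = x * k x /\ 0 < k x * k 0.
  move=> xr; have [|[e1 e2] e3] := rhoP x; first by rewrite /= sub0r normrN.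
  exact (conj (etrans e3 e1) e2).
have [a1 s1] : a ((eta, 0), 0) = eta * k eta /\ 0 < k eta * k 0.
  by apply: aE; rewrite gtr0_norm.
have [a2 s2] : a ((- eta, 0), 0) = - eta * k (- eta) /\ 0 < k (- eta) * k 0.
  by apply: aE; rewrite normrN gtr0_norm.
have prod0 : a ((eta, 0), 0) * a ((- eta, 0), 0) < 0.
  rewrite a1 a2.
  have -> : eta * k eta * (- eta * k (- eta)) = - (eta ^+ 2 * (k eta * k (- eta))) by ring.
  rewrite oppr_lt0 mulr_gt0 ?exprn_gt0 //.
  rewrite -(pmulr_lgt0 _ kp).
  have -> : k eta * k (- eta) * (k 0 * k 0) = (k eta * k 0) * (k (- eta) * k 0) by ring.
  exact: mulr_gt0.
have as_ (x : R) (l : 'rV[R]_p) : `|x| < r -> `|l| < s -> smooth_germ ((x, 0) : plane R, l) a.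
  move=> xr ls; apply: smooth_germ_derive; apply: jac_family_smooth; apply: Fw => //=.
  by split; rewrite //= normr0.
have zs : `|0 : 'rV[R]_p| < s by rewrite normr0.
have acont (x : R) (l : 'rV[R]_p) : `|x| < r -> `|l| < s ->
    {for l, continuous (fun l => a ((x, 0), l))}.
  move=> xr ls; apply: (continuous_comp (f := fun l : 'rV[R]_p => (((x, 0) : plane R), l))).
    apply: (@continuous_pairf _ _ _ _ (cst ((x, 0) : plane R)) id); last exact: cvg_id.
    exact: cst_continuous.
  exact: smooth_germ_cont (as_ x l xr ls).
have er : `|eta| < r by rewrite gtr0_norm.
have er' : `|- eta| < r by rewrite normrN gtr0_norm.
have nprod : \forall l \near (0 : 'rV[R]_p), a ((eta, 0), l) * a ((- eta, 0), l) < 0.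
  have c := continuousM (acont _ _ er zs) (acont _ _ er' zs).
  by move/cvgr_lt : c; apply.
apply: filterS3 nprod (near_param_lt p s0) (near_param_lt p d0) => l lprod ls ld.
have [|||x] := @IVT R (fun x => a ((x, 0), l)) (- eta) eta 0.
- by rewrite ge0_cp // ltW.
- apply: continuous_in_subspaceT => x; rewrite inE /= in_itv /= => /andP[x1 x2].
  have xr : `|x| < r by apply: le_lt_trans etar; rewrite ler_norml x1.
  apply: (continuous_comp (f := fun x : R => (((x, 0) : plane R), l) : plane R * 'rV[R]_p)).
    apply: (@continuous_pairf _ _ _ _ (fun x : R => (x, 0) : plane R) (cst l)).
      apply: (@continuous_pairf _ _ _ _ id (cst (0 : R))); first exact: cvg_id.
      exact: cst_continuous.
    exact: cst_continuous.
  exact: smooth_germ_cont (as_ x l xr ls).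
- move: lprod; rewrite ge_min le_max; move: (a _) (a _) => u w uw.
  have [u0|u0] := leP u 0; have [w0|w0] := leP w 0; rewrite ?u0 ?w0 ?(ltW u0) ?(ltW w0) ?orbT //.
    by move: uw; rewrite ltNge mulr_le0.
  by move: uw; rewrite ltNge mulr_ge0 // ltW.
rewrite in_itv /= => /andP[x1 x2] ax0.
have xeta : `|x| <= eta by rewrite ler_norml x1.
have xr : `|x| < r by exact: le_lt_trans etar.
have xd : `|(x, 0) : plane R| < d by rewrite norm_axis (le_lt_trans xeta).
have [[Qx Dx] [Ux Tx]] := dP _ _ xd ld.
exists (phi (x, 0)); first exact Ux.
apply: A_equiv_trans gI' _; apply: A_equiv_trans Tx.
apply: (pretangential_classII (pretangential_germ_at (Ft _ ls) xr)).
apply: (beaks_germ_at (fun z => F (z, l)) (x, 0)).2.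
have jx : jac (fun z => F (z, l)) (x, 0) = 0 := tangential_jac (Ft _ ls) xr.
have Fxs : smooth_germ ((x, 0) : plane R) (fun z => F (z, l)).
  by apply: smooth_slice; apply: Fw => //=; split; rewrite //= normr0.
have jxs := jac_smooth Fxs.
have HE u w := derive2_jac_slice F l (x, 0) u w.
have n : \forall y \near x, jac (fun z => F (z, l)) (y, 0) = 0.
  have c : {for x, continuous (fun y : R => `|y|)} by exact: norm_continuous.
  have : \forall y \near x, `|y| < r by move/cvgr_lt : c; apply.
  by apply: filterS => y; exact: (tangential_jac (Ft _ ls)).
split.
- split; first exact jx.
  move=> w; rewrite (derive_plane w (smooth_germ_diff jxs)).
  have EX := derive_axis0 n.
  have EY := etrans (derive_jac_slice F l (x, 0) eY) ax0.
  apply: etrans (congr2 (fun s t : R => w.1 *: s + w.2 *: t) EX EY) _.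
  by rewrite !scaler0 addr0.
- have E4 (m1 m1' y y' z z' t t' : R) : m1 = m1' -> y = y' -> z = z' -> t = t' ->
    m1' * y' - z' * t' != 0 -> m1 * y - z * t != 0 by move=> -> -> -> ->.
  exact (E4 _ _ _ _ _ _ _ _ (HE _ _) (HE _ _) (HE _ _) (HE _ _) Dx).
- exists (kv ((x, 0), l)).
  + rewrite (derive_plane _ (smooth_germ_diff Fxs)).
    have EX := derive_slice F (x, 0) eX l; have EY := derive_slice F (x, 0) eY l.
    apply: etrans (congr2 (fun s t : plane R => _ *: s + _ *: t) EX EY) _.
    apply: kernel_vectorP; rewrite -[LHS]/(jac_family F ((x, 0), l)).
    by have := jx; rewrite jac_slice.
  + have Ev := derive2_expand (kv ((x, 0), l)) (kv ((x, 0), l)) jxs.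
    rewrite Ev.
    have E4 (b : plane R) (m1 m1' y y' z z' t t' : R) :
      m1 = m1' -> y = y' -> z = z' -> t = t' ->
      b.1 * (b.1 * m1' + b.2 * y') + b.2 * (b.1 * z' + b.2 * t') != 0 ->
      b.1 * (b.1 * m1 + b.2 * y) + b.2 * (b.1 * z + b.2 * t) != 0.
      by move=> -> -> -> ->.
    exact (E4 _ _ _ _ _ _ _ _ _ (HE _ _) (HE _ _) (HE _ _) (HE _ _) Qx).
Qed.

End StableII.

(** * Instability of the other singularities *)

Section Pigeonhole.
Context {R : realType}.

Lemma same_cell (K : nat) (x y : R) : (0 < K)%N -> 0 <= x -> 0 <= y ->
  Num.trunc (x * K%:R) = Num.trunc (y * K%:R) -> `|x - y| < K%:R^-1.
Proof.
move=> K0 x0 y0 E.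
have K0' : 0 < K%:R :> R by rewrite ltr0n.
have /andP[a1 a2] := trunc_itv (mulr_ge0 x0 (ltW K0')).
have /andP[b1 b2] := trunc_itv (mulr_ge0 y0 (ltW K0')).
rewrite E in a1 a2; move: a1 a2 b1 b2; set n := Num.trunc _.
rewrite -natr1 => a1 a2 b1 b2.
rewrite -[ltRHS]mul1r ltr_pdivlMr // -(gtr0_norm K0') -normrM mulrBl.
by rewrite ltr_norml; apply/andP; split; lra.
Qed.

(* The covering by three Lipschitz images of a square cannot exhaust a cube: the
   [k^3] points of a grid of mesh [e/k] would fall into [O(k^2)] cells. *)
Lemma lipschitz_images_not_cube (B : 'I_3 -> plane R -> (R * R * R)%type -> Prop)
    (e L : R) : 0 < e ->
  (forall i x x' l l', B i x l -> B i x' l' -> `|l - l'| <= L * `|x - x'|) ->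
  ~ (forall l : (R * R * R)%type, 0 <= l.1.1 <= e -> 0 <= l.1.2 <= e ->
      0 <= l.2 <= e -> exists i (x : plane R), [/\ 0 <= x.1 <= 1, 0 <= x.2 <= 1 & B i x l]).
Proof.
move=> e0 lip cov.
pose L' := `|L| + 1.
have L'0 : 0 < L' by rewrite ltr_pwDr.
have lip' i x x' l l' : B i x l -> B i x' l' -> `|l - l'| <= L' * `|x - x'|.
  move=> b b'; apply: (le_trans (lip _ _ _ _ _ b b')); rewrite ler_wpM2r //.
  by apply: (le_trans (ler_norm _)); rewrite lerDl.
(* With [K = C k] cells per unit length, grid points whose witnesses share a cell are closer than
   [L' / (C k) < e / k], the mesh, and hence equal. The choice [k > 3 (C + 1)^2] makes [k^3] exceed
   the number [3 (K + 1)^2] of cells. *)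
pose C := (Num.trunc (L' / e)).+1.
have Ce : L' / e < C%:R.
  by have /andP[_] := trunc_itv (divr_ge0 (ltW L'0) (ltW e0)).
pose k := (3 * (C + 1) ^ 2).+1.
pose K := (C * k)%N.
have k0 : (0 < k)%N by [].
have K0 : (0 < K)%N by rewrite muln_gt0.
pose pt (a : 'I_k) : R := a%:R * e / k%:R.
have k0' : 0 < k%:R :> R by rewrite ltr0n.
have K0' : 0 < K%:R :> R by rewrite ltr0n.
have pt0 a : 0 <= pt a <= e.
  rewrite /pt; apply/andP; split; first by rewrite !mulr_ge0 ?invr_ge0 // ltW.
  by rewrite ler_pdivrMr // mulrC ler_pM2l // ler_nat ltnW.
have pt_inj a b : `|pt a - pt b| < e / k%:R -> a = b.
  rewrite /pt -!mulrA -mulrBl normrM [X in _ * X]gtr0_norm ?divr_gt0 //.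
  rewrite gtr_pMl ?divr_gt0 // ltr_norml => /andP[ab1 ab2]; apply: val_inj => /=.
  have [ab|ab|//] := ltngtP a b; move: ab; rewrite -(ler_nat R) -natr1 => ab; exfalso.
    by move: ab1 ab2 ab; clear; move: (_%:R) (_%:R) => x y; lra.
  by move: ab1 ab2 ab; clear; move: (_%:R) (_%:R) => x y; lra.
pose lam (w : 'I_k * 'I_k * 'I_k) : (R * R * R)%type := (pt w.1.1, pt w.1.2, pt w.2).
have H w : exists ix : 'I_3 * plane R,
    [/\ 0 <= ix.2.1 <= 1, 0 <= ix.2.2 <= 1 & B ix.1 ix.2 (lam w)].
  by have [i [x ?]] := cov (lam w) (pt0 _) (pt0 _) (pt0 _); exists (i, x).
have [f fP] := choice H.
(* The end point [y = 1] has the index [K], whence [K + 1] cells on each side. *)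
have cellP (y : R) : 0 <= y <= 1 -> (Num.trunc (y * K%:R) < K.+1)%N.
  move=> /andP[y0 y1]; have y0K := mulr_ge0 y0 (ltW K0').
  have /andP[t1 _] := trunc_itv y0K.
  rewrite ltnS -(ler_nat R); apply: (le_trans t1).
  by rewrite ger_pMl.
pose cell w : 'I_3 * ('I_K.+1 * 'I_K.+1) := let: ix := f w in
  (ix.1, (inord (Num.trunc (ix.2.1 * K%:R)), inord (Num.trunc (ix.2.2 * K%:R)))).
have cell_inj : injective cell.
  move=> w w'; rewrite /cell.
  case: (f w) (fP w) => i x [/= x1 x2 b]; case: (f w') (fP w') => i' x' [/= x1' x2' b'].
  move=> [ii e1 e2]; rewrite -{i'}ii in b'.
  have {}e1 : Num.trunc (x.1 * K%:R) = Num.trunc (x'.1 * K%:R).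
    by move/(congr1 (@nat_of_ord _)): e1; rewrite !inordK // cellP.
  have {}e2 : Num.trunc (x.2 * K%:R) = Num.trunc (x'.2 * K%:R).
    by move/(congr1 (@nat_of_ord _)): e2; rewrite !inordK // cellP.
  have /andP[x10 _] := x1; have /andP[x20 _] := x2.
  have /andP[x10' _] := x1'; have /andP[x20' _] := x2'.
  have d : `|x - x'| < K%:R^-1.
    rewrite prod_normE gt_max; apply/andP.
    by split; apply: same_cell.
  have dl : `|lam w - lam w'| < e / k%:R.
    apply: (le_lt_trans (lip' _ _ _ _ _ b b')).
    apply: (@lt_trans _ _ (L' * K%:R^-1)); first by rewrite ltr_pM2l.
    have C0 : 0 < C%:R :> R by rewrite ltr0n.
    rewrite /K natrM invfM mulrA ltr_pM2r ?invr_gt0 // ltr_pdivrMr // mulrC.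
    by rewrite -ltr_pdivrMr.
  move: dl; rewrite !prod_normE !gt_max /= => /andP[/andP[d1 d2] d3].
  case: w w' {b b'} d1 d2 d3 => [[a1 a2] a3] [[b1 b2] b3] /=.
  by move=> /pt_inj -> /pt_inj -> /pt_inj ->.
have := leq_card _ cell_inj; rewrite !card_prod !card_ord.
suff : (3 * (K.+1 * K.+1) < k * k * k)%N by move=> h; rewrite leqNgt h.
have KC : (K.+1 <= (C + 1) * k)%N by rewrite /K mulnDl mul1n -addn1 leq_add2l.
apply: (@leq_ltn_trans (3 * (((C + 1) * k) * ((C + 1) * k)))).
  by rewrite leq_mul2l leq_mul.
have -> : (3 * ((C + 1) * k * ((C + 1) * k)) = 3 * (C + 1) ^ 2 * (k * k))%N by lia.
have -> : (k * k * k = k * (k * k))%N by lia.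
by rewrite ltn_pmul2r ?muln_gt0.
Qed.

End Pigeonhole.

(** * Local Lipschitz estimates in the plane *)

Section Lipschitz.
Context {R : realType}.
Local Notation eX := ((1, 0) : plane R).
Local Notation eY := ((0, 1) : plane R).

Lemma segment_norm_lt (a b s d : R) : 0 <= s <= 1 -> `|a| < d -> `|b| < d ->
  `|s * (a - b) + b| < d.
Proof.
move=> /andP[s0 s1]; rewrite !ltr_norml => /andP[a1 a2] /andP[b1 b2].
have t0 : 0 <= 1 - s by rewrite subr_ge0.
have [ab|/ltW ab] := leP a b.
  have ba : 0 <= b - a by rewrite subr_ge0.
  by have := mulr_ge0 s0 ba; have := mulr_ge0 t0 ba; move=> h1 h2; apply/andP; split; lra.
have ba : 0 <= a - b by rewrite subr_ge0.
by have := mulr_ge0 s0 ba; have := mulr_ge0 t0 ba; move=> h1 h2; apply/andP; split; lra.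
Qed.

Lemma smooth_lipschitz (f : plane R -> R) : smooth_germ 0 f ->
  exists2 M : R, 0 < M & exists2 d : R, 0 < d & forall z z', box d z -> box d z' ->
    `|f z - f z'| <= M * `|z - z'|.
Proof.
move=> fs.
have fXs : smooth_germ 0 ('D_eX f) by exact: smooth_germ_derive.
have fYs : smooth_germ 0 ('D_eY f) by exact: smooth_germ_derive.
have n1 : \forall z \near (0 : plane R), `|'D_eX f 0 - 'D_eX f z| < 1.
  by have /cvgrPdist_lt := smooth_germ_cont fXs; apply.
have n2 : \forall z \near (0 : plane R), `|'D_eY f 0 - 'D_eY f z| < 1.
  by have /cvgrPdist_lt := smooth_germ_cont fYs; apply.
have [d d0 dP] := (near_boxP _).1 (filterI (smooth_germ_near fs) (filterI n1 n2)).
pose A := `|'D_eX f 0| + 1; pose B := `|'D_eY f 0| + 1.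
have bound (x y : R) : `|x - y| < 1 -> `|y| <= `|x| + 1.
  move=> xy; have -> : y = x - (x - y) by ring.
  by apply: (le_trans (ler_normB _ _)); rewrite lerD2l ltW.
exists (A + B); first by rewrite addr_gt0 // ltr_pwDr.
exists d => // z z' bz bz'.
have bc (s : R) : 0 <= s <= 1 -> box d ((1 * s) *: (z - z') + z').
  by move=> s01; rewrite mul1r; case: bz bz' => z1 z2 [z1' z2']; split; exact: segment_norm_lt.
have [||s s01] := @MVT_ray _ _ f z' (z - z') 1 (fun s => 'D_(z - z') f (s *: (z - z') + z')).
- move=> s s01; apply: continuous_line.
  by have [fz _] := dP _ (bc s s01); exact: smooth_germ_cont.
- move=> s /andP[/ltW s0 /ltW s1]; have s01 : 0 <= s <= 1 by rewrite s0.
  by have [fz _] := dP _ (bc s s01); exact: smooth_germ_is_derive.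
rewrite scale1r subrK mul1r => ->.
have s01' : 0 <= s <= 1 by case/andP: s01 => /ltW -> /ltW ->.
have [fz [h1 h2]] := dP _ (bc s s01').
rewrite (derive_plane (z - z') (smooth_germ_diff fz)).
have b1 := bound _ _ h1; have b2 := bound _ _ h2.
apply: (le_trans (ler_normD _ _)).
have E (x y : R) : x *: y = x * y by [].
rewrite !E !normrM mulrDl [X in X + _ <= _]mulrC [X in _ + X <= _]mulrC.
by apply: lerD; apply: ler_pM => //; rewrite prod_normE le_max lexx ?orbT.
Qed.

End Lipschitz.

(** * The three-parameter deformation and its degenerate points *)

Section Unstable.
Context {R : realType}.
Local Notation eX := ((1, 0) : plane R).
Local Notation eY := ((0, 1) : plane R).
Local Notation P := 'rV[R]_3.
Local Notation V := (plane R * P)%type.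
Local Notation j0 := (@Ordinal 3 0 isT).
Local Notation j1 := (@Ordinal 3 1 isT).
Local Notation j2 := (@Ordinal 3 2 isT).

Variable c : plane R -> R.

Definition shifted_c (l : P) (z : plane R) : R :=
  c z + (l ord0 j0 + l ord0 j1 * z.1 + l ord0 j2 * z.2).

Definition shifted_prefold (w : V) : plane R := prefold (shifted_c w.2) w.1.

(** The [t] derivative of [prefold c] vanishes on the axis, which a tangential family forbids. After
    the shear both partial derivatives on the axis are [(1, 0)]. *)
Definition shear (z : plane R) : plane R := (z.1 + z.2, z.2).

Definition shifted_family (w : V) : plane R := shifted_prefold (shear w.1, w.2).

Lemma smooth_coord n (l : 'rV[R]_n) (i : 'I_n) :
  smooth_germ l (fun l : 'rV[R]_n => l ord0 i).
Proof.
have Llin : linear (fun l : 'rV[R]_n => l ord0 i) by move=> a u v; rewrite !mxE.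
pose LL : {linear 'rV[R]_n -> R} :=
  HB.pack (fun l : 'rV[R]_n => l ord0 i) (GRing.isLinear.Build _ _ _ _ _ Llin).
apply: (@smooth_germ_linear _ _ _ l LL) => x; exact: coord_continuous.
Qed.

Lemma shifted_c_smooth l z : smooth_germ z c -> smooth_germ z (shifted_c l).
Proof.
move=> cs; apply: smooth_germD => //; apply: smooth_germD; first apply: smooth_germD.
- exact: smooth_germ_cst.
- by apply: smooth_germM; [exact: smooth_germ_cst|exact: smooth_fst].
- by apply: smooth_germM; [exact: smooth_germ_cst|exact: smooth_snd].
Qed.

Lemma shear_smooth z : smooth_germ z shear.
Proof.
apply: smooth_germ_pair; last exact: smooth_snd.
by apply: smooth_germD; [exact: smooth_fst|exact: smooth_snd].
Qed.

Lemma shifted_family_smooth z l : smooth_germ (shear z) c ->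
  smooth_germ ((z, l) : V) shifted_family.
Proof.
move=> cs.
have s1 : smooth_germ ((z, l) : V) fst by exact: smooth_fst.
have s2 : smooth_germ ((z, l) : V) snd by exact: smooth_snd.
have a2 : smooth_germ ((z, l) : V) (fun w : V => w.1.2) by exact: smooth_germ_snd.
have a1 : smooth_germ ((z, l) : V) (fun w : V => w.1.1 + w.1.2).
  by apply: smooth_germD => //; exact: smooth_germ_fst.
have lc (i : 'I_3) : smooth_germ ((z, l) : V) (fun w : V => w.2 ord0 i).
  have H := smooth_coord l i.
  have Llin : linear (fun w : V => w.2 ord0 i) by move=> a u v; rewrite /= !mxE.
  pose LL : {linear V -> R} :=
    HB.pack (fun w : V => w.2 ord0 i) (GRing.isLinear.Build _ _ _ _ _ Llin).
  apply: (@smooth_germ_linear _ _ _ _ LL) => x.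
  apply: (continuous_comp (f := snd : V -> P) (g := fun l : P => l ord0 i)).
    exact: continuous_snd.
  exact: coord_continuous.
apply: smooth_germ_pair => //; apply: smooth_germM; first exact: smooth_germX.
apply: smooth_germD.
  apply: (smooth_germ_comp (g := fun w : V => (w.1.1 + w.1.2, w.1.2) : plane R)) => //.
    exact: has_coords_plane.
  exact: smooth_germ_pair.
by apply: smooth_germD; [apply: smooth_germD => //|]; exact: smooth_germM.
Qed.

Lemma box_shear (r : R) z : box r z -> box (2 * r) (shear z).
Proof.
move=> [z1 z2]; have r0 : 0 < r by exact: le_lt_trans z1.
by split => /=; [apply: (le_lt_trans (ler_normD _ _))|]; lra.
Qed.

Lemma derive_shifted_family l z v : smooth_germ (shear z) c ->
  ('D_v (fun z => shifted_family (z, l)) z).1 = v.1 + v.2 /\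
  (z.2 = 0 -> ('D_v (fun z => shifted_family (z, l)) z).2 = 0).
Proof.
move=> cs.
pose k (z : plane R) := shifted_c l (shear z).
have ks : smooth_germ z k.
  apply: (smooth_germ_comp (g := shear)); first exact: has_coords_plane.
    exact: shear_smooth.
  exact: shifted_c_smooth.
have E : (fun z => shifted_family (z, l)) = fun z => (z.1 + z.2, z.2 * (z.2 * k z)).
  by apply/funext => w; rewrite /shifted_family /shifted_prefold /prefold /= expr2 mulrA.
have s1 : smooth_germ z (fun z : plane R => z.2 * k z).
  by apply: smooth_germM ks; exact: smooth_snd.
have s2 : smooth_germ z (fun z : plane R => z.2 * (z.2 * k z)).
  by apply: smooth_germM s1; exact: smooth_snd.
have s3 : smooth_germ z (fun z : plane R => z.1 + z.2).
  by apply: smooth_germD; [exact: smooth_fst|exact: smooth_snd].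
rewrite E (derive_pair v (smooth_germ_diff s3) (smooth_germ_diff s2)) /=; split.
  rewrite deriveD_smooth; last 2 first.
  - exact: smooth_germ_diff (smooth_fst _).
  - exact: smooth_germ_diff (smooth_snd _).
  rewrite (derive_linear (L := fst)); last by move=> y; exact: cvg_fst.
  by rewrite (derive_linear (L := snd)) //; move=> y; exact: cvg_snd.
move=> t0; rewrite (derive_plane v (smooth_germ_diff s2)).
have EX := derive_mulX s1; have EY := derive_mulY s1.
rewrite t0 mul0r in EX; rewrite t0 !mul0r addr0 in EY.
apply: etrans (congr2 (fun s t : R => v.1 *: s + v.2 *: t) EX EY) _.
by rewrite !scaler0 addr0.
Qed.

Lemma shifted_tangential (r : R) (l : P) : 0 < r ->
  (forall z, box (2 * r) z -> smooth_germ z c) ->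
  tangential_on r (fun z => shifted_family (z, l)).
Proof.
move=> r0 cs.
have cs' z : box r z -> smooth_germ (shear z) c by move/box_shear/cs.
have ax x : `|x| < r -> smooth_germ (shear (x, 0)) c.
  by move=> xr; apply: cs'; split; rewrite /= ?normr0.
have nz (u : plane R) : u.1 = 1 -> u != 0.
  by move=> u1; apply/eqP => u0; move/eqP: u1; rewrite u0 eq_sym oner_eq0.
split.
- apply: ((smooth_onP _ (@open_box R r)).2) => z bz.
  by apply: smooth_slice; exact: shifted_family_smooth (cs' z bz).
- move=> z bz; have [+ _] := derive_shifted_family l eY (cs' z bz).
  by rewrite add0r; exact: nz.
- move=> x xr.
  have [X1 X2] := derive_shifted_family l eX (ax x xr).
  have [Y1 Y2] := derive_shifted_family l eY (ax x xr).
  have {}X2 := X2 (erefl _); have {}Y2 := Y2 (erefl _).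
  rewrite addr0 in X1; rewrite add0r in Y1.
  split; [exact: nz X1|exact: nz Y1|exists 1].
  rewrite scale1r; exact: injective_projections (etrans X1 (esym Y1)) (etrans X2 (esym Y2)).
- exists fst; split; first by move=> x _; rewrite /= addr0.
  by apply: continuous_subspaceT => x; exact: continuous_fst.
Qed.

Lemma shifted_family0 z : shifted_family (z, 0) = prefold c (shear z).
Proof.
rewrite /shifted_family /shifted_prefold /prefold /=; congr (_, _ * _).
by rewrite /shifted_c /= !mxE !mul0r !addr0.
Qed.

Lemma shear_diffeo : diffeo_germ shear (fun z : plane R => (z.1 - z.2, z.2)).
Proof.
split.
- exact: shear_smooth.
- apply: smooth_germ_pair; last exact: smooth_snd.
  by apply: smooth_germB; [exact: smooth_fst|exact: smooth_snd].
- by rewrite /shear /= addr0.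
- by rewrite /= subr0.
- by split; apply: near_all => z; rewrite /shear /= ?addrK ?subrK -surjective_pairing.
Qed.

Lemma shifted_tangential_germ : smooth_germ 0 c ->
  exists2 r : R, 0 < r & (forall z, box (2 * r) z -> smooth_germ z c) /\
    forall l, tangential_on r (fun z => shifted_family (z, l)).
Proof.
move=> cs; have [d d0 dP] := (near_boxP _).1 (smooth_germ_near cs).
have r0 : 0 < d / 2 by rewrite divr_gt0.
have rP z : box (2 * (d / 2)) z -> smooth_germ z c by rewrite mulrC divfK //; exact: dP.
by exists (d / 2) => //; split=> // l; exact: shifted_tangential.
Qed.

Lemma shear_tangential : smooth_germ 0 c ->
  tangential_family_germ (fun z => prefold c (shear z)).
Proof.
move=> /shifted_tangential_germ[r r0 [_ T]].
split; first by rewrite /shear /= addr0; exact: prefold0.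
by exists r => //; under eq_fun do rewrite -shifted_family0; exact: T.
Qed.

Lemma shifted_deformation : smooth_germ 0 c ->
  tangential_deformation (prefold c) shifted_prefold.
Proof.
move=> cs; have [r r0 [rP T]] := shifted_tangential_germ cs.
exists (fun z => prefold c (shear z)), shear, (fun z => (z.1 - z.2, z.2)), id, id, shifted_family.
split.
- exact: shear_tangential.
- by split; [exact: shear_diffeo|exact: diffeo_germ_id].
- by apply: near_all => z; rewrite /shear /= subrK -surjective_pairing.
- exists r, 1; split => //.
  + apply: ((smooth_onP _ (@open_domain R 3 r 1)).2) => -[z l] [/= bz _].
    by apply: shifted_family_smooth; apply: rP; exact: box_shear.
  + by apply: near_all => z; exact: shifted_family0.
- apply: near_all => -[z l]; rewrite /shifted_family /shear /= subrK.
  by rewrite -surjective_pairing.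
Qed.

Lemma smooth_affine (a b d : R) z :
  smooth_germ z (fun z : plane R => a + b * z.1 + d * z.2).
Proof.
apply: smooth_germD; first apply: smooth_germD.
- exact: smooth_germ_cst.
- by apply: smooth_germM; [exact: smooth_germ_cst|exact: smooth_fst].
- by apply: smooth_germM; [exact: smooth_germ_cst|exact: smooth_snd].
Qed.

Lemma derive_affine (a b d : R) (z v : plane R) :
  'D_v (fun z : plane R => a + b * z.1 + d * z.2) z = b * v.1 + d * v.2.
Proof.
have E1 : smooth_germ z (fun z : plane R => b * z.1).
  by apply: smooth_germM; [exact: smooth_germ_cst|exact: smooth_fst].
have E2 : smooth_germ z (fun z : plane R => d * z.2).
  by apply: smooth_germM; [exact: smooth_germ_cst|exact: smooth_snd].
have E3 : smooth_germ z (fun z : plane R => a + b * z.1).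
  by apply: smooth_germD E1; exact: smooth_germ_cst.
have E0 : smooth_germ z (fun _ : plane R => a) by exact: smooth_germ_cst.
rewrite (deriveD_smooth v (smooth_germ_diff E3) (smooth_germ_diff E2)).
rewrite (deriveD_smooth v (smooth_germ_diff E0) (smooth_germ_diff E1)).
rewrite derive_cst add0r.
rewrite (deriveM_smooth v (smooth_germ_diff (smooth_germ_cst z b)) (smooth_germ_diff (smooth_fst z))).
rewrite (deriveM_smooth v (smooth_germ_diff (smooth_germ_cst z d)) (smooth_germ_diff (smooth_snd z))).
rewrite !derive_cst !mulr0 !addr0 (derive_linear (L := fst)); last by move=> y; exact: cvg_fst.
by rewrite (derive_linear (L := snd)) //; move=> y; exact: cvg_snd.
Qed.

(** [m] is linear in [c] and sends [1], [u], [t] to [2], [2 u], [3 t]; the three parameters thus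
    move the value and both derivatives of [m] at a point freely. *)
Lemma shifted_m l z : smooth_germ z c -> prefold_m (shifted_c l) z =
  prefold_m c z + (2 * l ord0 j0 + 2 * l ord0 j1 * z.1 + 3 * l ord0 j2 * z.2).
Proof.
move=> cs; rewrite /prefold_m.
have E := deriveD_smooth eY (smooth_germ_diff cs)
  (smooth_germ_diff (smooth_affine (l ord0 j0) (l ord0 j1) (l ord0 j2) z)).
rewrite derive_affine /= mulr0 add0r mulr1 in E.
rewrite /shifted_c E.
by move: ('D_eY c z) => y; ring.
Qed.

Lemma derive_shifted_m l z v : smooth_germ z c -> 'D_v (prefold_m (shifted_c l)) z =
  'D_v (prefold_m c) z + (2 * l ord0 j1 * v.1 + 3 * l ord0 j2 * v.2).
Proof.
move=> cs.
have n : \forall w \near z, prefold_m (shifted_c l) w = prefold_m c w +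
    (2 * l ord0 j0 + 2 * l ord0 j1 * w.1 + 3 * l ord0 j2 * w.2).
  by apply: filterS (smooth_germ_near cs) => w; exact: shifted_m.
rewrite (near_eq_derive v n) -(derive_affine (2 * l ord0 j0) _ _ z).
exact (deriveD_smooth v (smooth_germ_diff (prefold_m_smooth cs))
  (smooth_germ_diff (smooth_affine _ _ _ z))).
Qed.

(* The three ways in which [shifted_prefold] can fail to have a fold or beaks
   singularity at [q]: off the support, on the support with a degenerate Hessian,
   on the support with an isotropic kernel. *)
Definition degenerate (i : 'I_3) (x : plane R) (l : (R * R * R)%type) : Prop :=
  let M := prefold_m c in
  match val i with
  | 0%N => [/\ M x + (2 * l.1.1 + 2 * l.1.2 * x.1 + 3 * l.2 * x.2) = 0,
          'D_eX M x + 2 * l.1.2 = 0 & 'D_eY M x + 3 * l.2 = 0]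
  | 1%N => [/\ M (x.1, 0) + (2 * l.1.1 + 2 * l.1.2 * x.1) = 0,
          'D_eX M (x.1, 0) + 2 * l.1.2 = 0 & l.2 = x.2]
  | _ => [/\ M (x.1, 0) + (2 * l.1.1 + 2 * l.1.2 * x.1) = 0,
          l.1.2 = x.2 & 'D_eY M (x.1, 0) + 3 * l.2 = 0]
  end.

Lemma degenerate_witness (l : P) (q : plane R) : smooth_germ q c ->
  critical (prefold (shifted_c l)) q -> ~ beaks (prefold (shifted_c l)) q ->
  exists (i : 'I_3) (x : plane R), degenerate i x (l ord0 j0, l ord0 j1, l ord0 j2) /\
    (x.1 = q.1 /\ (x.2 = q.2 \/ x.2 = l ord0 j1 \/ x.2 = l ord0 j2)).
Proof.
move=> cs C B.
have [m0 X0 Y0] := (critical_prefold (shifted_c_smooth l cs)).1 C.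
have mE := shifted_m l cs.
have mX := derive_shifted_m l eX cs; have mY := derive_shifted_m l eY cs.
rewrite /= mulr0 addr0 mulr1 in mX; rewrite /= mulr0 add0r mulr1 in mY.
have cancel (t x y : R) : t != 0 -> x = y -> t * x = 0 -> y = 0.
  by move=> tn -> /eqP; rewrite mulf_eq0 (negbTE tn) => /eqP.
have [t0|t0] := eqVneq q.2 0; last first.
  exists j0, q; split; last by split; [|left].
  split; first exact (etrans (esym mE) m0).
    exact (cancel _ _ _ t0 mX X0).
  exact (cancel _ _ _ t0 mY Y0).
have qE : q = (q.1, 0) by apply: injective_projections.
have m0' : prefold_m c (q.1, 0) + (2 * l ord0 j0 + 2 * l ord0 j1 * q.1) = 0.
  by move: m0; rewrite mE t0 mulr0 addr0 {1}qE.
have [X1|X1] := eqVneq ('D_eX (prefold_m (shifted_c l)) q) 0.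
  exists j1, (q.1, l ord0 j2); split; last by split; [|right; right].
  split; [exact m0'| |exact (erefl _)].
  by rewrite -[(_, 0)]qE; exact (etrans (esym mX) X1).
have [Y1|Y1] := eqVneq ('D_eY (prefold_m (shifted_c l)) q) 0.
  exists j2, (q.1, l ord0 j1); split; last by split; [|right; left].
  split; [exact m0'|exact (erefl _)|].
  by rewrite -[(_, 0)]qE; exact (etrans (esym mY) Y1).
exfalso; apply: B.
exact ((beaks_prefold (shifted_c_smooth l cs) t0).2 (And3 m0 X1 Y1)).
Qed.

End Unstable.

(** * The degenerate parameters form a thin set *)

Section Instability.
Context {R : realType}.
Local Notation eX := ((1, 0) : plane R).
Local Notation eY := ((0, 1) : plane R).
Local Notation P := 'rV[R]_3.
Local Notation j0 := (@Ordinal 3 0 isT).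
Local Notation j1 := (@Ordinal 3 1 isT).
Local Notation j2 := (@Ordinal 3 2 isT).

(** Subtracting the two equations expresses [2 (l0 - l0')] by terms of total size at most [M d + 2
    (d + M d) + 3 (d + M d) = (6 M + 5) d]. *)
Lemma affine_lipschitz (A A' l0 l1 l2 l0' l1' l2' q1 q2 q1' q2' M d : R) :
  0 <= M -> 0 <= d ->
  A + (2 * l0 + 2 * l1 * q1 + 3 * l2 * q2) = 0 ->
  A' + (2 * l0' + 2 * l1' * q1' + 3 * l2' * q2') = 0 ->
  `|A - A'| <= M * d -> `|q1 - q1'| <= d -> `|q2 - q2'| <= d ->
  `|l1 - l1'| <= M * d -> `|l2 - l2'| <= M * d ->
  `|l1| <= 1 -> `|l2| <= 1 -> `|q1'| <= 1 -> `|q2'| <= 1 ->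
  `|l0 - l0'| <= (6 * M + 5) * d.
Proof.
move=> M0 d0 E E' HA H1 H2 L1 L2 n1 n2 m1 m2.
have Md : 0 <= M * d by exact: mulr_ge0.
have E2 : 2 * (l0 - l0') = - (A - A') - 2 * (l1 * (q1 - q1') + (l1 - l1') * q1')
    - 3 * (l2 * (q2 - q2') + (l2 - l2') * q2').
  have -> : - (A - A') - 2 * (l1 * (q1 - q1') + (l1 - l1') * q1')
    - 3 * (l2 * (q2 - q2') + (l2 - l2') * q2') = 2 * (l0 - l0')
    - (A + (2 * l0 + 2 * l1 * q1 + 3 * l2 * q2))
    + (A' + (2 * l0' + 2 * l1' * q1' + 3 * l2' * q2')) by ring.
  by rewrite E E' subr0 addr0.
have prod (x y b : R) : `|x| <= 1 -> `|y| <= b -> `|x * y| <= b.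
  move=> x1 yb; rewrite normrM -[leRHS]mul1r; apply: ler_pM => //.
have P1 := prod _ _ _ n1 H1; have P2 := prod _ _ _ n2 H2.
have P3 : `|(l1 - l1') * q1'| <= M * d by rewrite mulrC; exact: prod.
have P4 : `|(l2 - l2') * q2'| <= M * d by rewrite mulrC; exact: prod.
have -> : (6 * M + 5) * d = 6 * (M * d) + 5 * d by ring.
move: HA P1 P2 P3 P4 E2.
move: (A - A') (l1 * _) (l2 * _) ((l1 - l1') * _) ((l2 - l2') * _) (l0 - l0').
move: (M * d) Md => z z0 {E E' H1 H2 L1 L2 n1 n2 m1 m2 prod} a b e f g h.
rewrite !ler_norml.
move=> /andP[a1 a2] /andP[b1 b2] /andP[e1 e2] /andP[f1 f2] /andP[g1 g2] E.
by apply/andP; split; lra.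
Qed.

(** The equations are triangular in [l]: each of [l1], [l2] is given by a derivative of [m] or is a
    coordinate of [x], and the equation for [m] then gives [l0]. So [l] is a Lipschitz function of
    [x]. *)
Lemma degenerate_lipschitz (c : plane R -> R) : smooth_germ 0 c ->
  exists (d L : R), 0 < d /\ forall i x x' l l', box d x -> box d x' ->
    [/\ `|l.1.2| <= 1, `|l.2| <= 1, `|l'.1.2| <= 1 & `|l'.2| <= 1] ->
    degenerate c i x l -> degenerate c i x' l' -> `|l - l'| <= L * `|x - x'|.
Proof.
move=> cs; have ms := prefold_m_smooth cs.
have [M1 M10 [d1 d10 P1]] := smooth_lipschitz ms.
have [M2 M20 [d2 d20 P2]] := smooth_lipschitz (smooth_germ_derive eX ms).
have [M3 M30 [d3 d30 P3]] := smooth_lipschitz (smooth_germ_derive eY ms).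
(* The summand 1 covers the cases in which an entry of [l] is a coordinate of [x]. *)
pose M := M1 + M2 + M3 + 1.
have M0 : 0 <= M by rewrite /M; lra.
have M1M : M1 <= M by rewrite /M; lra.
have M2M : M2 <= M by rewrite /M; lra.
have M3M : M3 <= M by rewrite /M; lra.
have oM : 1 <= M by rewrite /M; lra.
pose d := Num.min 1 (Num.min d1 (Num.min d2 d3)).
exists d, (6 * M + 5); split; first by rewrite !lt_min ltr01 d10 d20 d30.
have sub r x : d <= r -> box d x -> box r x.
  by move=> dr [x1 x2]; split; exact: lt_le_trans dr.
have le1 : d <= 1 by rewrite /d ge_min lexx.
have b1 x : box d x -> box d1 x by apply: sub; rewrite /d !ge_min lexx ?orbT.
have b2 x : box d x -> box d2 x by apply: sub; rewrite /d !ge_min lexx ?orbT.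
have b3 x : box d x -> box d3 x by apply: sub; rewrite /d !ge_min lexx ?orbT.
have wk (m : R) (y : R) : m <= M -> 0 <= y -> m * y <= M * y by move=> mM y0; rewrite ler_wpM2r.
have key q q' (l l' : (R * R * R)%type) (y : R) : box d q -> box d q' ->
    [/\ `|l.1.2| <= 1, `|l.2| <= 1, `|l'.1.2| <= 1 & `|l'.2| <= 1] ->
    prefold_m c q + (2 * l.1.1 + 2 * l.1.2 * q.1 + 3 * l.2 * q.2) = 0 ->
    prefold_m c q' + (2 * l'.1.1 + 2 * l'.1.2 * q'.1 + 3 * l'.2 * q'.2) = 0 ->
    `|q - q'| <= y -> `|l.1.2 - l'.1.2| <= M * y -> `|l.2 - l'.2| <= M * y ->
    `|l - l'| <= (6 * M + 5) * y.
  move=> bq bq' [n1 n2 n1' n2'] E E' qy h1 h2.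
  have y0 : 0 <= y by exact: le_trans qy.
  have qq := qy; rewrite prod_normE ge_max /= in qq; case/andP: qq => qq1 qq2.
  have MY : M * y <= (6 * M + 5) * y by rewrite ler_wpM2r //; lra.
  have hA : `|prefold_m c q - prefold_m c q'| <= M * y.
    apply: (le_trans (P1 _ _ (b1 _ bq) (b1 _ bq'))).
    by apply: ler_pM => //; exact: ltW.
  have [q1' q2'] := bq'.
  have h0 := affine_lipschitz M0 y0 E E' hA qq1 qq2 h1 h2 n1 n2
    (ltW (lt_le_trans q1' le1)) (ltW (lt_le_trans q2' le1)).
  rewrite !prod_normE !ge_max /= h0 /=.
  by rewrite (le_trans h1 MY) (le_trans h2 MY).
have half (a b l l' m k y : R) : a + k * l = 0 -> b + k * l' = 0 -> 1 <= k ->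
    `|a - b| <= m * y -> `|l - l'| <= m * y.
  move=> E E' k1 ab; have k0 : 0 < k by exact: lt_le_trans k1.
  apply: le_trans ab.
  have -> : a - b = - (k * (l - l')).
    have -> : a - b = (a + k * l) - (b + k * l') - k * (l - l') by ring.
    by rewrite E E' subrr sub0r.
  by rewrite normrN normrM (gtr0_norm k0) ler_peMl.
have k2 : 1 <= 2 :> R by rewrite ler1n.
have k3 : 1 <= 3 :> R by rewrite ler1n.
have ax x : box d x -> box d (x.1, 0).
  by move=> [x1 x2]; split => //=; rewrite normr0 (le_lt_trans _ x2).
have axn (x x' : plane R) : `|((x.1, 0) : plane R) - (x'.1, 0)| <= `|x - x'|.
  by rewrite !prod_normE /= subrr normr0 ge_max le_max lexx /= le_max normr_ge0.
have nsnd (x x' : plane R) : `|x.2 - x'.2| <= M * `|x - x'|.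
  apply: (@le_trans _ _ `|x - x'|); first by rewrite prod_normE le_max lexx orbT.
  by rewrite ler_peMl.
move=> i x x' l l' bx bx' n.
case: i => -[|[|[|//]]] /= i3.
- move=> [E1 E2 E3] [E1' E2' E3']; apply: (key x x') => //.
    apply: (half _ _ _ _ _ _ _ E2 E2' k2).
    by apply: (le_trans (P2 _ _ (b2 _ bx) (b2 _ bx'))); exact: wk.
  apply: (half _ _ _ _ _ _ _ E3 E3' k3).
  by apply: (le_trans (P3 _ _ (b3 _ bx) (b3 _ bx'))); exact: wk.
- move=> [E1 E2 E3] [E1' E2' E3']; apply: (key (x.1, 0) (x'.1, 0)) => //.
  + exact: ax.
  + exact: ax.
  + by rewrite /= mulr0 addr0.
  + by rewrite /= mulr0 addr0.
  + apply: (half _ _ _ _ _ _ _ E2 E2' k2).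
    apply: (le_trans (P2 _ _ (b2 _ (ax _ bx)) (b2 _ (ax _ bx')))).
    by apply: ler_pM => //; exact: ltW.
  + by rewrite E3 E3'.
- move=> [E1 E2 E3] [E1' E2' E3']; apply: (key (x.1, 0) (x'.1, 0)) => //.
  + exact: ax.
  + exact: ax.
  + by rewrite /= mulr0 addr0.
  + by rewrite /= mulr0 addr0.
  + by rewrite E2 E2'.
  + apply: (half _ _ _ _ _ _ _ E3 E3' k3).
    apply: (le_trans (P3 _ _ (b3 _ (ax _ bx)) (b3 _ (ax _ bx')))).
    by apply: ler_pM => //; exact: ltW.
Qed.

(** Stability would give, for every small [l], a point near the origin where the deformed germ is
    equivalent to [prefold c], hence critical and not [beaks]. All [l] in a small cube would then be
    degenerate, against the covering bound. *)
Lemma unstable_prefold (c : plane R -> R) (S : set (plane R -> plane R)) :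
  smooth_germ 0 c -> c 0 = 0 -> ~ beaks (prefold c) 0 -> S (prefold c) -> ~ stable S.
Proof.
move=> cs c0 nB Sc stS.
have [d [L [d0 lip]]] := degenerate_lipschitz cs.
have [d' d'0 dP] := (near_boxP _).1 (smooth_germ_near cs).
pose r := Num.min 1 (Num.min d d').
have r0 : 0 < r by rewrite !lt_min ltr01 d0 d'0.
have r1 : r <= 1 by rewrite /r !ge_min lexx ?orbT.
have rd : r <= d by rewrite /r !ge_min lexx ?orbT.
have rd' : r <= d' by rewrite /r !ge_min lexx ?orbT.
have Ur : nbhs (0 : plane R) (box r).
  by apply: open_nbhs_nbhs; split; [exact: open_box|split; rewrite /= normr0].
have [e e0 eP] := (nbhs_normP _ _).1
  (stS _ Sc 3%N (@shifted_prefold R c) (shifted_deformation cs) _ Ur).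
have cC : critical (prefold c) 0 := (critical_prefold0 cs).2 c0.
pose t := Num.min e r / 2.
have m0 : 0 < Num.min e r by rewrite lt_min e0 r0.
have t0 : 0 < t by rewrite divr_gt0.
have : t < Num.min e r by rewrite /t ltr_pdivrMr // ltr_pMr // ltr1n.
rewrite lt_min => /andP[te tr].
(* The unit square of the covering bound is rescaled to the square of points with coordinates in
   [[-1, 1]], which contains [box r] as [r <= 1]; this doubles the Lipschitz constant. *)
pose B i (y : plane R) (l : (R * R * R)%type) :=
  let x := (2 * y.1 - 1, 2 * y.2 - 1) in
  [/\ degenerate c i x l, box d x, `|l.1.2| <= 1 & `|l.2| <= 1].
apply: (@lipschitz_images_not_cube R B t (`|L| * 2) t0) => [i y y' l l'|l l1 l2 l3].
  move=> [D b h1 h2] [D' b' h1' h2'].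
  apply: (le_trans (lip _ _ _ _ _ b b' (And4 h1 h2 h1' h2') D D')).
  set n := `|_ - _ : plane R|; set n' := `|_ - _ : plane R|.
  have -> : n = 2 * n'.
    rewrite /n /n' !prod_normE /= maxr_pMr //.
    have E (u v : R) : `|2 * u - 1 - (2 * v - 1)| = 2 * `|u - v|.
      by rewrite opprB addrA subrK -mulrBr normrM ger0_norm.
    by rewrite !E.
  by rewrite -mulrA; apply: ler_wpM2r;
    [by apply: mulr_ge0; [exact: ler0n|exact: normr_ge0]|exact: ler_norm].
pose w : P := \row_(i < 3) nth 0 [:: l.1.1; l.1.2; l.2] i.
have w0 : w ord0 j0 = l.1.1 by rewrite mxE.
have w1 : w ord0 j1 = l.1.2 by rewrite mxE.
have w2 : w ord0 j2 = l.2 by rewrite mxE.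
have tn (x : R) : 0 <= x <= t -> `|x| < Num.min e r.
  by move=> /andP[x0 xt]; rewrite ger0_norm // lt_min !(le_lt_trans xt).
have wn : `|w| < e.
  rewrite /Num.norm /= mx_normrE; apply: bigmax_lt => // -[a [b b3]] _ /=.
  rewrite mxE; case: b b3 => [|[|[|//]]] _ /=.
  - by have := tn _ l1; rewrite lt_min => /andP[].
  - by have := tn _ l2; rewrite lt_min => /andP[].
  - by have := tn _ l3; rewrite lt_min => /andP[].
have [|q bq qA] := eP w; first by rewrite /= sub0r normrN.
have bqd' : box d' q by case: bq => q1 q2; split; exact: lt_le_trans rd'.
have cq := dP _ bqd'.
have gC : critical (prefold (shifted_c c w)) q.
  apply: (critical_germ_at (prefold (shifted_c c w)) q).1.
  exact (A_equiv_critical (prefold_smooth cs) (prefold0 c) qA cC).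
have gB : ~ beaks (prefold (shifted_c c w)) q.
  move=> Bq; apply: nB.
  have Bq0 := (beaks_germ_at (prefold (shifted_c c w)) q).2 Bq.
  have Aq := A_equiv_sym_smooth (prefold_smooth cs) (prefold0 c) qA.
  have gs := germ_at_smooth (prefold_smooth (shifted_c_smooth w cq)).
  exact (A_equiv_beaks gs (germ_at0 _ _) Aq Bq0).
have [i [x [Dx [x1 x2]]]] := degenerate_witness cq gC gB.
rewrite w0 w1 w2 in Dx x2; rewrite -!surjective_pairing in Dx.
have [q1 q2] := bq.
have lr (y : R) : 0 <= y <= t -> `|y| < r.
  by move/tn; rewrite lt_min => /andP[].
have bx1 : `|x.1| < r by rewrite x1.
have bx2 : `|x.2| < r by case: x2 => [->//|[->|->]]; exact: lr.
have bnd (y : R) : `|y| < r -> 0 <= (y + 1) / 2 <= 1.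
  move=> yr; have := lt_le_trans yr r1; rewrite ltr_norml => /andP[y1 y2].
  by clear -y1 y2; apply/andP; split; lra.
exists i, ((x.1 + 1) / 2, (x.2 + 1) / 2); split; [exact: bnd|exact: bnd|].
have E (y : R) : 2 * ((y + 1) / 2) - 1 = y by field.
rewrite /B /= !E -surjective_pairing; split => //.
- by split; exact: lt_le_trans rd.
- by apply: ltW; exact: lt_le_trans (lr _ l2) r1.
- by apply: ltW; exact: lt_le_trans (lr _ l3) r1.
Qed.

End Instability.

(** * Extended codimension *)

Section Codimension.
Context {R : realType}.
Implicit Types f g h u v phi psi : plane R -> plane R.

Local Notation eX := ((1, 0) : plane R).
Local Notation eY := ((0, 1) : plane R).

Lemma near_and (x : plane R) (P Q : plane R -> Prop) :
  (\forall z \near x, P z) -> (\forall z \near x, Q z) ->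
  \forall z \near x, P z /\ Q z.
Proof. exact: filterI. Qed.

Lemma ext_tangentP f h : smooth_germ 0 f -> ext_tangent f h <->
  exists v u, [/\ smooth_germ 0 v, smooth_germ 0 u &
    \forall z \near (0 : plane R), h z = 'D_(v z) f z + u (f z)].
Proof.
move=> fs; have fn := smooth_germ_near fs; split.
  move=> [a [b [u [as_ bs us E]]]].
  exists (fun z => (a z, b z)), u; split => //; first exact: smooth_germ_pair.
  apply: filterS2 E fn => z E fz; rewrite E.
  by rewrite (derive_plane _ (smooth_germ_diff fz)).
move=> [v [u [vs us E]]].
exists (fun z => (v z).1), (fun z => (v z).2), u.
split => //; [exact: smooth_germ_fst|exact: smooth_germ_snd|].
apply: filterS2 E fn => z E fz; rewrite E.
by rewrite (derive_plane _ (smooth_germ_diff fz)).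
Qed.

Lemma ext_tangent_near f h h' : (\forall z \near (0 : plane R), h z = h' z) ->
  ext_tangent f h -> ext_tangent f h'.
Proof.
move=> hh [a [b [u [as_ bs us E]]]]; exists a, b, u; split => //.
by apply: filterS2 hh E => z <-.
Qed.

Lemma smooth_directional f g v : smooth_germ 0 v -> smooth_germ 0 g -> g 0 = 0 ->
  smooth_germ 0 f -> smooth_germ 0 (fun z => 'D_(v z) f (g z)).
Proof.
move=> vs gs g0 fs.
have s w : smooth_germ 0 (fun z => 'D_w f (g z)).
  apply: (smooth_germ_comp (f := 'D_w f) has_coords_plane gs); rewrite g0.
  exact: smooth_germ_derive.
have S : smooth_germ 0 (fun z => (v z).1 *: 'D_eX f (g z) + (v z).2 *: 'D_eY f (g z)).
  by apply: smooth_germD; apply: smooth_germZ;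
    [exact: smooth_germ_fst|exact: s|exact: smooth_germ_snd|exact: s].
apply: smooth_germ_ext S.
have n := near_comp0 gs g0 (smooth_germ_near fs).
by apply: filterS n => z fz; symmetry; rewrite (derive_plane _ (smooth_germ_diff fz)).
Qed.

(* The vector field [h] along [g] is carried to one along [psi \o g \o phi']. *)
Definition pushforward phi' psi g h (z : plane R) : plane R :=
  'D_(h (phi' z)) psi (g (phi' z)).

Lemma pushforward_smooth phi' psi g h : smooth_germ 0 phi' -> phi' 0 = 0 ->
  smooth_germ 0 psi -> smooth_germ 0 g -> g 0 = 0 -> smooth_germ 0 h ->
  smooth_germ 0 (pushforward phi' psi g h).
Proof.
move=> ps p0 qs gs g0 hs; apply: smooth_directional => //.
- by apply: (smooth_germ_comp (f := h) has_coords_plane ps); rewrite p0.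
- by apply: (smooth_germ_comp (f := g) has_coords_plane ps); rewrite p0.
- by rewrite p0.
Qed.

Lemma pushforward_sum phi' psi g d (e : 'I_d -> plane R -> plane R) (c : 'I_d -> R) :
  smooth_germ 0 phi' -> phi' 0 = 0 -> smooth_germ 0 psi -> smooth_germ 0 g ->
  g 0 = 0 -> \forall z \near (0 : plane R),
  pushforward phi' psi g (fun w => \sum_i c i *: e i w) z =
    \sum_i c i *: pushforward phi' psi g (e i) z /\
  forall h, pushforward phi' psi g (fun w => h w - \sum_i c i *: e i w) z =
    pushforward phi' psi g h z - \sum_i c i *: pushforward phi' psi g (e i) z.
Proof.
move=> ps p0 qs gs g0.
have n := near_comp0 ps p0 (near_comp0 gs g0 (smooth_germ_near qs)).
apply: filterS n => z qz; have dq := smooth_germ_diff qz.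
have S : pushforward phi' psi g (fun w => \sum_i c i *: e i w) z =
    \sum_i c i *: pushforward phi' psi g (e i) z.
  rewrite /pushforward deriveE // linear_sum.
  by apply: eq_bigr => i _; rewrite linearZ -deriveE.
split=> // h; rewrite -S /pushforward.
by rewrite !deriveE // linearB.
Qed.

Lemma derive_id_near psi (x w : plane R) : (\forall y \near x, psi y = y) ->
  'D_w psi x = w.
Proof. by move=> E; rewrite (near_eq_derive _ E) derive_id. Qed.

Lemma derive_inverse phi phi' (x w : plane R) : smooth_germ x phi -> smooth_germ (phi x) phi' ->
  (\forall y \near x, phi' (phi y) = y) -> 'D_('D_w phi x) phi' (phi x) = w.
Proof.
move=> ps ps' E.
have H := derive_comp w (smooth_germ_diff ps) (smooth_germ_diff ps').
by rewrite -H; exact: derive_id_near.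
Qed.

Lemma pushforwardK phi phi' psi psi' f g h :
  diffeo_germ phi phi' -> diffeo_germ psi psi' -> smooth_germ 0 g -> g 0 = 0 ->
  (\forall z \near (0 : plane R), f z = psi (g (phi' z))) ->
  \forall z \near (0 : plane R),
    pushforward phi psi' f (pushforward phi' psi g h) z = h z.
Proof.
move=> [ps ps' p0 p0' [pK pK']] [qs qs' q0 q0' [qK qK']] gs g0 E.
have n1 := near_comp0 ps p0 E.
have n2 := near_comp0 gs g0 (smooth_germ_near qs).
have n3 := near_comp0 gs g0 (near_comp0 qs q0 (smooth_germ_near qs')).
have n4 := near_comp0 gs g0 (near_near qK).
have n12 := near_and n1 n2.
have n34 := near_and n3 n4.
apply: filterS3 n12 n34 pK => z [E1 s] [s' K] e.
rewrite /pushforward E1 e; exact: derive_inverse.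
Qed.

(** Differentiate [f \o phi = psi \o g]: the source field [v] is pushed forward by [phi] and the
    target field [u] by [psi]. *)
Lemma pushforward_tangent phi phi' psi psi' f g h :
  diffeo_germ phi phi' -> diffeo_germ psi psi' -> smooth_germ 0 g -> g 0 = 0 ->
  smooth_germ 0 f ->
  (\forall z \near (0 : plane R), f z = psi (g (phi' z))) ->
  ext_tangent g h -> ext_tangent f (pushforward phi' psi g h).
Proof.
move=> [ps ps' p0 p0' [pK pK']] [qs qs' q0 q0' [qK qK']] gs g0 fs E.
move/(ext_tangentP _ gs) => [v [u [vs us H]]].
apply/(ext_tangentP _ fs).
have vps : smooth_germ 0 (fun w => v (phi' w)).
  by apply: (smooth_germ_comp (f := v) has_coords_plane ps'); rewrite p0'.
have uqs : smooth_germ 0 (fun w => u (psi' w)).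
  by apply: (smooth_germ_comp (f := u) has_coords_plane qs'); rewrite q0'.
exists (fun w => 'D_(v (phi' w)) phi (phi' w)), (fun y => 'D_(u (psi' y)) psi (psi' y)).
split; [exact: smooth_directional|exact: smooth_directional|].
have m (P : plane R -> Prop) : (\forall z \near (0 : plane R), P z) ->
    \forall z \near (0 : plane R), P (phi' z) by exact: near_comp0.
have m2 (P : plane R -> Prop) : (\forall z \near (0 : plane R), P z) ->
    \forall z \near (0 : plane R), P (g (phi' z)).
  by move=> nP; apply: (m (fun z => P (g z))); exact: near_comp0.
have n1 := near_and (m (fun z => h z = 'D_(v z) g z + u (g z)) H) (near_near E).
have n2 := near_and (m (fun z => \forall w \near z, phi' (phi w) = w) (near_near pK))
  (m (fun z => smooth_germ z phi) (smooth_germ_near ps)).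
have n3 := near_and (smooth_germ_near ps') (m (fun z => smooth_germ z g) (smooth_germ_near gs)).
have n4 := near_and (m2 (fun y => psi' (psi y) = y) qK)
  (m2 (fun y => smooth_germ y psi) (smooth_germ_near qs)).
have n12 := near_and n1 n2.
have n34 := near_and n3 n4.
apply: filterS3 n12 n34 pK' => w.
move=> [[Hw Ew] [pKw psw]] [[psw' gsw] [qKw qsw]] pKw'.
have fw : f w = psi (g (phi' w)) := nbhs_singleton Ew.
rewrite fw qKw /pushforward Hw.
have gd := smooth_germ_diff gsw; have qd := smooth_germ_diff qsw.
have add a b : 'D_(a + b) psi (g (phi' w)) = 'D_a psi (g (phi' w)) + 'D_b psi (g (phi' w)).
  by rewrite !deriveE // linearD.
rewrite add; clear add.
have psiG : smooth_germ (phi' w) (fun z => psi (g z)).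
  exact (smooth_germ_comp has_coords_plane gsw qsw).
have psdw' := smooth_germ_diff psw'.
pose V := 'D_(v (phi' w)) phi (phi' w).
have h1 := derive_comp V psdw' (smooth_germ_diff psiG).
have pKK : 'D_V phi' w = v (phi' w).
  have pKw'2 : smooth_germ (phi (phi' w)) phi' by rewrite pKw'.
  have := derive_inverse (v (phi' w)) psw pKw'2 pKw.
  by rewrite pKw'.
have h2 := derive_comp (v (phi' w)) gd qd.
rewrite pKK h2 -(near_eq_derive V Ew) in h1.
by rewrite -/V h1.
Qed.

(** Pushforward is linear over the constants, is inverted by the pushforward along the inverse
    changes, and maps tangent space to tangent space in both directions; it therefore maps a basis
    of one quotient to a basis of the other. *)
Lemma ext_codim_transfer f g d : smooth_germ 0 g -> g 0 = 0 -> A_equiv g f ->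
  ext_codim g d -> ext_codim f d.
Proof.
move=> gs g0 gf [e [es span free]].
have [fs f0] := A_equiv_smooth gs g0 gf.
have [p [p' [q [q' [dp dq E]]]]] := gf.
have [ps ps' p0 p0' [pK pK']] := dp; have [qs qs' q0 q0' [qK qK']] := dq.
have E' : \forall z \near (0 : plane R), g z = q' (f (p z)).
  have n := near_comp0 gs g0 qK.
  apply: filterS3 (near_comp0 ps p0 E) pK n => z -> -> qz.
  by rewrite qz.
pose T := pushforward p' q g; pose T' := pushforward p q' f.
have TS (c : 'I_d -> R) := pushforward_sum e c ps' p0' qs gs g0.
exists (fun i => T (e i)); split.
- by move=> i; exact: pushforward_smooth.
- move=> h hs; have [|c Hc] := span (T' h); first exact: pushforward_smooth.
  exists c; have := pushforward_tangent dp dq gs g0 fs E Hc.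
  apply: ext_tangent_near.
  have n := pushforwardK h (diffeo_germ_sym dp) (diffeo_germ_sym dq) fs f0 E'.
  by apply: filterS2 (TS c) n => z [_ ->] ->.
- move=> c Hc; apply: free.
  have := pushforward_tangent (diffeo_germ_sym dp) (diffeo_germ_sym dq) fs f0 gs E' Hc.
  apply: ext_tangent_near.
  have n := pushforwardK (fun z => \sum_i c i *: e i z) dp dq gs g0 E.
  have n' := near_comp0 ps p0 (TS c).
  by apply: filterS2 n n' => z <- [S _]; rewrite {1}/pushforward -S.
Qed.

Lemma derive_prefoldX c z : smooth_germ z c ->
  'D_eX (prefold c) z = (1, z.2 ^+ 2 * 'D_eX c z).
Proof.
move=> cs; have s1 : smooth_germ z (fun w : plane R => w.2 * c w).
  by apply: smooth_germM => //; exact: smooth_snd.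
have s2 : smooth_germ z (fun w : plane R => w.2 * (w.2 * c w)).
  by apply: smooth_germM => //; exact: smooth_snd.
have -> : prefold c = fun w => (w.1, w.2 * (w.2 * c w)).
  by apply/funext => w; rewrite /prefold expr2 mulrA.
rewrite (derive_pairl _ (smooth_germ_diff s2)) (derive_mulX s1) (derive_mulX cs).
by rewrite mulrA -expr2.
Qed.

Lemma derive_prefoldY c z : smooth_germ z c ->
  'D_eY (prefold c) z = (0, z.2 * prefold_m c z).
Proof.
move=> cs; have s1 : smooth_germ z (fun w : plane R => w.2 * c w).
  by apply: smooth_germM => //; exact: smooth_snd.
have s2 : smooth_germ z (fun w : plane R => w.2 * (w.2 * c w)).
  by apply: smooth_germM => //; exact: smooth_snd.
have -> : prefold c = fun w => (w.1, w.2 * (w.2 * c w)).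
  by apply/funext => w; rewrite /prefold expr2 mulrA.
rewrite (derive_pairl _ (smooth_germ_diff s2)) (derive_mulY s1) (derive_mulY cs).
by rewrite /prefold_m; move: ('D_eY c z) => y; congr (_, _); ring.
Qed.

(* The first component of a tangent vector determines the coefficient of the
   first partial derivative, which leaves one scalar equation. *)
Lemma ext_tangent_prefold c h : smooth_germ 0 c -> smooth_germ 0 h ->
  ext_tangent (prefold c) h <->
  exists b p q : plane R -> R, [/\ smooth_germ 0 b, smooth_germ 0 p, smooth_germ 0 q &
    \forall z \near (0 : plane R),
      (h z).2 = ((h z).1 - p (prefold c z)) * (z.2 ^+ 2 * 'D_eX c z) +
        b z * (z.2 * prefold_m c z) + q (prefold c z)].
Proof.
move=> cs hs; have cn := smooth_germ_near cs; split.
  move=> [a [b [u [as_ bs us E]]]]; exists b, (fun y => (u y).1), (fun y => (u y).2).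
  split; [by []|exact: smooth_germ_fst|exact: smooth_germ_snd|].
  apply: filterS2 E cn => z E cz; rewrite E /d_xi /d_t.
  rewrite (derive_prefoldX cz) (derive_prefoldY cz) /=.
  rewrite [_ *: 1]mulr1 scaler0 addr0 addrK.
  by [].
move=> [b [p [q [bs ps qs E]]]].
exists (fun z => (h z).1 - p (prefold c z)), b, (fun y => (p y, q y)).
split => //.
- apply: smooth_germB; first exact: smooth_germ_fst.
  apply: (smooth_germ_comp (f := p) has_coords_plane (prefold_smooth cs)).
  by rewrite prefold0.
- exact: smooth_germ_pair.
apply: filterS2 E cn => z E cz; rewrite /d_xi /d_t.
rewrite (derive_prefoldX cz) (derive_prefoldY cz).
rewrite [LHS]surjective_pairing E /=.
apply: injective_projections => //=.
by rewrite [_ *: 1]mulr1 scaler0 addr0 subrK.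
Qed.

End Codimension.

(** * The codimensions of the two normal forms *)

Section CodimensionValues.
Context {R : realType}.

Local Notation eX := ((1, 0) : plane R).
Local Notation eY := ((0, 1) : plane R).

(** Here [t m = 2 t]: the [t] derivative supplies all multiples of [t] in the second component, and
    what remains is a function of the first target coordinate. *)
Lemma ext_codim_prefold1 : ext_codim (prefold (fun=> 1 : R)) 0.
Proof.
have cs : smooth_germ 0 (fun _ : plane R => 1 : R) by exact: smooth_germ_cst.
exists (fun=> fun=> 0); split; [by case|move=> h hs|by move=> c _ []].
exists (fun=> 0); rewrite (_ : (fun z => _) = h); last first.
  by apply/funext => z; rewrite big_ord0 subr0.
have hs2 := smooth_germ_snd hs.
have qs : smooth_germ 0 (fun y : plane R => (h (y.1, 0)).2).
  apply: smooth_germ_snd; apply: smooth_germ_comp2 => //; first exact: smooth_fst.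
  exact: smooth_germ_cst.
have [||k ks hk] := @hadamard R (fun z => (h z).2 - (h (z.1, 0)).2).
- exact: smooth_germB.
- by apply: near_all => u /=; rewrite subrr.
apply/(ext_tangent_prefold cs hs).
exists (fun z => k z * 2^-1), (fun=> 0), (fun y => (h (y.1, 0)).2); split => //.
- by apply: smooth_germM => //; exact: smooth_germ_cst.
- exact: smooth_germ_cst.
apply: filterS hk => z E; rewrite /prefold_m !derive_cst /= !mulr0 add0r addr0 mulr1.
have -> : (h z).2 = z.2 * k z + (h (z.1, 0)).2 by rewrite -E subrK.
by move: ((h _).2) (k z) => u v; congr (_ + _); field.
Qed.

Lemma mulX_eq0 (a : R -> R) : smooth_germ 0 a ->
  (\forall x \near (0 : R), x * a x = 0) -> a 0 = 0.
Proof.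
move=> as_ E; have D : 'D_1 (fun x : R => x * a x) 0 = 0.
  by rewrite (near_eq_derive _ E) derive_cst.
move: D; rewrite deriveM_smooth; last 2 first.
- exact: smooth_germ_diff (smooth_germ_id _).
- exact: smooth_germ_diff.
by rewrite mul0r add0r derive_id mulr1.
Qed.

Lemma mulX_near0 (a : R -> R) : smooth_germ 0 a ->
  (\forall x \near (0 : R), x * a x = 0) -> \forall x \near (0 : R), a x = 0.
Proof.
move=> as_ E; have a0 := mulX_eq0 as_ E.
apply: filterS E => x; case: (eqVneq x 0) => [->//|x0 /eqP].
by rewrite mulf_eq0 (negPf x0) /= => /eqP.
Qed.

Lemma smooth_graph (a : R -> R) (f : plane R -> R) : smooth_germ 0 a -> a 0 = 0 ->
  smooth_germ 0 f -> smooth_germ 0 (fun x : R => f (x, a x)).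
Proof.
move=> as_ a0 fs; apply: smooth_germ_comp2 => //; first exact: smooth_germ_id.
by rewrite a0.
Qed.

Lemma near_graph (a : R -> R) (P : plane R -> Prop) : smooth_germ 0 a -> a 0 = 0 ->
  (\forall z \near (0 : plane R), P z) -> \forall x \near (0 : R), P (x, a x).
Proof.
move=> as_ a0 nP; apply: (@near_comp0 _ _ _ (fun x : R => (x, a x))) => //.
  by apply: smooth_germ_pair => //; exact: smooth_germ_id.
by rewrite a0.
Qed.

(** Hadamard's lemma is used twice, the second time after a shear that moves the line [t = k u] to
    the axis; [mulX_near0] ensures that the first quotient vanishes on this line also at the
    origin. *)
Lemma hadamard_lines (k : R) (g : plane R -> R) : k != 0 -> smooth_germ 0 g ->
  (\forall x \near (0 : R), g (x, 0) = 0) ->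
  (\forall x \near (0 : R), g (x, k * x) = 0) ->
  exists2 b, smooth_germ 0 b &
    \forall z \near (0 : plane R), g z = z.2 * ((z.2 - k * z.1) * b z).
Proof.
move=> k0 gs g0 gk; have [g1 g1s E] := hadamard gs g0.
have ls : smooth_germ 0 (fun x : R => k * x).
  by apply: smooth_germM; [exact: smooth_germ_cst|exact: smooth_germ_id].
have g1k : \forall x \near (0 : R), g1 (x, k * x) = 0.
  apply: mulX_near0; first by apply: smooth_graph => //; rewrite mulr0.
  have n := near_graph ls (mulr0 k) E.
  apply: filterS2 n gk => x /= -> /eqP.
  by rewrite -mulrA mulf_eq0 (negPf k0) => /eqP.
have s1 (e : R) : smooth_germ 0 (fun z : plane R => z.2 + e * z.1).
  apply: smooth_germD; first exact: smooth_snd.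
  by apply: smooth_germM; [exact: smooth_germ_cst|exact: smooth_fst].
have s2 (e : R) : smooth_germ 0 (fun z : plane R => (z.1, z.2 + e * z.1)).
  by apply: smooth_germ_pair; [exact: smooth_fst|exact: s1].
have s3 (e : R) (f : plane R -> R) : smooth_germ 0 f ->
    smooth_germ 0 (fun z : plane R => f (z.1, z.2 + e * z.1)).
  move=> fs; apply: smooth_germ_comp2 => //; first exact: smooth_fst.
  by rewrite /= mulr0 addr0.
have [||b bs E1] := @hadamard R (fun z => g1 (z.1, z.2 + k * z.1)); first exact: s3.
  by apply: filterS g1k => x /= E1; rewrite add0r.
exists (fun z => b (z.1, z.2 + - k * z.1)); first exact: s3.
have z0 : (((0 : plane R).1, (0 : plane R).2 + - k * (0 : plane R).1) : plane R) = 0.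
  by rewrite /= mulr0 addr0.
have n := near_comp0 (s2 (- k)) z0 E1.
apply: filterS2 E n => z -> /=; rewrite mulNr subrK -surjective_pairing => ->.
by [].
Qed.

Let c (z : plane R) : R := z.1 - z.2.

Let c_smooth z : smooth_germ z c.
Proof. by apply: smooth_germB; [exact: smooth_fst|exact: smooth_snd]. Qed.

Let c_derive z v : 'D_v c z = v.1 - v.2.
Proof.
rewrite deriveB_smooth; last 2 first.
- exact: smooth_germ_diff (smooth_fst _).
- exact: smooth_germ_diff (smooth_snd _).
rewrite (derive_linear (L := fst)); last exact: continuous_fst.
by rewrite (derive_linear (L := snd)) //; exact: continuous_snd.
Qed.

Let tangent (h : plane R -> plane R) : smooth_germ 0 h ->
  ext_tangent (prefold c) h <->
  exists b p q : plane R -> R, [/\ smooth_germ 0 b, smooth_germ 0 p, smooth_germ 0 q &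
    \forall z \near (0 : plane R),
      (h z).2 = ((h z).1 - p (prefold c z)) * z.2 ^+ 2 +
        b z * (z.2 * (2 * z.1 - 3 * z.2)) + q (prefold c z)].
Proof.
move=> hs; apply: iff_trans (ext_tangent_prefold (c_smooth 0) hs) _.
have m z : prefold_m c z = 2 * z.1 - 3 * z.2.
  by rewrite /prefold_m c_derive /c /=; ring.
by split=> -[b [p [q [bs ps qs E]]]]; exists b, p, q; split => //;
  apply: filterS E => z ->; rewrite m c_derive /= subr0 mulr1.
Qed.

(** Modulo multiples of [t (2 u - 3 t)] a function is known by its restrictions to the lines [t = 0]
    and [t = 2u/3]. The first is matched by [q]. On the second, [p t^2] starts at order two and [q]
    brings nothing new at order one, so the coefficient of [u] there is the one missing dimension,
    supplied by [(0, t)]. *)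
Lemma ext_codim_prefold_beaks : ext_codim (prefold (fun z : plane R => z.1 - z.2)) 1.
Proof.
rewrite -/c.
have es : smooth_germ 0 (fun z : plane R => (0, z.2) : plane R).
  by apply: smooth_germ_pair; [exact: smooth_germ_cst|exact: smooth_snd].
have k0 : (2 / 3 : R) != 0 by rewrite mulf_neq0 ?invr_eq0 ?pnatr_eq0.
have ls : smooth_germ 0 (fun x : R => 2 / 3 * x).
  by apply: smooth_germM; [exact: smooth_germ_cst|exact: smooth_germ_id].
have zs : smooth_germ 0 (fun _ : R => 0 : R) by exact: smooth_germ_cst.
exists (fun=> fun z => (0, z.2)); split => //.
- move=> h hs.
  pose k z := (h z).2 - (h z).1 * z.2 ^+ 2.
  have ks : smooth_germ 0 k.
    apply: smooth_germB; first exact: smooth_germ_snd.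
    apply: smooth_germM; first exact: smooth_germ_fst.
    by apply: smooth_germX; exact: smooth_snd.
  have kg a := smooth_graph (a := a) (f := k).
  have k1s := kg _ zs erefl ks; have k2s := kg _ ls (mulr0 _) ks.
  have [||r [rs _ Er]] := @hadamard1 R (fun x => k (x, 2 / 3 * x) - k (x, 0)).
  + exact: smooth_germB.
  + by rewrite mulr0 subrr.
  have [||s [ss _ Es]] := @hadamard1 R (fun x => r x - r 0).
  + by apply: smooth_germB => //; exact: smooth_germ_cst.
  + by rewrite subrr.
  (* On [t = 2u/3] the difference [k(u, 2u/3) - k(u, 0)] is [u r u]; [C t] has to match its part
     [u (r 0)] of order one. *)
  pose C := 3 / 2 * r 0.
  exists (fun=> C); under eq_fun do rewrite big_ord1.
  have hs' : smooth_germ 0 (fun z => h z - C *: ((0, z.2) : plane R)).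
    apply: smooth_germB => //; apply: smooth_germZ => //; exact: smooth_germ_cst.
  apply/(tangent hs').
  (* The rest [u^2 s u] is matched by [- p t^2], as [t^2 = 4/9 u^2] on this line. *)
  pose p (y : plane R) : R := - (9 / 4 * s y.1).
  pose q (y : plane R) : R := k (y.1, 0).
  have sf (a : R -> R) : smooth_germ 0 a -> smooth_germ 0 (fun y : plane R => a y.1).
    by move=> as_; apply: (smooth_germ_comp has_coords_R (smooth_fst _)).
  have ps : smooth_germ 0 p.
    by apply: smooth_germN; apply: smooth_germM; [exact: smooth_germ_cst|exact: sf].
  have qs : smooth_germ 0 q by exact: (sf (fun x => k (x, 0))).
  pose g z := k z - C * z.2 + p z * z.2 ^+ 2 - q z.
  have gs : smooth_germ 0 g.
    apply: smooth_germB => //; apply: smooth_germD.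
      apply: smooth_germB => //.
      by apply: smooth_germM; [exact: smooth_germ_cst|exact: smooth_snd].
    by apply: smooth_germM => //; apply: smooth_germX; exact: smooth_snd.
  have [||b bs Eb] := hadamard_lines k0 gs.
  + by apply: near_all => x; rewrite /g /q /= expr0n !mulr0 subr0 addr0 subrr.
  + apply: filterS2 Er Es => x Er Es; rewrite /g /q /p /C /=.
    have -> : k (x, 2 / 3 * x) = k (x, 0) + x * r x by rewrite -Er addrC subrK.
    have -> : r x = r 0 + x * s x by rewrite -Es addrC subrK.
    by field.
  exists (fun z => - (b z / 3)), p, q; split => //.
    by apply: smooth_germN; apply: smooth_germM => //; exact: smooth_germ_cst.
  apply: filterS Eb => z; rewrite /g /k /= scaler0 subr0.
  have -> : p (prefold c z) = p z by [].
  have -> : q (prefold c z) = q z by [].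
  have -> : C *: z.2 = C * z.2 by [].
  move: (h z) (p z) (q z) (b z) => [h1 h2] P Q B /= E.
  have -> : h2 = (h2 - h1 * z.2 ^+ 2 - C * z.2 + P * z.2 ^+ 2 - Q) +
    (h1 * z.2 ^+ 2 + C * z.2 - P * z.2 ^+ 2 + Q) by ring.
  by rewrite E; field.
- move=> a Ha [[|//] i0]; set i := Ordinal _.
  have es' : smooth_germ 0 (fun z : plane R => \sum_(j < 1) a j *: ((0, z.2) : plane R)).
    by apply: smooth_germ_sum => j; apply: smooth_germZ => //; exact: smooth_germ_cst.
  have [b [p [q [bs ps qs E]]]] := (tangent es').1 Ha.
  have E2 : \forall z \near (0 : plane R), a i * z.2 = - p (prefold c z) * z.2 ^+ 2 +
        b z * (z.2 * (2 * z.1 - 3 * z.2)) + q (prefold c z).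
    apply: filterS E => z; rewrite big_ord1 (_ : ord0 = i); last exact: val_inj.
    by rewrite /= scaler0 sub0r.
  (* On [t = 0] the equation says [q(u, 0) = 0], so [q] is divisible by the second target
     coordinate. *)
  have [|q1 q1s Eq] := hadamard qs.
    have n := near_axis E2; apply: filterS n => x.
    by rewrite /prefold /= expr0n /= !mulr0 mul0r !mulr0 !add0r mul0r => <-.
  (* [x A x = 0] is the equation restricted to the line [t = 2x/3], whose image is the curve
     [(x, 4/27 x^3)]; after division by [x] only the term with [a] survives at the origin. *)
  pose A x := 2 / 3 * a i + x * (4 / 9 * p (x, x ^+ 3 * (4 / 27)))
    - x ^+ 2 * (4 / 27 * q1 (x, x ^+ 3 * (4 / 27))).
  have cub : smooth_germ 0 (fun x : R => x ^+ 3 * (4 / 27)).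
    by apply: smooth_germM; [apply: smooth_germX; exact: smooth_germ_id|exact: smooth_germ_cst].
  have cub0 : 0 ^+ 3 * (4 / 27) = 0 :> R by rewrite expr0n mul0r.
  have As : smooth_germ 0 A.
    apply: smooth_germB; [apply: smooth_germD|]; first exact: smooth_germ_cst.
    - apply: smooth_germM; first exact: smooth_germ_id.
      by apply: smooth_germM; [exact: smooth_germ_cst|exact: smooth_graph].
    - apply: smooth_germM; first by apply: smooth_germX; exact: smooth_germ_id.
      by apply: smooth_germM; [exact: smooth_germ_cst|exact: smooth_graph].
  have : A 0 = 0.
    apply: mulX_eq0 => //.
    have n1 := near_graph ls (mulr0 _) E2.
    have n2 := near_graph cub cub0 Eq.
    apply: filterS2 n1 n2 => x /=.
    have -> : prefold c (x, 2 / 3 * x) = (x, x ^+ 3 * (4 / 27)).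
      by rewrite /prefold /c /=; congr (_, _); field.
    move=> E3 E4; rewrite E4 in E3; rewrite /A; move: E3.
    move: (p _) (q1 _) (b _) (a i) => P Q B ai E3.
    have -> : x * (2 / 3 * ai + x * (4 / 9 * P) - x ^+ 2 * (4 / 27 * Q)) =
      ai * (2 / 3 * x) - (- P * (2 / 3 * x) ^+ 2 +
       B * (2 / 3 * x * (2 * x - 3 * (2 / 3 * x))) + x ^+ 3 * (4 / 27) * Q) by field.
    by rewrite E3 subrr.
  rewrite /A mul0r addr0 expr0n mul0r subr0 => /eqP.
  by rewrite mulf_eq0 (negPf k0) => /eqP.
Qed.

Lemma singularityI_ext_codim : singularity_ext_codim (singularityI R) 0.
Proof.
move=> f If.
have E := A_equiv_sym_smooth (germI_smooth 0) germI0 (germI_prefold (oner_neq0 R)).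
have s : smooth_germ 0 (prefold (fun=> 1 : R)).
  by apply: prefold_smooth; exact: smooth_germ_cst.
exact (ext_codim_transfer s (prefold0 _) (A_equiv_trans E If) ext_codim_prefold1).
Qed.

Lemma singularityII_ext_codim : singularity_ext_codim (singularityII R) 1.
Proof.
move=> f If.
have E := A_equiv_sym_smooth (germII_smooth 0) germII0 (@germII_prefold R).
have s := prefold_smooth (c_smooth 0).
exact (ext_codim_transfer s (prefold0 _) (A_equiv_trans E If) ext_codim_prefold_beaks).
Qed.

End CodimensionValues.

(** * Classification of the stable singularities *)

Section Classification.
Context {R : realType}.
Implicit Types f g : plane R -> plane R.

Lemma germI_tangential : tangential_family_germ (germI R).
Proof.
have -> : germI R = fun z => prefold (fun=> 1) (shear z).
  by apply/funext => z; rewrite /prefold /= mulr1.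
by apply: shear_tangential; exact: smooth_germ_cst.
Qed.

Lemma germII_tangential : tangential_family_germ (germII R).
Proof.
have -> : germII R = fun z => prefold (fun w => w.1 - w.2) (shear z).
  by apply/funext => z; rewrite /prefold /= addrK.
by apply: shear_tangential; apply: smooth_germB; [exact: smooth_fst|exact: smooth_snd].
Qed.

Lemma singularity_eq f g : smooth_germ 0 f -> f 0 = 0 -> A_equiv f g ->
  singularity f = singularity g.
Proof.
move=> fs f0 fg; have gf := A_equiv_sym_smooth fs f0 fg.
by apply/seteqP; split => h; [exact: A_equiv_trans gf|exact: A_equiv_trans fg].
Qed.

Lemma stable_tangential f : tangential_family_germ f -> stable (singularity f) ->
  singularity f = singularityI R \/ singularity f = singularityII R.
Proof.
move=> /pretangential_family[f0 fs fX fj] st; have [c cs fc] := prenormal f0 fs fX fj.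
have cf : A_equiv (prefold c) f := A_equiv_sym_smooth fs f0 fc.
have [c0|c0] := eqVneq (c 0) 0; last first.
  left; apply/esym/singularity_eq; [exact: germI_smooth|exact: germI0|].
  exact (A_equiv_trans (prefold_unit cs c0) cf).
have [[_ cX cY]|nB] := pselect [/\ c 0 = 0, 'D_((1, 0) : plane R) c 0 != 0 &
    'D_((0, 1) : plane R) c 0 != 0].
  right; apply/esym/singularity_eq; [exact: germII_smooth|exact: germII0|].
  exact (A_equiv_trans (prefold_beaks cs c0 cX cY) cf).
case: (unstable_prefold cs c0 _ _ st) => // B.
exact: nB ((beaks_prefold0 cs).1 B).
Qed.

End Classification.

Theorem theorem1 (R : realType) :
  [/\ tangential_family_germ (germI R) /\ tangential_family_germ (germII R),
      forall f : R * R -> R * R, tangential_family_germ f ->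
        (stable (singularity f) <->
         singularity f = singularityI R \/ singularity f = singularityII R),
      singularity_ext_codim (singularityI R) 0 &
      singularity_ext_codim (singularityII R) 1].
Proof.
split.
- by split; [exact: germI_tangential|exact: germII_tangential].
- move=> f tf; split; first exact: stable_tangential.
  by case=> ->; [exact: singularityI_stable|exact: singularityII_stable].
- exact: singularityI_ext_codim.
- exact: singularityII_ext_codim.
Qed.
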